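(* Let $F$ be a function field in one variable over $\mathbb{C}$ of genus $\mathfrak{g}$. Let $G_n = a_1 \alpha_1^n + \cdots + a_d \alpha_d^n$ and $H_m = b_1 \beta_1^m + \cdots + b_t \beta_t^m$ be two simple linear recurrence sequences with $a_i, \alpha_i, b_j, \beta_j \in F^*$ for $i=1,\ldots,d$ and $j=1,\ldots,t$. Assume that there exists a valuation $\nu$ of $F$ such that $\alpha_1$ and $\beta_1$ are the $\nu$-dominant roots with immediate effect of $G_n$ and $H_m$, respectively, that $\alpha_1, \beta_1 \notin \mathbb{C}$, and that $\alpha_1$ and $\beta_1$ are multiplicatively independent. Then there exists an effectively computable constant $C$, depending only on the $a_i, \alpha_i, b_j, \beta_j$ and $\mathfrak{g}$, such that for all distinct pairs $(n_1,m_1), (n_2,m_2) \in \mathbb{N}^2$ with $G_{n_1} - H_{m_1} = G_{n_2} - H_{m_2}$ we have $\max\{n_1,m_1,n_2,m_2\} \leq C$.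
   Context: $\mathbb{N}$ denotes the set of positive integers. Valuations of $F/\mathbb{C}$ are the discrete valuations $\nu: F^* \to \mathbb{Z}$ trivial on $\mathbb{C}^*$ (extensions of the valuations $\nu_c$, $c \in \mathbb{C}\cup\{\infty\}$, of $\mathbb{C}(x)$). For a sequence $G_n = a_1\alpha_1^n+\cdots+a_d\alpha_d^n$ and a valuation $\nu$, $\alpha_1$ is called the $\nu$-dominant root if either $d=1$ or $\nu(\alpha_1) < \min\{\nu(\alpha_2),\ldots,\nu(\alpha_d),0\}$. The $\nu$-dominant root $\alpha_1$ is said to have immediate effect if $\nu(a_1\alpha_1^n) < \min_{i=2,\ldots,d} \nu(a_i\alpha_i^n)$ for all $n \in \mathbb{N}$ (a vacuous condition when $d=1$). Two elements $\alpha,\beta \in F$ are multiplicatively independent if $\alpha^r\beta^s \in \mathbb{C}$ with $r,s\in\mathbb{Z}$ implies $r=s=0$. *)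

(* Defs.v *)
From HB Require Import structures.
From mathcomp Require Import all_boot all_order all_algebra all_field.
From mathcomp Require Import finmap.
From mathcomp Require Import boolp classical_sets functions cardinality fsbigop.
From mathcomp Require Import reals.
From mathcomp Require Import complex.

Set Implicit Arguments.
Unset Strict Implicit.
Unset Printing Implicit Defensive.

Import Order.TTheory GRing.Theory Num.Theory.
Local Open Scope classical_set_scope.
Local Open Scope ring_scope.

(* A function field in one variable over the complex numbers is a finite
   extension of the field of rational functions. *)
Notation ratfun R := {fraction {poly R[i]}}.
Notation funfield R := (fieldExtType (ratfun R)).

Section FunctionField.
Variables (R : realType) (F : funfield R).

Definition cst (c : R[i]) : F := (tofrac c%:P : ratfun R)%:A.

Definition is_constant (f : F) : Prop := exists c : R[i], f = cst c.

(* Surjectivity normalizes the valuation (and excludes the trivial one).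
   Valuations are only meaningful on nonzero elements: v 0 = 0 is a junk value
   which makes a valuation a single function F -> int, and which must be kept
   out of every inequality. *)
Record is_valuation (v : F -> int) : Prop := IsValuation {
  valuation0 : v 0 = 0;
  valuationM : forall f h : F, f != 0 -> h != 0 -> v (f * h) = v f + v h;
  valuationD : forall f h : F, f != 0 -> h != 0 -> f + h != 0 ->
    Num.min (v f) (v h) <= v (f + h);
  valuationC : forall c : R[i], c != 0 -> v (cst c) = 0;
  valuation_surj : exists2 f : F, f != 0 & v f = 1 }.

Record valuation : Type := Valuation {
  valuation_fun :> F -> int;
  valuationP : is_valuation valuation_fun }.

HB.instance Definition _ := gen_eqMixin valuation.
HB.instance Definition _ := gen_choiceMixin valuation.

(* The constants are algebraically closed, so every place has degree 1 and a
   divisor is a finitely supported integer function on the valuations. *)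
Definition is_divisor (D : valuation -> int) : Prop :=
  finite_set [set v | D v != 0].

Definition divisor_deg (D : valuation -> int) : int :=
  \sum_(v \in [set: valuation]) D v.

Definition riemann_roch_space (D : valuation -> int) : set F :=
  [set f | f = 0 \/ forall v : valuation, - D v <= v f].

Definition riemann_roch_dim (D : valuation -> int) (l : nat) : Prop :=
  exists e : 'I_l -> F,
    (forall f, riemann_roch_space D f <->
       exists c : 'I_l -> R[i], f = \sum_(i < l) cst (c i) * e i) /\
    (forall c : 'I_l -> R[i],
       \sum_(i < l) cst (c i) * e i = 0 -> forall i, c i = 0).

(* The genus is the maximum of deg D - l(D) + 1 over all divisors D. *)
Definition has_genus (g : nat) : Prop :=
  (forall D l, is_divisor D -> riemann_roch_dim D l ->
     divisor_deg D - l%:Z + 1 <= g%:Z) /\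
  (exists D l, [/\ is_divisor D, riemann_roch_dim D l &
     divisor_deg D - l%:Z + 1 = g%:Z]).

(* A recurrence with d.+1 roots; ord0 is the index of the root that may be dominant. *)
Definition recseq (d : nat) (a alpha : 'I_d.+1 -> F) (n : nat) : F :=
  \sum_(i < d.+1) a i * alpha i ^+ n.

Definition dominant_root (v : valuation) (d : nat) (alpha : 'I_d.+1 -> F)
    : Prop :=
  d.+1 = 1%N \/
  ((forall i, i != ord0 -> v (alpha ord0) < v (alpha i)) /\
   v (alpha ord0) < 0).

Definition immediate_effect (v : valuation) (d : nat)
    (a alpha : 'I_d.+1 -> F) : Prop :=
  forall n : nat, (0 < n)%N -> forall i, i != ord0 ->
    v (a ord0 * alpha ord0 ^+ n) < v (a i * alpha i ^+ n).

Definition mult_independent (f h : F) : Prop :=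
  forall r s : int, is_constant (f ^ r * h ^ s) -> r = 0 /\ s = 0.

(* Finite data on which the effective constant may depend: the genus and the
   divisors of all coefficients and roots.  The latter are given by one row of
   valuations for each v in the (finite) set of zeros and poles of these
   elements, listed in an arbitrary order; they determine the elements up to
   nonzero constant factors. *)
Definition zeros_poles (d t : nat) (a alpha : 'I_d.+1 -> F)
    (b beta : 'I_t.+1 -> F) : set valuation :=
  [set v : valuation | (exists i, v (a i) != 0 \/ v (alpha i) != 0) \/
           (exists j, v (b j) != 0 \/ v (beta j) != 0)].

Definition valuation_row (d t : nat) (a alpha : 'I_d.+1 -> F)
    (b beta : 'I_t.+1 -> F) (v : valuation)
    : seq int * seq int * seq int * seq int :=
  ([seq v (a i) | i <- enum 'I_d.+1], [seq v (alpha i) | i <- enum 'I_d.+1],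
   [seq v (b j) | j <- enum 'I_t.+1], [seq v (beta j) | j <- enum 'I_t.+1]).

Definition divisor_table (d t : nat) (a alpha : 'I_d.+1 -> F)
    (b beta : 'I_t.+1 -> F) : seq (seq int * seq int * seq int * seq int) :=
  [seq valuation_row a alpha b beta v
  | v <- enum_fset (fset_set (zeros_poles a alpha b beta))].

Definition data_code (g d t : nat) (a alpha : 'I_d.+1 -> F)
    (b beta : 'I_t.+1 -> F) : nat :=
  choice.pickle (g, divisor_table a alpha b beta).

End FunctionField.

(* The total recursive functions, as the closure of the basic functions under
   composition, primitive recursion and minimization of regular functions; in
   the last two clauses h is the function determined by the equations. *)
Inductive recursive : forall n : nat, (n.-tuple nat -> nat) -> Prop :=
| recursive_zero n : @recursive n (fun=> 0%N)
| recursive_succ : @recursive 1 (fun x => (thead x).+1)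
| recursive_proj n (i : 'I_n) : @recursive n (fun x => tnth x i)
| recursive_comp m n (f : m.-tuple nat -> nat)
    (k : 'I_m -> n.-tuple nat -> nat) :
    recursive f -> (forall i, recursive (k i)) ->
    @recursive n (fun x => f [tuple k i x | i < m])
| recursive_primrec n (f : n.-tuple nat -> nat) (k : n.+2.-tuple nat -> nat)
    (h : n.+1.-tuple nat -> nat) :
    recursive f -> recursive k ->
    (forall x : n.-tuple nat, h (cons_tuple 0%N x) = f x) ->
    (forall y (x : n.-tuple nat), h (cons_tuple y.+1 x) =
       k (cons_tuple y (cons_tuple (h (cons_tuple y x)) x))) ->
    recursive h
| recursive_min n (f : n.+1.-tuple nat -> nat) (h : n.-tuple nat -> nat) :
    recursive f ->
    (forall x : n.-tuple nat, f (cons_tuple (h x) x) = 0%N /\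
       forall y, (y < h x)%N -> f (cons_tuple y x) <> 0%N) ->
    recursive h.

Definition computable (Phi : nat -> nat) : Prop :=
  @recursive 1 (fun x => Phi (thead x)).

(* Main.v *)
From HB Require Import structures.
From mathcomp Require Import all_boot all_order all_algebra all_field.
From mathcomp Require Import finmap.
From mathcomp Require Import boolp classical_sets cardinality.
From mathcomp Require Import reals.
From mathcomp Require Import complex.
From mathcomp Require Import zify ring.
Require Import Defs.

Set Implicit Arguments.
Unset Strict Implicit.
Unset Printing Implicit Defensive.

Import Order.TTheory GRing.Theory Num.Theory.
Local Open Scope ring_scope.

(** Suppose [G_n1 - H_m1 = G_n2 - H_m2], say with n1 > n2 and m1 > m2, and put
    f = a_1 (1 - alpha_1^(n2 - n1)), h = b_1 (1 - beta_1^(m2 - m1)).  Dominance at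
    v forces f alpha_1^n1 - h beta_1^m1 to vanish at v, relative to its two terms,
    to an order growing with min(n1, m1); keeping only the leading terms of f and h
    first bounds one of n1 - n2, m1 - m2, and then the other.

    On the other hand, let u = f alpha_1^n1 / (h beta_1^m1).  If u is not 1, the
    order of u - 1 at v is bounded independently of the exponents: it is controlled
    by the order of the logarithmic derivative of u, which is an integral
    combination of the logarithmic derivatives of f, h, alpha_1, beta_1.  These
    functions satisfy polynomial relations over C[1/alpha_1] of degree bounded in
    terms of their divisors, hence so does the combination after clearing
    denominators, and a Liouville estimate bounds its order at v.  If u is 1, the
    exponents are bounded by Cramer's rule, since the divisors of alpha_1 and
    beta_1 are linearly independent.

    The relations of bounded degree come from l(D) <= 1 + deg D for D >= 0, which
    needs only that the residue fields are C and that a function without poles is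
    constant.  The bound therefore depends on the divisors alone. *)

(** * Constants and valuations *)

(** The elimination runs in rounds because the bound on the order of [u - 1] depends on the poles of
    [f] and [h], and those of [1 - alpha_1^-k] grow with the gap [k]. With [f], [h] replaced by
    [a_1], [b_1] the heights are fixed, but the error only has order about the least of [k], the
    other gap [l] and [min(n1, m1)]. Once one gap is bounded, its full factor has bounded height and
    the next round removes that gap from the minimum. The exponents do not affect the bound on
    [u - 1] because they enter the logarithmic derivative only as integer coefficients: nonzero
    constants have order 0 at every place. Heights count poles only, inside a fixed finite list of
    places, since the zeros of [1 - alpha_1^-k] can lie anywhere; zeros at a given place are
    controlled by a polynomial relation. A sequence with a single term satisfies dominance
    vacuously, and its root may have no pole at [v]. That case is treated apart, with a pole of the
    root as another place. *)

Lemma sub_divE (K : fieldType) (a b c d : K) : b != 0 -> d != 0 ->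
  a / b - c / d = (b * d)^-1 * ((a - c) * d - (b - d) * c).
Proof. by move=> b0 d0; field; rewrite b0 d0. Qed.

Section Constants.
Variables (R : realType) (F : funfield R).
Local Notation C := R[i].

Lemma cst_is_zmod_morphism : zmod_morphism (@cst R F).
Proof. by move=> a b; rewrite /cst polyCB tofracB scalerBl. Qed.

Lemma cst_is_monoid_morphism : monoid_morphism (@cst R F).
Proof.
split=> [|a b]; first by rewrite /cst tofrac1 scale1r.
by rewrite /cst polyCM tofracM -scalerAl mul1r scalerA.
Qed.

HB.instance Definition _ := GRing.isZmodMorphism.Build C F (@cst R F)
  cst_is_zmod_morphism.
HB.instance Definition _ := GRing.isMonoidMorphism.Build C F (@cst R F)
  cst_is_monoid_morphism.

Definition ev (z : F) (p : {poly C}) : F := (map_poly (@cst R F) p).[z].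

Lemma ev_is_zmod_morphism z : zmod_morphism (ev z).
Proof. by move=> p q; rewrite /ev rmorphB hornerD hornerN. Qed.

Lemma ev_is_monoid_morphism z : monoid_morphism (ev z).
Proof. by split=> [|p q]; rewrite /ev ?rmorph1 ?hornerE // rmorphM hornerM. Qed.

HB.instance Definition _ z := GRing.isZmodMorphism.Build {poly C} F (ev z)
  (ev_is_zmod_morphism z).
HB.instance Definition _ z := GRing.isMonoidMorphism.Build {poly C} F (ev z)
  (ev_is_monoid_morphism z).

Lemma evC z c : ev z c%:P = cst F c.
Proof. by rewrite /ev map_polyC hornerC. Qed.

Lemma evX z : ev z 'X = z.
Proof. by rewrite /ev map_polyX hornerX. Qed.

Lemma evD z : {morph ev z : p q / p + q}. Proof. exact: rmorphD. Qed.
Lemma evB z : {morph ev z : p q / p - q}. Proof. exact: rmorphB. Qed.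
Lemma evM z : {morph ev z : p q / p * q}. Proof. exact: rmorphM. Qed.
Lemma ev0 z : ev z 0 = 0. Proof. exact: rmorph0. Qed.
Lemma ev1 z : ev z 1 = 1. Proof. exact: rmorph1. Qed.
Lemma evXn z p n : ev z (p ^+ n) = ev z p ^+ n. Proof. exact: rmorphXn. Qed.

Lemma evE z p : ev z p = \sum_(i < size p) cst F p`_i * z ^+ i.
Proof.
rewrite /ev horner_coef size_map_poly.
by apply: eq_bigr => i _; rewrite coef_map.
Qed.

Lemma ev_poly z n (E : nat -> C) :
  ev z (\poly_(i < n) E i) = \sum_(i < n) cst F (E i) * z ^+ i.
Proof.
rewrite poly_def (raddf_sum (ev z)); apply: eq_bigr => i _.
by rewrite -mul_polyC /= evM evC evXn evX.
Qed.

Lemma cst_eq0 c : (cst F c == 0) = (c == 0).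
Proof. exact: fmorph_eq0. Qed.

Lemma is_constant0 : is_constant (0 : F).
Proof. by exists 0; rewrite rmorph0. Qed.

Lemma algebraic_is_constant z p : p != 0 -> ev z p = 0 -> is_constant z.
Proof.
have [r ->] := closed_field_poly_normal p.
have [->|lc0] := eqVneq (lead_coef p) 0; first by rewrite scale0r eqxx.
move=> _; rewrite -mul_polyC evM evC => /eqP; rewrite mulf_eq0 cst_eq0 (negPf lc0) /=.
move=> /eqP; elim: r => [|a r IH].
  by rewrite big_nil ev1 => /eqP; rewrite oner_eq0.
rewrite big_cons evM => /eqP; rewrite mulf_eq0 => /orP[|/eqP //].
by rewrite evB evX evC subr_eq0 => /eqP ->; exists a.
Qed.

End Constants.
Arguments ev {R F}.

Section ValuationBasics.
Variables (R : realType) (F : funfield R) (w : valuation F).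
Local Notation C := R[i].
Implicit Types (f h : F) (k l : int).

Lemma valM f h : f != 0 -> h != 0 -> w (f * h) = w f + w h.
Proof. exact: valuationM (valuationP w) f h. Qed.

Lemma val0 : w 0 = 0. Proof. exact: valuation0 (valuationP w). Qed.

Lemma val_cst c : w (cst F c) = 0.
Proof.
have [->|] := eqVneq c 0; first by rewrite rmorph0 val0.
exact: valuationC (valuationP w) c.
Qed.

Lemma val1 : w 1 = 0.
Proof. by rewrite -(rmorph1 (@cst R F)) val_cst. Qed.

Lemma valN f : w (- f) = w f.
Proof.
have [->|f0] := eqVneq f 0; first by rewrite oppr0.
rewrite -mulN1r valM ?oppr_eq0 ?oner_eq0 //.
by rewrite -(rmorph1 (@cst R F)) -rmorphN val_cst add0r.
Qed.

Lemma valV f : w f^-1 = - w f.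
Proof.
have [->|f0] := eqVneq f 0; first by rewrite invr0 val0 oppr0.
apply: (addrI (w f)); rewrite -valM ?invr_eq0 // mulfV // val1 subrr //.
Qed.

Lemma valX f n : w (f ^+ n) = n%:Z * w f.
Proof.
have [->|f0] := eqVneq f 0.
  by rewrite val0 mulr0; case: n => [|n]; rewrite ?expr0 ?val1 // exprS mul0r val0.
elim: n => [|n IH]; first by rewrite expr0 val1 mul0r.
by rewrite exprS valM ?expf_neq0 // IH intS mulrDl mul1r.
Qed.

(* [w f >= k] with the convention [w 0 = oo], instead of the junk value [w 0 = 0]. *)
Definition vge k f := (f == 0) || (k <= w f).

Lemma vge0 k : vge k 0. Proof. by rewrite /vge eqxx. Qed.

Lemma vge_neq0 k f : f != 0 -> vge k f = (k <= w f).
Proof. by rewrite /vge => /negPf->. Qed.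

Lemma vge_val f : vge (w f) f. Proof. by rewrite /vge lexx orbT. Qed.

Lemma vgeW k l f : k <= l -> vge l f -> vge k f.
Proof.
rewrite /vge => kl /orP[->//|lf]; apply/orP; right; exact: le_trans lf.
Qed.

Lemma vgeN k f : vge k (- f) = vge k f.
Proof. by rewrite /vge oppr_eq0 valN. Qed.

Lemma vgeD k f h : vge k f -> vge k h -> vge k (f + h).
Proof.
rewrite {1 2}/vge.
have [->|f0] := eqVneq f 0; first by rewrite add0r.
have [->|h0] := eqVneq h 0; first by rewrite addr0 orFb => kf _; rewrite vge_neq0.
move=> /= kf kh; rewrite /vge; have [//|s0 /=] := eqVneq (f + h) 0.
apply: le_trans (valuationD (valuationP w) f0 h0 s0).
by rewrite le_min kf.
Qed.

Lemma vgeB k f h : vge k f -> vge k h -> vge k (f - h).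
Proof. by move=> kf kh; apply: vgeD => //; rewrite vgeN. Qed.

Lemma vgeM k l f h : vge k f -> vge l h -> vge (k + l) (f * h).
Proof.
rewrite {1 2}/vge.
have [->|f0] := eqVneq f 0; first by rewrite mul0r vge0.
have [->|h0] := eqVneq h 0; first by rewrite mulr0 vge0.
by move=> /= kf kh; rewrite vge_neq0 ?mulf_neq0 // valM // lerD.
Qed.

Lemma vgeMl k f h : vge 0 f -> vge k h -> vge k (f * h).
Proof. by move=> f0 kh; rewrite -[k]add0r vgeM. Qed.

Lemma vgeMr k f h : vge k f -> vge 0 h -> vge k (f * h).
Proof. by move=> kf h0; rewrite -[k]addr0 vgeM. Qed.

Lemma vgeX k f n : vge k f -> vge (n%:Z * k) (f ^+ n).
Proof.
move=> kf; elim: n => [|n IH]; first by rewrite mul0r -val1 vge_val.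
by rewrite exprS intS mulrDl mul1r vgeM.
Qed.

Lemma vge_cst c : vge 0 (cst F c).
Proof. by rewrite -(val_cst c) vge_val. Qed.

Lemma vge_nat n : vge 0 n%:R.
Proof. by rewrite -(rmorph_nat (@cst R F)) vge_cst. Qed.

Lemma vge0X f n : vge 0 f -> vge 0 (f ^+ n).
Proof. by move/(vgeX n); rewrite mulr0. Qed.

Lemma vge_sum (I : Type) (r : seq I) (P : pred I) k (f : I -> F) :
  (forall i, P i -> vge k (f i)) -> vge k (\sum_(i <- r | P i) f i).
Proof.
by move=> kf; elim/big_ind: _ => //; [exact: vge0 | move=> x y; exact: vgeD].
Qed.

Lemma vgeMZ k f h : f != 0 -> vge (w f + k) (f * h) = vge k h.
Proof.
move=> f0; have [->|h0] := eqVneq h 0; first by rewrite mulr0 !vge0.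
by rewrite !vge_neq0 ?mulf_neq0 // valM // lerD2l.
Qed.

Lemma vge_lt k f : ~~ vge k f -> f != 0 /\ w f < k.
Proof. by rewrite /vge negb_or -ltNge => /andP[]. Qed.

(** The sum has a unique term of least valuation. The part [f + h != 0] serves to refute relations
    in which one term strictly dominates. *)
Lemma val_eqD f h : f != 0 -> vge (w f + 1) h -> f + h != 0 /\ w (f + h) = w f.
Proof.
move=> f0 hh.
have s1 : ~~ vge (w f + 1) (f + h).
  apply/negP => /vgeB /(_ hh); rewrite addrK vge_neq0 //; lia.
have [s0 ws] := vge_lt s1; split=> //.
have : vge (w f) (f + h).
  by apply: vgeD; [exact: vge_val | apply: vgeW hh; lia].
rewrite vge_neq0 //; lia.
Qed.

Lemma vge_ev (z : F) (p : {poly C}) : vge 0 z -> vge 0 (ev z p).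
Proof.
move=> z0; rewrite evE; apply: vge_sum => i _.
by apply: vgeMr; [exact: vge_cst | exact: vge0X].
Qed.

Lemma uniformizer : exists pi, pi != 0 /\ w pi = 1.
Proof. by have [pi] := valuation_surj (valuationP w); exists pi. Qed.

Lemma val_ev0 (z : F) (p : {poly C}) : z != 0 -> 0 < w z -> p.[0] != 0 ->
  ev z p != 0 /\ w (ev z p) = 0.
Proof.
move=> z0 wz; rewrite horner_coef0 => p0.
have -> : p = (p`_0)%:P + (p - (p`_0)%:P) by rewrite addrC subrK.
have /factor_theorem[q ->] : root (p - (p`_0)%:P) 0.
  by rewrite rootE !hornerE horner_coef0 subrr.
have vq : vge (0 + 1) (ev z (q * ('X - 0%:P))).
  rewrite subr0 evM evX; apply: vgeMl; last by rewrite vge_neq0.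
  by apply: vge_ev; rewrite vge_neq0 // ltW.
have := @val_eqD (cst F p`_0) (ev z (q * ('X - 0%:P))).
rewrite val_cst cst_eq0 => /(_ p0 vq).
by rewrite evD evC.
Qed.

Lemma valXz f (r : int) : w (f ^ r) = r * w f.
Proof.
case: r => n; first by rewrite -exprnP valX.
by rewrite NegzE -exprnN valV valX mulNr.
Qed.

End ValuationBasics.

(** * Places of C(x) and residues *)

Section RationalSubfield.
Variables (R : realType) (F : funfield R).
Local Notation C := R[i].
Local Notation K := (ratfun R).

Definition xF : F := (tofrac 'X : K)%:A.

Definition ratF (k : K) : F := k%:A.

Lemma ratF_is_zmod_morphism : zmod_morphism ratF.
Proof. by move=> k l; rewrite /ratF scalerBl. Qed.

Lemma ratF_is_monoid_morphism : monoid_morphism ratF.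
Proof.
by split=> [|k l]; rewrite /ratF ?scale1r // -scalerAl mul1r scalerA.
Qed.

HB.instance Definition _ := GRing.isZmodMorphism.Build K F ratF
  ratF_is_zmod_morphism.
HB.instance Definition _ := GRing.isMonoidMorphism.Build K F ratF
  ratF_is_monoid_morphism.

Lemma ratF_div k l : ratF (k / l) = ratF k / ratF l.
Proof. exact: fmorph_div. Qed.

Lemma ratF_eq0 k : (ratF k == 0) = (k == 0).
Proof. exact: fmorph_eq0. Qed.

Lemma ratF0 : ratF 0 = 0. Proof. exact: rmorph0. Qed.
Lemma ratF1 : ratF 1 = 1. Proof. exact: rmorph1. Qed.

Lemma ev_xF p : ev xF p = ratF (tofrac p).
Proof.
elim/poly_ind: p => [|p c IH]; first by rewrite ev0 tofrac0 ratF0.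
by rewrite evD evM evX evC IH tofracD tofracM rmorphD rmorphM.
Qed.

Lemma ratfun_quotient (k : K) :
  exists p q : {poly C}, q != 0 /\ k = tofrac p / tofrac q.
Proof.
exists (\n_(repr k)), (\d_(repr k)); split; first exact: denom_ratioP.
have <- : k * tofrac (\d_(repr k)) = tofrac (\n_(repr k)).
  rewrite -{1}[k]reprK; unlock tofrac.
  rewrite -[LHS]FracField.pi_mul; apply/eqmodP => /=.
  rewrite FracField.equivfE /FracField.mulf.
  by rewrite !numden_Ratio ?mulf_neq0 ?oner_eq0 ?denom_ratioP // !mulr1 mulrC.
by rewrite mulfK // tofrac_eq0 denom_ratioP.
Qed.

(** These are uniformizers of places of C(x), so ramification may give them order above 1 in F. The
    inverse serves the place at infinity, for any [z]. *)
Definition local_parameter (tau : F) : Prop :=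
  tau != 0 /\ exists z, tau = xF - cst F z \/ tau = (xF - cst F z)^-1.

Lemma local_parameter_poly (tau : F) (p : {poly C}) :
  local_parameter tau -> p != 0 ->
  exists e : int, exists q : {poly C}, q.[0] != 0 /\ ev xF p = tau ^ e * ev tau q.
Proof.
move=> [tau0 [z tauE]] p0.
pose y := xF - cst F z; pose r := p \Po ('X + z%:P).
have r0 : r != 0 by rewrite comp_poly_eq0 ?size_XaddC.
have rE : ev xF p = ev y r.
  rewrite /r /y; elim/poly_ind: p {p0 r r0} => [|p c IH].
    by rewrite comp_poly0 !ev0.
  rewrite comp_polyD comp_polyM comp_polyX comp_polyC !evD !evM IH !evC !evX.
  by rewrite evD evX evC subrK.
rewrite rE; case: tauE => tauE.
  have [m [q]] := multiplicity_XsubC r 0.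
  rewrite r0 /= => q0 ->; exists m, q; split; first by rewrite -rootE.
  by rewrite evM evXn evB evX evC rmorph0 subr0 /y -tauE -exprnP mulrC.
(* At infinity the polynomial is reversed: the top power of [y] is factored out, and the leading
   coefficient becomes the constant term in [tau]. *)
exists (- (size r).-1%:Z), (\poly_(i < size r) r`_((size r).-1 - i)).
rewrite horner_coef0 coef_poly lt0n size_poly_eq0 r0 subn0 -lead_coefE lead_coef_eq0 r0.
split=> //; have yE : y = tau^-1 by rewrite tauE invrK.
rewrite evE -exprnN -exprVn -yE.
have -> : ev tau (\poly_(i < size r) r`_((size r).-1 - i)) =
   \sum_(i < size r) cst F r`_((size r).-1 - i) * tau ^+ i.
  exact: ev_poly.
rewrite mulr_sumr (reindex_inj rev_ord_inj) /=.
apply: eq_bigr => i _; have si := ltn_ord i.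
have -> : (size r - i.+1 = (size r).-1 - i)%N by lia.
have e n (j : nat) : (j < n)%N -> n.-1 = (n.-1 - j + j)%N by lia.
rewrite [X in _ = y ^+ X * _](e _ _ si).
rewrite exprD [RHS]mulrCA; congr (_ * _).
by rewrite -mulrA yE !exprVn mulVf ?mulr1 ?expf_neq0.
Qed.

Lemma local_parameter_decomp (tau : F) (k : K) :
  local_parameter tau -> k != 0 ->
  exists e : int, exists p q : {poly C}, [/\ p.[0] != 0, q.[0] != 0 &
    ratF k = tau ^ e * (ev tau p / ev tau q)].
Proof.
move=> tauP; have [p [q [q0 ->]]] := ratfun_quotient k => k0.
have p0 : p != 0 by apply: contra_neq k0 => ->; rewrite tofrac0 mul0r.
have [e1 [p1 [p10 pE]]] := local_parameter_poly tauP p0.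
have [e2 [q1 [q10 qE]]] := local_parameter_poly tauP q0.
exists (e1 - e2), p1, q1; split=> //.
rewrite ratF_div -!ev_xF pE qE invfM mulrACA.
by case: tauP => ? _; rewrite expfzDr // -invr_expz.
Qed.

Lemma algebraic_relation (f : F) : exists q : {poly K},
  [/\ q \is monic, (size q <= (\dim {:F}).+1)%N &
      \sum_(i < size q) ratF q`_i * f ^+ i = 0].
Proof.
have /polyOver1P[q qE] := minPolyOver 1 f.
have mon : q \is monic by rewrite -(map_monic (in_alg F)) -qE monic_minPoly.
have sq : size q = size (minPoly 1 f) by rewrite qE size_map_poly.
exists q; split=> //.
  rewrite sq size_minPoly ltnS.
  have := dim_Fadjoin 1%AS f; rewrite dimv1 muln1 => <-.
  by rewrite dimvS ?subvf.
have := minPolyxx 1 f; rewrite qE horner_coef size_map_poly => {2}<-.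
by apply: eq_bigr => i _; rewrite coef_map.
Qed.

(** If [w f] were negative, the top power would dominate the monic relation of [f], whose nonzero
    coefficients have valuation 0; inversion covers positive [w f]. *)
Lemma algebraic_nontrivial (w : valuation F) (f : F) : f != 0 ->
  (forall k : K, k != 0 -> w (ratF k) = 0) -> w f = 0.
Proof.
wlog f0 : f / w f <= 0 => [wl fn0 wk|].
  have [|/ltW wf] := leP (w f) 0; first by move=> ?; apply: wl.
  by apply: oppr_inj; rewrite oppr0 -valV; apply: wl; rewrite ?invr_eq0 // valV; lia.
move=> fn0 wk; have [q [qmon _ q0]] := algebraic_relation f.
apply/eqP; rewrite eq_le f0 /= leNgt; apply/negP => wf.
have sq : (0 < size q)%N by rewrite size_poly_gt0 monic_neq0.
move: q0; rewrite -(prednK sq) big_ord_recr /= -lead_coefE (monicP qmon) ratF1 mul1r.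
set n := (size q).-1; rewrite addrC => q0.
have := @val_eqD _ _ w (f ^+ n) (\sum_(i < n) ratF q`_i * f ^+ i).
rewrite q0 eqxx expf_neq0 //.
case=> //; apply: vge_sum => i _.
have [->|qi] := eqVneq q`_i 0; first by rewrite ratF0 mul0r vge0.
rewrite vge_neq0 ?mulf_neq0 ?expf_neq0 //; last by rewrite ratF_eq0.
rewrite valM ?expf_neq0 //; last by rewrite ratF_eq0.
rewrite wk // !valX add0r; have := ltn_ord i; nia.
Qed.

(** Otherwise [w] vanishes on every [x - z], hence on C(x) by factoring polynomials, hence on F,
    against surjectivity. *)
Lemma local_parameter_exists (w : valuation F) :
  exists tau, local_parameter tau /\ 0 < w tau.
Proof.
apply: contrapT => /forallNP ntau.
have wz z : w (xF - cst F z) = 0.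
  have [->|n0] := eqVneq (xF - cst F z) 0; first exact: val0.
  have [w0|w0|//] := ltgtP (w (xF - cst F z)) 0.
    case: (ntau (xF - cst F z)^-1); split; last by rewrite valV; lia.
    by split; [rewrite invr_eq0|exists z; right].
  by case: (ntau (xF - cst F z)); split=> //; split=> //; exists z; left.
have wp (p : {poly C}) : w (ev xF p) = 0.
  have [r ->] := closed_field_poly_normal p.
  rewrite -mul_polyC evM evC.
  elim: r => [|a r IH]; first by rewrite big_nil ev1 mulr1 val_cst.
  rewrite big_cons evM mulrCA evB evX evC.
  have [->|n0] := eqVneq (xF - cst F a) 0; first by rewrite mul0r val0.
  have [e0|n1] := eqVneq (cst F (lead_coef p) * ev xF (\prod_(z <- r) ('X - z%:P))) 0.
    by rewrite e0 mulr0 val0.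
  by rewrite valM // IH wz.
have [pi [pi0]] := uniformizer w; rewrite algebraic_nontrivial // => k k0.
have [p [q [q0 kE]]] := ratfun_quotient k.
rewrite kE ratF_div -!ev_xF.
have [p0|p0] := eqVneq (ev (xF : F) p) 0; first by rewrite p0 mul0r val0.
have [e0|q1] := eqVneq (ev (xF : F) q) 0; first by rewrite e0 invr0 mulr0 val0.
by rewrite valM ?invr_eq0 // valV !wp.
Qed.

(** The exponent is the order at the place of C(x) below, common to all [w] over it. Inequalities
    between coefficients therefore pass from one such [w] to another. *)
Lemma val_ratfun (tau : F) (k : K) : local_parameter tau -> k != 0 ->
  exists e : int, forall w : valuation F, 0 < w tau -> w (ratF k) = e * w tau.
Proof.
move=> tauP k0; have [e [p [q [p0 q0 kE]]]] := local_parameter_decomp tauP k0.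
exists e => w wtau; have [tau0 _] := tauP.
have [p1 wp] := val_ev0 tau0 wtau p0; have [q1 wq] := val_ev0 tau0 wtau q0.
rewrite kE valM ?expfz_neq0 ?mulf_neq0 ?invr_eq0 //.
by rewrite valM ?invr_eq0 // valV wp wq valXz subrr addr0.
Qed.

Lemma residue_poly (w : valuation F) (z : F) (p : {poly C}) :
  z != 0 -> 0 < w z -> vge w 1 (ev z p - cst F p.[0]).
Proof.
move=> z0 wz; have /factor_theorem[q pE] : root (p - (p.[0])%:P) 0.
  by rewrite rootE !hornerE subrr.
rewrite -(evC z) -evB pE subr0 evM evX; apply: vgeMl; last by rewrite vge_neq0.
by apply: vge_ev; rewrite vge_neq0 // ltW.
Qed.

Lemma residue_ratfun (w : valuation F) (k : K) : vge w 0 (ratF k) ->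
  exists c, vge w 1 (ratF k - cst F c).
Proof.
have [->|k0] := eqVneq k 0; first by exists 0; rewrite ratF0 rmorph0 subr0 vge0.
have [tau [tauP wtau]] := local_parameter_exists w; have [tau0 _] := tauP.
have [e [p [q [p0 q0 kE]]]] := local_parameter_decomp tauP k0.
have [p1 wp] := val_ev0 tau0 wtau p0; have [q1 wq] := val_ev0 tau0 wtau q0.
have kA0 : ratF k != 0 :> F by rewrite ratF_eq0.
have wk : w (ratF k) = e * w tau.
  rewrite kE valM ?expfz_neq0 ?mulf_neq0 ?invr_eq0 //.
  by rewrite valM ?invr_eq0 // valV wp wq valXz subrr addr0.
rewrite vge_neq0 // wk; have [e0|e0|e0] := ltgtP e 0; first by nia.
  move=> _; exists 0; rewrite rmorph0 subr0 vge_neq0 // wk; nia.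
move=> _; exists (p.[0] / q.[0]); rewrite kE e0 expr0z mul1r.
rewrite fmorph_div.
have -> : ev tau p / ev tau q - cst F p.[0] / cst F q.[0] =
  (ev tau q * cst F q.[0])^-1 * ((ev tau p - cst F p.[0]) * cst F q.[0] -
   (ev tau q - cst F q.[0]) * cst F p.[0]).
  by apply: sub_divE => //; rewrite cst_eq0.
apply: vgeMl.
  by rewrite vge_neq0 ?invr_eq0 ?mulf_neq0 ?cst_eq0 // valV valM ?cst_eq0 // wq val_cst.
by apply: vgeB; apply: vgeMr; rewrite ?vge_cst ?residue_poly.
Qed.

Lemma val_minimal (w : valuation F) (I : finType) (k : I -> K) (i0 : I) :
  k i0 != 0 ->
  exists i, k i != 0 /\ forall j, vge w 0 (ratF (k j / k i)).
Proof.
move=> k0; have [i ki imin] := @arg_minP _ int _ _ (fun i => k i != 0)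
   (fun i => w (ratF (k i))) k0.
exists i; split=> [//|j]; have [kj0|kj] := eqVneq (k j) 0.
  by rewrite kj0 mul0r ratF0 vge0.
have ui : ratF (k i) != 0 by rewrite ratF_eq0.
have uj : ratF (k j) != 0 by rewrite ratF_eq0.
have {}imin := imin j kj.
rewrite ratF_div; move: (ratF (k i)) (ratF (k j)) ui uj imin => u v u0 v0 uv.
by rewrite vge_neq0 ?mulf_neq0 ?invr_eq0 // valM ?invr_eq0 // valV subr_ge0.
Qed.

(* If f has no residue, w vanishes on C(f), contradicting a relation of f over
   C(x) reduced at w. *)
Lemma residue (w : valuation F) (f : F) : vge w 0 f -> exists c, vge w 1 (f - cst F c).
Proof.
move=> f0; apply: contrapT => /forallNP nres.
have wp (p : {poly C}) : p != 0 -> ev f p != 0 /\ w (ev f p) = 0.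
  have [r ->] := closed_field_poly_normal p.
  have [->|lc0 _] := eqVneq (lead_coef p) 0; first by rewrite scale0r eqxx.
  rewrite -mul_polyC evM evC.
  have [b0 b1] : ev f (\prod_(z <- r) ('X - z%:P)) != 0 /\
                 w (ev f (\prod_(z <- r) ('X - z%:P))) = 0.
    elim: r => [|a r [IH0 IH]]; first by rewrite big_nil ev1 val1 oner_eq0.
    rewrite big_cons evM evB evX evC.
    have /negP/vge_lt[a0 wa] := nres a.
    have : vge w 0 (f - cst F a) by apply: vgeB => //; exact: vge_cst.
    rewrite vge_neq0 // => wa'; rewrite mulf_neq0 // valM // IH addr0; split=> //.
    lia.
  by rewrite mulf_neq0 ?cst_eq0 // valM ?cst_eq0 // val_cst b1.
have [q [qmon _ q0]] := algebraic_relation f.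
have sq : (0 < size q)%N by rewrite size_poly_gt0 monic_neq0.
have sq' : ((size q).-1 < size q)%N by rewrite prednK.
have lq : q`_(Ordinal sq') != 0.
  by rewrite /= -lead_coefE lead_coef_eq0 monic_neq0.
(* Division by a coefficient of least valuation makes all coefficients integral and one of them 1,
   so their residues form a nonzero complex polynomial. Its value at [f] is congruent to the
   relation, hence vanishes at [w], whereas [wp] gives it order 0. *)
have [i [qi kv]] := @val_minimal w _ (fun j : 'I_(size q) => q`_j) _ lq.
pose k (j : 'I_(size q)) := q`_j / q`_i.
have /choice[c cP] j := residue_ratfun (kv j).
pose c' n := if insub n is Some j then c j else 0.
have c'E (j : 'I_(size q)) : c' j = c j by rewrite /c' valK.
pose p := \poly_(j < size q) c' j.
have p0 : p != 0.
  apply/eqP => p0; have : vge w 1 (ratF (k i) : F).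
    have := cP i; suff -> : c i = 0 by rewrite rmorph0 subr0.
    by have := congr1 (fun p : {poly C} => p`_i) p0; rewrite coef_poly ltn_ord coef0 c'E.
  by rewrite /k mulfV // ratF1 vge_neq0 ?oner_eq0 // val1.
have [evp wevp] := wp p p0.
suff : vge w 1 (ev f p) by rewrite vge_neq0 // wevp.
have -> : ev f p = \sum_(j < size q) cst F (c j) * f ^+ j.
  by rewrite ev_poly; apply: eq_bigr => j _; rewrite c'E.
have kE : \sum_(j < size q) ratF (k j) * f ^+ j = 0.
  transitivity (ratF (q`_i)^-1 * \sum_(j < size q) ratF q`_j * f ^+ j); last by rewrite
      q0 mulr0.
  rewrite mulr_sumr; apply: eq_bigr => j _.
  by rewrite mulrA /k [q`_j / _]mulrC rmorphM.
rewrite -[\sum_(j < _) _]subr0 -[in X in _ - X]kE -sumrB; apply: vge_sum => j _.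
rewrite -mulrBl; apply: vgeMr; last exact: vge0X.
by rewrite -vgeN opprB; exact: cP.
Qed.

End RationalSubfield.

(** * Existence of places *)

Lemma mulf_cancel (K : fieldType) (a b f u : K) : f != 0 -> u != 0 ->
  a * b = a / f / u * b * (f * u).
Proof. by move=> f0 u0; field; rewrite f0 u0. Qed.

Lemma mulf_cancel_cross (K : fieldType) (a b v x : K) : b != 0 ->
  v * (a * x) = x * (b * (a / b * v)).
Proof. by move=> b0; field. Qed.

Lemma divf_div_same (K : fieldType) (a b x : K) : x != 0 -> a != 0 -> b != 0 ->
  x / b / (x / a) = a / b.
Proof. by move=> x0 a0 b0; field; rewrite x0 a0 b0. Qed.

Section PlaceExistence.
Variables (R : realType) (F : funfield R).
Local Notation C := R[i].
Local Notation K := (ratfun R).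
Implicit Types (A B : set F) (f z a b : F).

Record subring_over_cst (A : set F) : Prop := SubringOverCst {
  sring_cst : forall c, A (cst F c);
  sringB : forall a b, A a -> A b -> A (a - b);
  sringM : forall a b, A a -> A b -> A (a * b) }.

Section SubringTheory.
Variables (A : set F) (sA : subring_over_cst A).

Lemma sring0 : A 0. Proof. by rewrite -(rmorph0 (@cst R F)); exact: sring_cst. Qed.
Lemma sring1 : A 1. Proof. by rewrite -(rmorph1 (@cst R F)); exact: sring_cst. Qed.
Lemma sringN a : A a -> A (- a).
Proof. by move=> Aa; rewrite -sub0r; apply: sringB => //; exact: sring0. Qed.
Lemma sringD a b : A a -> A b -> A (a + b).
Proof. by move=> Aa /sringN Ab; rewrite -[b]opprK; apply: sringB. Qed.
Lemma sringX a n : A a -> A (a ^+ n).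
Proof.
move=> Aa; elim: n => [|n IH]; first by rewrite expr0; exact: sring1.
by rewrite exprS; apply: sringM.
Qed.
Lemma sring_sum (I : Type) (r : seq I) (P : pred I) (f : I -> F) :
  (forall i, P i -> A (f i)) -> A (\sum_(i <- r | P i) f i).
Proof.
by move=> h; elim/big_ind: _ => //; [exact: sring0|move=> *; exact: sringD].
Qed.
Lemma sring_ev z p : A z -> A (ev z p).
Proof.
move=> Az; rewrite evE; apply: sring_sum => i _.
by apply: sringM => //; [exact: sring_cst|exact: sringX].
Qed.

End SubringTheory.

(* Such an A is a valuation ring in which 1 / f is not a unit. *)
Record maximal_avoiding (f : F) (A : set F) : Prop := MaximalAvoiding {
  max_sring :> subring_over_cst A;
  max_inv : A f^-1;
  max_avoid : ~ A f;
  max_max : forall B, subring_over_cst B -> (A `<=` B)%classic -> ~ B f ->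
    (B `<=` A)%classic }.

Lemma maximal_avoiding_exists f : ~ is_constant f ->
  exists A, maximal_avoiding f A.
Proof.
move=> fnc.
pose good A := [/\ subring_over_cst A, A f^-1 & ~ A f].
pose P A := A = set0 \/ good A.
have goodP A a : P A -> A a -> good A by move=> [->|].
pose A0 : set F := [set z | exists p, z = ev f^-1 p]%classic.
have gA0 : good A0.
  split; [split| |].
  - by move=> c; exists c%:P; rewrite evC.
  - by move=> _ _ [p ->] [q ->]; exists (p - q); rewrite evB.
  - by move=> _ _ [p ->] [q ->]; exists (p * q); rewrite evM.
  - by exists 'X; rewrite evX.
  (* If [f] were [p] evaluated at [1/f], then [1/f] would be a root of ['X * p - 1], hence
     constant. *)
  case=> p fp; have f0 : f != 0.
    by apply/eqP => f0; apply: fnc; rewrite f0; exact: is_constant0.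
  suff [c fc] : is_constant f^-1.
    by apply: fnc; exists c^-1; rewrite (fmorphV (@cst R F)) /= -fc invrK.
  apply: (@algebraic_is_constant _ _ _ ('X * p - 1)).
    apply/eqP => /(congr1 (fun p : {poly C} => p.[0])).
    rewrite hornerD hornerM hornerX mul0r hornerN hornerC horner0 add0r.
    by move/eqP; rewrite oppr_eq0 oner_eq0.
  by rewrite evB evM evX ev1 -fp mulVf ?subrr.
have [|A [PA maxA]] := @Zorn_bigcup _ P.
  move=> H HP Htot.
  have [[X [HX [a Xa]]]|none] := pselect (exists X, H X /\ exists a, X a); last first.
    left; apply/seteqP; split=> // a [X HX Xa]; apply: none.
    by exists X; split=> //; exists a.
  have both u v : (\bigcup_(X in H) X)%classic u -> (\bigcup_(X in H) X)%classic v ->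
      exists Y, [/\ H Y, Y u & Y v].
    move=> [Y HY Yu] [Z HZ Zv]; have [YZ|ZY] := Htot _ _ HY HZ.
      by exists Z; split=> //; apply: YZ.
    by exists Y; split=> //; apply: ZY.
  have gX := goodP _ _ (HP _ HX) Xa.
  right; split; [split| |].
  - by move=> c; exists X => //; apply: sring_cst; case: gX.
  - move=> u v /both h/h [Y [HY Yu Yv]]; exists Y => //.
    by apply: sringB => //; case: (goodP _ _ (HP _ HY) Yu).
  - move=> u v /both h/h [Y [HY Yu Yv]]; exists Y => //.
    by apply: sringM => //; case: (goodP _ _ (HP _ HY) Yu).
  - by exists X => //; case: gX.
  - by case=> Y HY Yf; case: (goodP _ _ (HP _ HY) Yf).
have gA : good A.
  case: PA => // A_0; case: (maxA A0); last by right.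
  rewrite A_0; split; first by move=> x [].
  by move=> h; apply: (h f^-1); exists 'X; rewrite evX.
exists A; have [sA Afi Anf] := gA; split=> // B sB AB Bf; apply: contrapT => nBA.
by apply: (maxA B) => //; right; split=> //; exact: AB.
Qed.

(** * A maximal subring avoiding an element is a valuation ring *)

Section ValuationRing.
Variables (f : F) (A : set F) (mA : maximal_avoiding f A).

Let sA : subring_over_cst A := mA.

Lemma avoided_neq0 : f != 0.
Proof. by apply/eqP => f0; apply: (max_avoid mA); rewrite f0; exact: sring0. Qed.

(** By maximality, [s = 1 - b / f] can be inverted in [A] unless this captures [f], that is, unless
    some [f * s^j] lies in [A]. As [s^j] is 1 up to a multiple of [1/f] in [A], that would put [f]
    itself in [A]. *)
Lemma avoided_local b : A b -> 1 - f^-1 * b != 0 /\ A (1 - f^-1 * b)^-1.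
Proof.
move=> Ab; have f0 := avoided_neq0; set s := 1 - f^-1 * b.
have s0 : s != 0.
  apply/eqP => /eqP; rewrite subr_eq0 => /eqP /(congr1 ( *%R f)).
  by rewrite mulr1 mulrA mulfV // mul1r => fb; apply: (max_avoid mA); rewrite fb.
have As : A s.
  by apply: sringB => //; [exact: sring1|apply: sringM => //; exact: max_inv].
split=> //; pose B : set F := [set z | exists j, A (z * s ^+ j)]%classic.
apply: (max_max mA (B := B)); last by exists 1; rewrite expr1 mulVf //; exact: sring1.
- split.
  + by move=> c; exists 0; rewrite expr0 mulr1; exact: sring_cst.
  + move=> u v [i Au] [j Av]; exists (i + j)%N; rewrite mulrBl; apply: sringB => //.
      by rewrite exprD mulrA; apply: sringM => //; exact: sringX.
    by rewrite addnC exprD mulrA; apply: sringM => //; exact: sringX.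
  + move=> u v [i Au] [j Av]; exists (i + j)%N.
    by rewrite exprD mulrACA; apply: sringM.
- by move=> z Az; exists 0; rewrite expr0 mulr1.
- case=> j Afs; apply: (max_avoid mA).
  have [b' Ab' sj] : exists2 b', A b' & s ^+ j = 1 - f^-1 * b'.
    elim: j {Afs} => [|j [b' Ab' IH]].
      by exists 0; [exact: sring0|rewrite expr0 mulr0 subr0].
    exists (b' + b * s ^+ j).
      by apply: sringD => //; apply: sringM => //; exact: sringX.
    by rewrite exprS {1}/s mulrBl mul1r {1}IH mulrDr opprD addrA mulrA.
  have -> : f = f * s ^+ j + b'.
    by rewrite sj mulrBr mulr1 mulrA mulfV // mul1r subrK.
  exact: sringD.
Qed.

(** Chevalley's descent: since [1 - q_0 / f] is a unit, the expression in [z^-1] rewrites the top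
    power of [z] in the other one through lower powers. Exchanging [z] and its inverse allows the
    longer polynomial to be [p], so that the new exponents stay nonnegative. *)
Lemma avoided_poly n (z : F) (p q : {poly F}) : z != 0 ->
  (forall i, A p`_i) -> (forall i, A q`_i) -> (size p + size q <= n)%N ->
  f = p.[z] -> f = q.[z^-1] -> False.
Proof.
elim: n z p q => [|n IH] z p q z0 Ap Aq.
  rewrite leqn0 addn_eq0 size_poly_eq0 => /andP[/eqP-> _].
  by rewrite horner0 => f0; have := avoided_neq0; rewrite f0 eqxx.
wlog sqp : z p q z0 Ap Aq / (size q <= size p)%N => [wl|] spq fp fq.
  have [sqp|/ltnW spq'] := leqP (size q) (size p); first exact: (wl z p q).
  by apply: (wl z^-1 q p); rewrite ?invr_eq0 // ?invrK // addnC.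
have [sp|sp] := leqP (size p) 1.
  by apply: (max_avoid mA); rewrite fp (size1_polyC sp) hornerC.
have [u0 Au] := avoided_local (Aq 0%N); set u := 1 - _ in u0 Au.
have f0 := avoided_neq0; pose r := (size p).-2.
have spE : size p = r.+2 by rewrite /r; case: (size p) sp => [|[]].
have qE : f * u = \sum_(i < (size q).-1) q`_i.+1 * z^-1 ^+ i.+1.
  rewrite mulrBr mulr1 mulrA mulfV // mul1r {1}fq horner_coef.
  have sq0 : (0 < size q)%N.
    rewrite lt0n size_poly_eq0; apply: contra_neqN f0 => /eqP q0.
    by rewrite fq q0 horner0.
  by rewrite -(prednK sq0) big_ord_recl expr0 mulr1 addrC addKr.
pose p' := \poly_(i < r.+1) (p`_i) +
  \sum_(i < (size q).-1) (p`_r.+1 * f^-1 * u^-1 * q`_i.+1) *: 'X^(r - i).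
apply: (IH z p' q) => //.
- move=> i; rewrite coefD coef_poly; apply: sringD => //.
    by case: ifP => // _; exact: sring0.
  rewrite coef_sum; apply: sring_sum => // j _; rewrite coefZ coefXn.
  have Ac : A (p`_r.+1 * f^-1 / u * q`_j.+1).
    by do !apply: sringM => //; exact: max_inv.
  by case: eqP => _; rewrite ?mulr1 ?mulr0 //; exact: sring0.
- have : (size p' <= r.+1)%N; last by move: spq; rewrite spE; lia.
  apply: (leq_trans (size_polyD _ _)); rewrite geq_max size_poly /=.
  apply: (leq_trans (size_sum _ _ _)); apply/bigmax_leqP => i _.
  by rewrite (leq_trans (size_scale_leq _ _)) // size_polyXn ltnS leq_subr.
- rewrite {1}fp horner_coef spE big_ord_recr /= hornerD horner_poly; congr (_ + _).
  rewrite horner_sum.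
  have -> : p`_r.+1 * z ^+ r.+1 = p`_r.+1 * f^-1 * u^-1 * z ^+ r.+1 * (f * u).
    exact: mulf_cancel.
  rewrite qE mulr_sumr; apply: eq_bigr => i _.
  rewrite hornerZ hornerXn -!mulrA; do 3!congr (_ * _).
  rewrite mulrCA; congr (_ * _).
  have ir : (i.+1 <= r.+1)%N by have := ltn_ord i; move: sqp; rewrite spE; lia.
  by rewrite exprVn -expfB_cond ?subSS // (negPf z0).
Qed.

(** By maximality [A[z]] contains [f] as soon as [z] is not in [A], and likewise for the inverse;
    [avoided_poly] excludes both at once. *)
Lemma valuation_ring_total z : A z \/ A z^-1.
Proof.
apply: contrapT => /not_orP[nAz nAzi].
have z0 : z != 0.
  by apply/eqP => z0; apply: nAz; rewrite z0; exact: sring0.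
have ext y : ~ A y -> exists2 p : {poly F}, (forall i, A p`_i) & f = p.[y].
  move=> nAy; apply: contrapT => nf; apply: nAy.
  pose B : set F := [set u | exists2 p : {poly F}, (forall i, A p`_i) & u =
      p.[y]]%classic.
  apply: (max_max mA (B := B)).
  - split.
    + move=> c; exists (cst F c)%:P; last by rewrite hornerC.
      by move=> i; rewrite coefC; case: eqP => _; [exact: sring_cst|exact: sring0].
    + move=> _ _ [p Ap ->] [q Aq ->]; exists (p - q); last by rewrite hornerD hornerN.
      by move=> i; rewrite coefB; apply: sringB.
    + move=> _ _ [p Ap ->] [q Aq ->]; exists (p * q); last by rewrite hornerM.
      by move=> i; rewrite coefM; apply: sring_sum => // j _; apply: sringM.
  - move=> a Aa; exists a%:P; last by rewrite hornerC.
    by move=> i; rewrite coefC; case: eqP => _ //; exact: sring0.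
  - by move=> [p Ap fp]; apply: nf; exists p.
  - exists 'X; last by rewrite hornerX.
    by move=> i; rewrite coefX; case: eqP => _; [exact: sring1|exact: sring0].
have [p Ap fp] := ext _ nAz; have [q Aq fq] := ext _ nAzi.
exact: (avoided_poly z0 Ap Aq (leqnn _)).
Qed.

Definition runit (u : F) : Prop := [/\ u != 0, A u & A u^-1].

Lemma runitM u v : runit u -> runit v -> runit (u * v).
Proof.
move=> [u0 Au Aui] [v0 Av Avi]; split; rewrite ?mulf_neq0 //; first exact: sringM.
by rewrite invfM; apply: sringM.
Qed.

Lemma runitV u : runit u -> runit u^-1.
Proof. by move=> [u0 Au Aui]; split; rewrite ?invr_eq0 // invrK. Qed.

Lemma runitX u n : runit u -> runit (u ^+ n).
Proof.
move=> [u0 Au Aui]; split; rewrite ?expf_neq0 //; first exact: sringX.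
by rewrite -exprVn; exact: sringX.
Qed.

Lemma runit_cst c : c != 0 -> runit (cst F c).
Proof.
by move=> c0; split; rewrite ?cst_eq0 // -?fmorphV; exact: sring_cst.
Qed.

(** One of [b / a] and [a / b] lies in [A], so one summand divides the sum, and a divisor of a unit
    is a unit. *)
Lemma nonunitD a b : A a -> A b -> ~ runit a -> ~ runit b -> ~ runit (a + b).
Proof.
wlog ba : a b / A (b / a) => [wl Aa Ab na nb|Aa Ab na nb [s0 As Asi]].
  have [|] := valuation_ring_total (b / a); first by move/wl; apply.
  by rewrite invf_div => /wl; rewrite addrC; apply.
have [a0|a0] := eqVneq a 0; first by apply: nb; move: s0 As Asi; rewrite a0 add0r.
apply: na; split=> //.
have -> : a^-1 = (1 + b / a) * (a + b)^-1.
  apply: (mulIf s0); rewrite mulfVK // mulrDr mulVf // mulrC //.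
by apply: sringM => //; apply: sringD => //; exact: sring1.
Qed.

Section Uniformizing.
Variables (tau : F) (Atau : A tau) (nAtau : ~ A tau^-1).

Lemma parameter_neq0 : tau != 0.
Proof.
by apply/eqP => t0; apply: nAtau; rewrite t0 invr0; exact: sring0.
Qed.

Lemma parameter_nonunit b : A b -> ~ runit (tau * b).
Proof.
move=> Ab [tb0 _ tbi]; apply: nAtau; move: tb0; rewrite mulf_eq0 negb_or => /andP[t0 b0].
have -> : tau^-1 = b * (tau * b)^-1 by rewrite invfM mulrCA mulfV ?mulr1.
exact: sringM.
Qed.

Lemma runit_ev (p : {poly C}) : p.[0] != 0 -> runit (ev tau p).
Proof.
move=> p0; have /factor_theorem[q pE] : root (p - (p.[0])%:P) 0.
  by rewrite rootE !hornerE subrr.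
have {}pE : ev tau p = cst F p.[0] + tau * ev tau q.
  have -> : p = (p.[0])%:P + 'X * q by rewrite mulrC -[X in q * X]subr0 -pE addrC subrK.
  by rewrite evD evM evX evC hornerD hornerM hornerX mul0r addr0 hornerC.
have nu : ~ runit (- (tau * ev tau q)).
  by rewrite -mulrN; apply: parameter_nonunit; apply: sringN => //; exact: sring_ev.
apply: contrapT => np; have := nonunitD _ _ np nu.
rewrite pE addrK; apply; [| |exact: runit_cst].
- by rewrite -pE; exact: sring_ev.
- by apply: sringN => //; apply: sringM => //; exact: sring_ev.
Qed.

Lemma runit_expz (k : int) : runit (tau ^ k) -> k = 0.
Proof.
have pos n : ~ runit (tau ^+ n.+1).
  by rewrite exprS; apply: parameter_nonunit; exact: sringX.
case: k => [[|n]|n] //; first by rewrite -exprnP => /pos.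
by rewrite NegzE -exprnN => /runitV; rewrite invrK => /pos.
Qed.

Hypothesis tauP : local_parameter tau.

Lemma runit_ratF (k : K) : k != 0 -> exists e : int, runit (ratF F k / tau ^ e).
Proof.
move=> k0; have [e [p [q [p0 q0 ->]]]] := local_parameter_decomp tauP k0.
exists e; rewrite mulrAC mulfV ?expfz_neq0 ?parameter_neq0 // mul1r.
by apply: runitM; [|apply: runitV]; apply: runit_ev.
Qed.

(* Two terms of the relation of z over C(x) must be associate in A. *)
Lemma runit_power z : z != 0 ->
  exists e : int, runit (z ^+ (\dim {:F})`! / tau ^ e).
Proof.
move=> z0; have [q [qmon sq q0]] := algebraic_relation z.
pose T (i : 'I_(size q)) := ratF F q`_i * z ^+ i.
have t0 := parameter_neq0.
have sq0 : (0 < size q)%N by rewrite size_poly_gt0 monic_neq0.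
have sq' : ((size q).-1 < size q)%N by rewrite prednK.
have lq : q`_(Ordinal sq') != 0.
  by rewrite /= -lead_coefE lead_coef_eq0 monic_neq0.
(* Divisibility in [A] is a total preorder on F because [A] is a valuation ring; a least term
   divides all the others. *)
pose ord : rel F := fun a b => `[< exists2 c, A c & b = a * c >].
have ord_refl : reflexive ord.
  by move=> a; apply/asboolP; exists 1; [exact: sring1|rewrite mulr1].
have ord_trans : transitive ord.
  move=> b a c /asboolP[u Au ->] /asboolP[v Av ->]; apply/asboolP.
  by exists (u * v); [exact: sringM|rewrite mulrA].
have ord_total : total ord.
  move=> a b; apply/orP.
  have [->|a0] := eqVneq a 0.
    by right; apply/asboolP; exists 0; [exact: sring0|rewrite mulr0].
  have [->|b0] := eqVneq b 0.
    by left; apply/asboolP; exists 0; [exact: sring0|rewrite mulr0].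
  have [h|h] := valuation_ring_total (b / a); [left|right]; apply/asboolP.
    by exists (b / a) => //; rewrite mulrCA mulfV ?mulr1.
  by exists (b / a)^-1 => //; rewrite invf_div mulrCA mulfV ?mulr1.
have [i qi imin] := @extremumP _ _ ord (Ordinal sq') (fun i : 'I_(size q) => q`_i != 0)
    T ord_refl ord_trans ord_total lq.
have cex (j : 'I_(size q)) : exists c, A c /\ T j = T i * c.
  have [qj|/imin/asboolP[c]] := eqVneq q`_j 0; last by exists c.
  by exists 0; split; [exact: sring0|rewrite /T qj ratF0 mul0r mulr0].
have /choice[c cP] := cex.
have Ti0 : T i != 0 by rewrite mulf_neq0 ?ratF_eq0 ?expf_neq0.
have ci : c i = 1.
  by apply: (mulfI Ti0); rewrite mulr1; case: (cP i).
have sumc : \sum_j c j = 0.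
  apply: (mulfI Ti0); rewrite mulr0 mulr_sumr -[RHS]q0; apply: eq_bigr => j _.
  by case: (cP j) => _ <-.
(* The cofactors sum to 0 and [c i] is 1, so the others sum to -1, which a sum of non-units cannot
   be. *)
have [j ji uj] : exists2 j, j != i & runit (c j).
  apply: contrapT => nj.
  have : ~ runit (\sum_(j | j != i) c j) /\ A (\sum_(j | j != i) c j).
    elim/big_ind: _ => [|a b [na Aa] [nb Ab]|j ji].
    - by split; [case; rewrite eqxx|exact: sring0].
    - by split; [exact: nonunitD|exact: sringD].
    - by split; [move=> uj; apply: nj; exists j|case: (cP j)].
  case=> + _; apply; move: sumc; rewrite (bigD1 i) //= ci => /eqP.
  rewrite addrC addr_eq0 => /eqP ->.
  by rewrite -(rmorph1 (@cst R F)) -rmorphN; apply: runit_cst; rewrite oppr_eq0 oner_eq0.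
have [_ TjE] := cP j.
have qj : q`_j != 0.
  apply/eqP => qj; case: uj => cj0 _ _; have /eqP := TjE.
  by rewrite /T qj ratF0 mul0r eq_sym mulf_eq0 (negPf Ti0) (negPf cj0).
(* Two associate terms express [z^(b - a)], up to a unit, as an element of C(x), hence as a power of
   [tau]. The exponent is at most the degree of F, so it divides the factorial, which serves all [z]
   at once. *)
have main (a b : 'I_(size q)) v : (a < b)%N -> q`_a != 0 -> q`_b != 0 -> runit v ->
    T b = T a * v -> exists e : int, runit (z ^+ (\dim {:F})`! / tau ^ e).
  move=> ab qa qb uv Tab.
  pose m := (b - a)%N.
  have [e ue] := @runit_ratF (q`_a / q`_b) (mulf_neq0 qa (invr_neq0 qb)).
  have zm : z ^+ m = ratF F (q`_a / q`_b) * v.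
    have z1 : z ^+ a != 0 by rewrite expf_neq0.
    apply: (mulfI z1); rewrite -exprD subnKC ?(ltnW ab) //.
    have qb' : ratF F q`_b != 0 by rewrite ratF_eq0.
    apply: (mulfI qb'); rewrite -/(T b) Tab /T ratF_div mulrC.
    rewrite [RHS]mulrCA; exact: mulf_cancel_cross.
  have um : runit (z ^+ m / tau ^ e) by rewrite zm mulrAC; apply: runitM.
  have /dvdnP[s sE] : (m %| (\dim {:F})`!)%N.
    apply: dvdn_fact; rewrite subn_gt0 ab /=.
    rewrite (leq_trans (leq_subr _ _)) // -ltnS; exact: leq_trans (ltn_ord b) sq.
  exists (e * s%:Z); rewrite sE mulnC exprM -exprz_exp -exprnP.
  rewrite -expr_div_n; exact: runitX.
have [ltij|ltji|/val_inj eij] := ltngtP i j; last by rewrite eij eqxx in ji.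
  exact: main ltij qi qj uj TjE.
apply: main ltji qj qi (runitV uj) _.
by rewrite TjE mulfK //; case: uj.
Qed.

End Uniformizing.

(** If there were none, [A] would contain C(x). Dividing the monic relation of [f] by a power of [f]
    would then put [f] in [A], since [1/f] is there. *)
Lemma parameter_exists : exists tau, [/\ local_parameter tau, A tau & ~ A tau^-1].
Proof.
have [Ax|nAx] := pselect (A (xF F)); last first.
  have [//|Axi] := valuation_ring_total (xF F).
  exists (xF F - cst F 0)^-1; rewrite rmorph0 subr0 invrK; split=> //.
  split; last by exists 0; right; rewrite rmorph0 subr0.
  by apply/eqP => xi; apply: nAx; rewrite -[xF F]invrK xi invr0; exact: sring0.
apply: contrapT => ntau.
have Axz (z : R[i]) : A (xF F - cst F z)^-1.
  apply: contrapT => nA; apply: ntau; exists (xF F - cst F z); split=> //.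
    split; last by exists z; left.
    by apply/eqP => e; apply: nA; rewrite e invr0; exact: sring0.
  by apply: sringB => //; exact: sring_cst.
have Ap (p : {poly C}) : A (ev (xF F) p)^-1.
  have [r ->] := closed_field_poly_normal p.
  rewrite -mul_polyC evM evC invfM; apply: sringM => //.
    by rewrite -fmorphV; exact: sring_cst.
  elim: r => [|a r IH]; first by rewrite big_nil ev1 invr1; exact: sring1.
  by rewrite big_cons evM invfM evB evX evC; apply: sringM => //; exact: Axz.
have AK (k : K) : A (ratF F k).
  have [p [q [q0 ->]]] := ratfun_quotient k.
  by rewrite ratF_div -!ev_xF; apply: sringM => //; exact: sring_ev.
have f0 := avoided_neq0.
have [q [qmon _]] := algebraic_relation f.
have sq : (0 < size q)%N by rewrite size_poly_gt0 monic_neq0.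
rewrite -(prednK sq) big_ord_recr /= -lead_coefE (monicP qmon) ratF1 mul1r.
case: (size q).-1 => [|n] /eqP.
  by rewrite big_ord0 expr0 add0r oner_eq0.
rewrite addrC addr_eq0 => /eqP fE; apply: (max_avoid mA).
have -> : f = f ^+ n.+1 * f^-1 ^+ n.
  by rewrite exprSr mulrC mulrA -exprMn mulVf // expr1n mul1r.
rewrite fE mulNr mulr_suml; apply: sringN => //; apply: sring_sum => // i _.
rewrite -mulrA; apply: sringM => //.
have -> : f^-1 ^+ n = f^-1 ^+ i * f^-1 ^+ (n - i).
  by rewrite -exprD subnKC // -ltnS.
by rewrite mulrA -exprMn mulfV // expr1n mul1r; apply: sringX => //; exact: max_inv.
Qed.

End ValuationRing.

Lemma pole_exists (f : F) : ~ is_constant f -> exists w : valuation F, w f < 0.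
Proof.
move=> /maximal_avoiding_exists[A mA]; have sA : subring_over_cst A := mA.
have [tau [tauP Atau nAtau]] := parameter_exists mA.
have t0 : tau != 0 := parameter_neq0 mA nAtau.
set N := (\dim {:F})`!.
have N0 : (0 < N)%N by rewrite fact_gt0.
have /choice[W0 W0P] z : exists e : int, z != 0 -> runit A (z ^+ N / tau ^ e).
  have [->|z0] := eqVneq z 0; first by exists 0.
  by have [e eP] := runit_power mA Atau nAtau tauP z0; exists e.
have uniq z e e' : z != 0 -> runit A (z ^+ N / tau ^ e) -> runit A (z ^+ N / tau ^ e')
    -> e = e'.
  move=> z0 /runitV ue ue'; have := runitM mA ue' ue.
  rewrite divf_div_same ?expf_neq0 ?expfz_neq0 // invr_expz -expfzDr // => /(runit_expz
      mA Atau nAtau); lia.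
(* [W] measures [z^N] against [tau]: it is additive on products and nonnegative exactly on [A]. Its
   values are the multiples of some [d] that may exceed 1, so the normalized valuation is [W]
   divided by [d]. *)
pose W z := if z == 0 then 0 else W0 z.
have WP z : z != 0 -> runit A (z ^+ N / tau ^ W z).
  by move=> z0; rewrite /W (negPf z0); exact: W0P.
have WM a b : a != 0 -> b != 0 -> W (a * b) = W a + W b.
  move=> a0 b0; apply: (uniq (a * b)); rewrite ?mulf_neq0 //; first by apply: WP;
      rewrite mulf_neq0.
  rewrite exprMn expfzDr // invfM mulrACA; apply: (runitM mA); exact: WP.
have WA z : z != 0 -> (0 <= W z) <-> A z.
  move=> z0; have [u0 Au Aui] := WP z z0; split=> [|Az].
    case WE : (W z) => [n|//] _; have [//|Azi] := valuation_ring_total mA z.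
    have AzN : A (z ^+ N).
      rewrite WE in u0 Au; have -> : z ^+ N = z ^+ N / tau ^ n * tau ^+ n.
        by rewrite -exprnP divfK // expf_neq0.
      by apply: sringM => //; exact: sringX.
    have -> : z = z ^+ N * z^-1 ^+ N.-1.
      by rewrite -{1}(prednK N0) exprSr mulrC mulrA -exprMn mulVf // expr1n mul1r.
    by apply: sringM => //; exact: sringX.
  case WE : (W z) => [//|n]; rewrite WE in u0 Au Aui.
  have : runit A (tau * (z ^+ N * tau ^+ n)).
    have -> : tau * (z ^+ N * tau ^+ n) = z ^+ N / tau ^ Negz n.
      by rewrite NegzE -exprnN invrK exprS mulrCA.
    by split.
  move/(parameter_nonunit mA nAtau); case.
  by apply: sringM => //; exact: sringX.
have W1 : W 1 = 0.
  have := WM 1 1 (oner_neq0 _) (oner_neq0 _); rewrite mulr1; lia.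
have WX z n : z != 0 -> W (z ^+ n) = n%:Z * W z.
  move=> z0; elim: n => [|n IH]; first by rewrite expr0 W1 mul0r.
  by rewrite exprS WM ?expf_neq0 // IH intS mulrDl mul1r.
have WV z : z != 0 -> W z^-1 = - W z.
  by move=> z0; apply: (addrI (W z)); rewrite -WM ?invr_eq0 // mulfV // W1 subrr.
have WXz z (n : int) : z != 0 -> W (z ^ n) = n * W z.
  move=> z0; case: n => n; first by rewrite -exprnP WX.
  by rewrite NegzE -exprnN WV ?expf_neq0 // WX // mulNr.
have Wtau : 0 < W tau.
  rewrite lt_neqAle; have [_ /(_ Atau) ->] := WA tau t0; rewrite andbT.
  apply/eqP => W0'; have := WA tau^-1; rewrite invr_eq0 WV // -W0' oppr0 => /(_ t0)[h _].
  exact/nAtau/h.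
pose P m := (0 < m)%N && `[< exists2 z, z != 0 & W z = m%:Z >].
have exP : exists m, P m.
  exists `|W tau|%N; rewrite /P; apply/andP; split; first by lia.
  by apply/asboolP; exists tau => //; lia.
have [d /andP[d0 /asboolP[pi pi0 Wpi]] dmin] := ex_minnP exP.
have Wd z : W z = (W z %/ d)%Z * d%:Z.
  have [->|z0] := eqVneq z 0; first by rewrite /W eqxx div0z mul0r.
  have := divz_eq (W z) d; set e := (W z %/ d)%Z; set r := (W z %% d)%Z => WE.
  have r_ge0 : 0 <= r by apply: modz_ge0; lia.
  have r_lt : r < d by have := @ltz_pmod (W z) d; rewrite ltz_nat => /(_ d0).
  have Wr : W (z / pi ^ e) = r.
    by rewrite WM ?invr_eq0 ?expfz_neq0 // WV ?expfz_neq0 // WXz // Wpi; lia.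
  case: r r_ge0 r_lt Wr WE => [[|r]|//] _; first by rewrite addr0.
  rewrite ltz_nat => rd Wr _; have := dmin r.+1; rewrite leqNgt rd => /(_ _)/negP[] //.
  rewrite /P /=; apply/asboolP; exists (z / pi ^ e) => //.
  by rewrite mulf_neq0 ?invr_eq0 ?expfz_neq0.
pose w z := (W z %/ d)%Z.
have wP : is_valuation w.
  split.
  - by rewrite /w /W eqxx div0z.
  - move=> a b a0 b0; rewrite /w WM //; have := Wd a; have := Wd b.
    move: (W a) (W b) (W a %/ d)%Z (W b %/ d)%Z => Wa Wb ea eb -> ->.
    by rewrite -mulrDl mulzK // eqz_nat -lt0n.
  - move=> a b; wlog ab : a b / w a <= w b => [wl a0 b0 s0|a0 b0 s0].
      have [ab|] := boolP (w a <= w b); first exact: wl.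
      rewrite -ltNge => /ltW ab.
      by rewrite minC addrC; apply: wl; rewrite // addrC.
    rewrite (min_idPl ab); have : 0 <= W (b / a).
      rewrite WM ?invr_eq0 // WV //; have := Wd a; have := Wd b.
      rewrite -/(w a) -/(w b); nia.
    rewrite WA ?mulf_neq0 ?invr_eq0 // => Aba.
    have s1 : 1 + b / a != 0.
      by apply: contra_neq s0 => h; rewrite -[a]mulr1 -(mulfVK a0 b) [_ * a]mulrC
          -mulrDr h mulr0.
    have : 0 <= W (1 + b / a).
      by apply/WA => //; apply: sringD => //; exact: sring1.
    have -> : a + b = a * (1 + b / a) by rewrite mulrDr mulr1 mulrCA mulfV ?mulr1.
    have := WM _ _ a0 s1; have := Wd a; have := Wd (a * (1 + b / a)).
    rewrite -/(w _) -/(w a); nia.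
  - move=> c c0; rewrite /w.
    have -> : W (cst F c) = 0.
      apply: (uniq (cst F c)); rewrite ?cst_eq0 //; first by apply: WP; rewrite cst_eq0.
      by rewrite expr0z invr1 mulr1 -rmorphXn; apply: (runit_cst mA); rewrite expf_neq0.
    exact: div0z.
  - by exists pi => //; rewrite /w Wpi divzz eqz_nat -lt0n d0.
exists (Valuation wP) => /=; rewrite /w ltNge; apply/negP => wf.
apply: (max_avoid mA); apply/WA; first exact: avoided_neq0 mA.
by rewrite Wd; nia.
Qed.

Lemma no_pole_is_constant (f : F) : (forall w : valuation F, vge w 0 f) -> is_constant f.
Proof.
move=> fge; apply: contrapT => /pole_exists[w wf].
have f0 : f != 0 by apply: contraTneq wf => ->; rewrite val0.
have := fge w; rewrite vge_neq0 //; lia.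
Qed.

End PlaceExistence.

(** * Finiteness of supports *)

Section PlaceFiniteness.
Variables (R : realType) (F : funfield R).
Local Notation C := R[i].
Local Notation K := (ratfun R).

Lemma valuation_ext (v w : valuation F) : (forall f, v f = w f) -> v = w.
Proof.
case: v w => [v vP] [w wP] /= vw; have {}vw : v = w by apply: funext.
by subst w; congr Valuation; exact: Prop_irrelevance.
Qed.

(** Units for [v] are units for [w], so [w] is [w pi] times [v]; as [w] takes the value 1, this
    factor is 1. *)
Lemma valuation_subring (v w : valuation F) :
  (forall f, f != 0 -> 0 <= v f -> 0 <= w f) -> v = w.
Proof.
move=> vw; apply: valuation_ext => f.
have [->|f0] := eqVneq f 0; first by rewrite !val0.
have [pi [pi0 vpi]] := uniformizer v.
have unit h : h != 0 -> v h = 0 -> w h = 0.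
  move=> h0 vh; have := vw h h0; have := vw h^-1; rewrite invr_eq0 !valV vh oppr0.
  by move=> /(_ h0 (lexx _)) wh1 /(_ (lexx _)) wh2; lia.
have wv h : h != 0 -> w h = v h * w pi.
  move=> h0; have q0 : pi ^ (v h) != 0 by rewrite expfz_neq0.
  have := unit (h / pi ^ (v h)); rewrite mulf_neq0 ?invr_eq0 // !valM ?invr_eq0 //.
  by rewrite !valV !valXz vpi mulr1 subrr => /(_ isT erefl)/eqP; rewrite subr_eq0 => /eqP.
have wpi : 0 <= w pi by apply: vw; rewrite // vpi.
have [pi' [pi'0 wpi']] := uniformizer w.
have := wv _ pi'0; rewrite wpi' => h; rewrite wv //.
have -> : w pi = 1; last by rewrite mulr1.
move: (v pi') (w pi) h wpi => a b h b0.
by have [a0|a0] := leP a 0; nia.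
Qed.

Lemma separating_element (v w : valuation F) : v <> w ->
  exists y, [/\ y != 0, 0 < v y & w y < 0].
Proof.
move=> vw.
have sep (v' w' : valuation F) : v' <> w' -> exists y, [/\ y != 0, 0 <= v' y & w' y < 0].
  move=> ne; apply: contrapT => /forallNP ny; apply: ne; apply: valuation_subring => f
      f0 vf.
  by rewrite leNgt; apply/negP => wf; apply: (ny f).
have [y [y0 vy wy]] := sep _ _ vw; have [z [z0 wz vz]] := sep _ _ (nesym vw).
exists (y / z); rewrite mulf_neq0 ?invr_eq0 // !valM ?invr_eq0 // !valV.
by split=> //; lia.
Qed.

Lemma avoid_finite (s : seq C) : exists2 c : C, c != 0 & c \notin s.
Proof.
have uniqs n : uniq [seq i.+1%:R : C | i <- iota 0 n].
  by rewrite map_inj_uniq ?iota_uniq // => i j /eqP; rewrite eqr_nat => /eqP[].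
have [c cs cn] : exists2 c, c \in [seq i.+1%:R : C | i <- iota 0 (size s).+1] & c
    \notin s.
  apply: contrapT => nc; have /uniq_leq_size := uniqs (size s).+1.
  move=> /(_ s); rewrite size_map size_iota ltnn => h; suff : false by [].
  by apply: h => c cs; apply/negPn/negP => cn; apply: nc; exists c.
by exists c => //; case/mapP: cs => i _ ->; rewrite pnatr_eq0.
Qed.

(* The element is [1 / (1 + c * y)] for [y] separating v from w and a constant c
   avoiding the poles this could create at the other places. *)
Lemma separating_unit (v w : valuation F) (s : seq (valuation F)) : v <> w ->
  exists t, [/\ t != 0, v t = 0, 0 < w t & forall u, u \in s -> 0 <= u t].
Proof.
move=> vw; have [y [y0 vy wy]] := separating_element vw.
have /choice[rho rhoP] (u : valuation F) : exists r : C, u y = 0 -> vge u 1 (y - cst F r).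
  have [uy|uy] := eqVneq (u y) 0; last by exists 0 => uy'; rewrite uy' eqxx in uy.
  by have [|r rP] := @residue _ _ u y; [rewrite -uy vge_val|exists r].
have [c c0 cs] := avoid_finite [seq - (rho u)^-1 | u <- s].
have cF0 : cst F c != 0 by rewrite cst_eq0.
have val_pos (u : valuation F) : 0 < u y -> 1 + cst F c * y != 0 /\ u (1 + cst F c * y)
    = 0.
  move=> uy; have := @val_eqD _ _ u 1 (cst F c * y); rewrite oner_eq0 val1 => /(_ isT).
  by apply; rewrite add0r vge_neq0 ?mulf_neq0 // valM // val_cst add0r.
have val_neg (u : valuation F) : u y < 0 -> 1 + cst F c * y != 0 /\ u (1 + cst F c * y)
    = u y.
  move=> uy; have := @val_eqD _ _ u (cst F c * y) 1; rewrite mulf_neq0 // valM //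
      val_cst add0r.
  rewrite addrC => /(_ isT) h.
  by rewrite [1 + _]addrC; apply: h; rewrite vge_neq0 ?oner_eq0 // val1; lia.
have [n0 vn] := val_pos v vy; have [_ wn] := val_neg w wy.
exists (1 + cst F c * y)^-1; split; rewrite ?invr_eq0 // ?valV ?vn ?wn; [by []|lia|].
move=> u us; have [uy|uy|uy] := ltgtP (u y) 0.
- by rewrite valV (val_neg u uy).2; lia.
- by rewrite valV (val_pos u uy).2; lia.
have ry := rhoP u uy.
suff -> : u (1 + cst F c * y)^-1 = 0 by [].
(* This is the residue of [1 + c * y] at [u]; it is nonzero because [c] avoids [- (rho u)^-1]. *)
have r0 : 1 + c * rho u != 0.
  apply: contra_notN (negP cs) => /eqP e; apply/mapP; exists u => //.
  have r0 : rho u != 0.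
    by apply: contra_eq_neq e => ->; rewrite mulr0 addr0 oner_eq0.
  apply: (mulIf r0); rewrite mulNr mulVf //.
  by apply/eqP; rewrite -addr_eq0 addrC e.
rewrite valV; have := @val_eqD _ _ u (cst F (1 + c * rho u)) (cst F c * (y - cst F (rho
    u))).
rewrite cst_eq0 val_cst add0r => /(_ r0).
rewrite rmorphD rmorph1 rmorphM mulrBr addrA addrAC addrK => h.
have [|_ ->] := h; last exact: oppr0.
by rewrite -mulrBr; apply: vgeMl => //; exact: vge_cst.
Qed.

Lemma isolating_unit (v : valuation F) (s : seq (valuation F)) : v \notin s ->
  exists t, [/\ t != 0, v t = 0 & forall u, u \in s -> 0 < u t].
Proof.
move=> vs.
(* The list [s'] stays fixed during the induction on [s]: all factors are nonnegative on it, so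
   multiplying by a new one destroys no zero already obtained. *)
suff key (s' : seq (valuation F)) : {subset s <= s'} -> exists t, [/\ t != 0, v t = 0,
    forall u, u \in s -> 0 < u t & forall u, u \in s' -> 0 <= u t].
  by have [//|t [t0 vt ts _]] := key s; exists t.
move=> ss'; elim: s vs ss' => [|w s IH] vs ss'.
  by exists 1; rewrite oner_eq0 val1; split=> // u _; rewrite val1.
rewrite inE negb_or in vs; case/andP: vs => vw vs.
have [|t [t0 vt ts ts']] := IH vs; first by move=> u us; apply: ss'; rewrite inE us orbT.
have [r [r0 vr wr rs']] := separating_unit s' (elimN eqP vw).
exists (t * r); rewrite mulf_neq0 // valM // vt vr; split=> // u.
  rewrite inE => /orP[/eqP->|us]; rewrite valM //.
    by have := ts' w (ss' w (mem_head _ _)); lia.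
  by have := ts u us; have := rs' u; rewrite ss' ?inE ?us ?orbT // => /(_ isT); lia.
by move=> us; rewrite valM //; have := ts' u us; have := rs' u us; lia.
Qed.

(** Functions that are units at one place of [s] and vanish at the others are independent over C(x).
    In a relation divided by its coefficient of least order, the term of index [i] alone survives at
    the place [i]; since all places lie over one place of C(x), a coefficient least at one of them
    is least at all. *)
Lemma places_over_bound (tau : F) (s : seq (valuation F)) :
  local_parameter tau -> uniq s -> (forall w, w \in s -> 0 < w tau) ->
  (size s <= \dim {:F})%N.
Proof.
move=> tauP us stau.
have [[v0 v0s]|s0] := pselect (exists v0, v0 \in s); last first.
  by case: s {us stau} s0 => // v s []; exists v; rewrite mem_head.
have /choice[t tP] (i : 'I_(size s)) : exists t, [/\ t != 0, nth v0 s i t = 0 &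
    forall j : 'I_(size s), j != i -> 0 < nth v0 s j t].
  have [|t [t0 ti tj]] := @isolating_unit (nth v0 s i) (rem (nth v0 s i) s).
    by rewrite mem_rem_uniq // !inE eqxx.
  exists t; split=> // j ji; apply: tj; rewrite mem_rem_uniq // !inE mem_nth // andbT.
  by rewrite nth_uniq.
have fr : free [tuple t i | i < size s].
  apply/freeP => k k0 i0; apply: contrapT => /eqP ki0.
  have [i [ki kmin]] := val_minimal v0 ki0.
  have kge (w : valuation F) j : w \in s -> vge w 0 (ratF F (k j / k i)).
    move=> ws; have [kj|kj] := eqVneq (k j / k i) 0; first by rewrite kj ratF0 vge0.
    have [e eP] := val_ratfun tauP kj; have := kmin j.
    rewrite !vge_neq0 ?ratF_eq0 // !eP ?stau //.
    by have := stau _ ws; have := stau _ v0s; nia.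
  have sumt : \sum_j ratF F (k j / k i) * t j = 0.
    transitivity (ratF F (k i)^-1 * \sum_j k j *: t j).
      rewrite mulr_sumr; apply: eq_bigr => j _.
      by rewrite -[k j *: _]mulr_algl mulrA -/(ratF F (k j)) mulrC rmorphM mulrC [ratF
          F (k j) * _]mulrC.
    rewrite [X in _ * X](_ : _ = 0) ?mulr0 // -[RHS]k0.
    by apply: eq_bigr => j _; rewrite -tnth_nth tnth_mktuple.
  move: sumt; rewrite (bigD1 i) //= mulfV // ratF1 mul1r.
  have [ti0 wti _] := tP i; set w := nth v0 s i in wti.
  have := @val_eqD _ _ w (t i) (\sum_(j < size s | j != i) ratF F (k j / k i) * t j) ti0.
  rewrite wti add0r => h /eqP; have [|/negPf-> //] := h.
  apply: vge_sum => j ji; apply: vgeMl; first by apply: kge; rewrite mem_nth.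
  have [tj0 _ tj] := tP j; rewrite vge_neq0 //.
  by have := tj i; rewrite eq_sym ji => /(_ isT).
have <- : \dim <<[tuple t i | i < size s]>> = size s by rewrite (eqnP fr) size_tuple.
by rewrite dimvS ?subvf.
Qed.

Lemma finite_places_over (tau : F) : local_parameter tau ->
  finite_set [set w : valuation F | 0 < w tau]%classic.
Proof.
move=> tauP; apply: contrapT => inf.
have [X XS XE] := infinite_set_fset (\dim {:F}).+1 inf.
have := @places_over_bound tau (enum_fset X) tauP (fset_uniq X).
by move=> h; have := leq_trans XE (h (fun w wX => XS w wX)); rewrite ltnn.
Qed.

(** On C(x) the support comes from linear factors, whose zeros and poles are finite in number. A
    pole of a general element is a zero or a pole of some coefficient of its monic relation; its
    zeros are poles of the inverse. *)
Lemma finite_support (f : F) : finite_set [set w : valuation F | w f != 0]%classic.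
Proof.
have fin1 z : finite_set [set w : valuation F | w (xF F - cst F z) != 0]%classic.
  have [e0|n0] := eqVneq (xF F - cst F z) 0.
    by rewrite e0 (_ : mkset _ = set0) //; apply/seteqP; split=> // w /=; rewrite val0
        eqxx.
  apply: (@sub_finite_set _ _ ([set w : valuation F | 0 < w (xF F - cst F z)%R] `|`
     [set w : valuation F | 0 < w (xF F - cst F z)^-1%R])%classic).
    move=> w /=; rewrite valV neq_lt => /orP[h|h]; [right|left]; lia.
  rewrite finite_setU; split; apply: finite_places_over.
    by split=> //; exists z; left.
  by split; [rewrite invr_eq0|exists z; right].
have finp (p : {poly C}) : finite_set [set w : valuation F | w (ev (xF F) p) !=
    0]%classic.
  have [r ->] := closed_field_poly_normal p.
  rewrite -mul_polyC.
  elim: r => [|a r IH].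
    rewrite (_ : mkset _ = set0) //; apply/seteqP; split=> // w /=.
    by rewrite big_nil mulr1 evC val_cst eqxx.
  apply: (@sub_finite_set _ _ (_ `|` _)%classic); last by rewrite finite_setU; split;
      [exact: (fin1 a)|exact: IH].
  move=> w /=; apply: contraPP => /not_orP[/negP/negPn/eqP h1 /negP/negPn/eqP h2].
  rewrite big_cons mulrCA evM evB evX evC => /eqP; apply.
  have [->|n1] := eqVneq (xF F - cst F a) 0; first by rewrite mul0r val0.
  set b := ev _ _ in h2 *; have [->|n2] := eqVneq b 0; first by rewrite mulr0 val0.
  by rewrite valM // h1 h2.
have finK (k : K) : finite_set [set w : valuation F | w (ratF F k) != 0]%classic.
  have [p [q [q0 ->]]] := ratfun_quotient k.
  apply: (@sub_finite_set _ _ (_ `|` _)%classic); last by rewrite finite_setU; split;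
      [exact: (finp p)|exact: (finp q)].
  move=> w /=; apply: contraPP => /not_orP[/negP/negPn/eqP h1 /negP/negPn/eqP h2].
  rewrite ratF_div -!ev_xF => /eqP; apply.
  have [->|n1] := eqVneq (ev (xF F) p) 0; first by rewrite mul0r val0.
  have [->|n2] := eqVneq (ev (xF F) q) 0; first by rewrite invr0 mulr0 val0.
  by rewrite valM ?invr_eq0 // valV h1 h2 oppr0.
have [f0|f0] := eqVneq f 0.
  by rewrite f0 (_ : mkset _ = set0) //; apply/seteqP; split=> // w /=; rewrite val0 eqxx.
have fin_neg (h : F) : h != 0 -> finite_set [set w : valuation F | w h < 0]%classic.
  move=> h0; have [q [qmon _ q0]] := algebraic_relation h.
  have sq : (0 < size q)%N by rewrite size_poly_gt0 monic_neq0.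
  move: q0; rewrite -(prednK sq) big_ord_recr /= -lead_coefE (monicP qmon) ratF1 mul1r.
  set n := (size q).-1; rewrite addrC => q0.
  apply: (@sub_finite_set _ _ (\bigcup_(i in [set` 'I_n]) [set w : valuation F | w
      (ratF F q`_i) != 0])%classic).
    move=> w /= wh; apply: contrapT => nw.
    have := @val_eqD _ _ w (h ^+ n) (\sum_(i < n) ratF F q`_i * h ^+ i).
    rewrite q0 eqxx expf_neq0 // => /(_ isT) [] //; apply: vge_sum => i _.
    have [->|qi] := eqVneq q`_i 0; first by rewrite ratF0 mul0r vge0.
    rewrite vge_neq0 ?mulf_neq0 ?expf_neq0 ?ratF_eq0 // valM ?expf_neq0 ?ratF_eq0 //.
    have -> : w (ratF F q`_i) = 0.
      by apply/eqP; apply: contrapT => /negP nw'; apply: nw; exists i.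
    rewrite !valX add0r; have := ltn_ord i; nia.
  by apply: bigcup_finite => // i _; exact: finK.
apply: (@sub_finite_set _ _ ([set w : valuation F | w f < 0] `|` [set w : valuation F |
    w f^-1%R < 0])%classic).
  move=> w /=; rewrite valV neq_lt => /orP[h|h]; [left|right]; lia.
by rewrite finite_setU; split; apply: fin_neg; rewrite ?invr_eq0.
Qed.

End PlaceFiniteness.

(** * Functions with bounded poles *)

Lemma residue_elimination (K : comNzRingType) (t f g r c e : K) : c * e = r ->
  t * (f - c * g) = (t * f - r) - c * (t * g - e).
Proof. by move=> <-; ring. Qed.

Section BoundedPoles.
Variables (R : realType) (F : funfield R).
Local Notation C := R[i].

(* f lies in the Riemann-Roch space of h times the sum of the places of s. *)
Definition pole_bound (s : seq (valuation F)) (h : nat) (f : F) : Prop :=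
  forall w : valuation F, vge w (if w \in s then - h%:Z else 0) f.

Section Fixed.
Variable s : seq (valuation F).
Local Notation L := (pole_bound s).

Lemma pole_bound_cst c : L 0 (cst F c).
Proof. by move=> w; rewrite oppr0 if_same; exact: vge_cst. Qed.

Lemma pole_bound_le h k f : (h <= k)%N -> L h f -> L k f.
Proof.
move=> hk hf w; apply: vgeW (hf w); case: ifP => // _; lia.
Qed.

Lemma pole_bound1 : L 0 1.
Proof. by rewrite -(rmorph1 (@cst R F)); exact: pole_bound_cst. Qed.

Lemma pole_bound0 h : L h 0. Proof. by move=> w; exact: vge0. Qed.

Lemma pole_boundN h f : L h f -> L h (- f).
Proof. by move=> hf w; rewrite vgeN. Qed.

Lemma pole_boundD h f g : L h f -> L h g -> L h (f + g).
Proof. by move=> hf hg w; apply: vgeD. Qed.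

Lemma pole_boundM h k f g : L h f -> L k g -> L (h + k) (f * g).
Proof.
move=> hf hg w; have := vgeM (hf w) (hg w).
by case: ifP => _; rewrite ?addr0 // PoszD opprD.
Qed.

Lemma pole_boundX h f n : L h f -> L (n * h) (f ^+ n).
Proof.
move=> hf; elim: n => [|n IH]; first by rewrite mul0n expr0; exact: pole_bound1.
by rewrite exprS mulSn; apply: pole_boundM.
Qed.

Lemma pole_bound_sum (I : Type) (r : seq I) (P : pred I) h (f : I -> F) :
  (forall i, P i -> L h (f i)) -> L h (\sum_(i <- r | P i) f i).
Proof.
move=> hf; elim/big_ind: _ => //; [exact: pole_bound0|].
by move=> x y; exact: pole_boundD.
Qed.

Lemma pole_bound_cstM c h f : L h f -> L h (cst F c * f).
Proof. by move=> hf; rewrite -[h]add0n; apply: pole_boundM => //; exact: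
    pole_bound_cst. Qed.

End Fixed.

(* One linear condition per unit of degree: the leading coefficient at a place. *)
Lemma dependent_of_degree (I : finType) (D : valuation F -> nat) (s : seq (valuation
    F)) (f : I -> F) :
  uniq s ->
  (forall i w, vge w (if w \in s then - (D w)%:Z else 0) (f i)) ->
  (1 + \sum_(w <- s) D w < #|I|)%N ->
  exists2 c : I -> C, (exists i, c i != 0) & \sum_i cst F (c i) * f i = 0.
Proof.
move=> us; move En: (\sum_(w <- s) D w)%N => n.
elim: n I D f En => [|n IH] I D f En fge cI.
  (* In degree 0 the functions have no poles, so they are constants and any two of them are
     dependent. *)
  have D0 w : w \in s -> D w = 0%N.
    move=> ws; apply/eqP; rewrite -leqn0 -En (big_rem w) //= leq_addr //.
  have fc i : is_constant (f i).
    apply: no_pole_is_constant => w; have := fge i w.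
    by case: ifP => // /D0 ->; rewrite oppr0.
  have /choice[c cP] := fc.
  have [a [b [_ _ ab]]] : exists a b : I, [/\ a \in I, b \in I & a != b].
    exact/card_gt1P.
  have [ca|ca] := eqVneq (c a) 0.
    exists (fun i => (i == a)%:R); first by exists a; rewrite eqxx oner_eq0.
    rewrite (bigD1 a) //= big1 => [|i /negPf->]; last by rewrite rmorph0 mul0r.
    by rewrite addr0 cP ca rmorph0 mulr0.
  exists (fun i => if i == a then c b else if i == b then - c a else 0).
    by exists b; rewrite eqxx [b == a]eq_sym (negPf ab) oppr_eq0.
  rewrite (bigD1 a) //= (bigD1 b) ?(eq_sym b) //= big1 => [|i /andP[/negPf->
      /negPf->]]; last first.
    by rewrite rmorph0 mul0r.
  by rewrite !eqxx (negPf ab) addr0 !cP -!rmorphM -rmorphD mulNr mulrC subrr rmorph0.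
have [w ws Dw] : exists2 w, w \in s & (0 < D w)%N.
  apply: contrapT => nw; move: En; rewrite big1_seq // => w /andP[_ ws].
  by apply/eqP; rewrite -leqn0 leqNgt; apply/negP => Dw; apply: nw; exists w.
pose D' u := if u == w then (D w).-1 else D u.
have EnD' : (\sum_(u <- s) D' u)%N = n.
  apply: succn_inj; rewrite -En (big_rem w ws) [in RHS](big_rem w ws) /=.
  rewrite /D' eqxx -addSn prednK //; congr (_ + _)%N.
  apply: eq_big_seq => u; rewrite mem_rem_uniq // !inE => /andP[/negPf-> _] //.
have [pi [pi0 wpi]] := uniformizer w.
have piD0 : pi ^+ D w != 0 by rewrite expf_neq0.
have wpiD : w (pi ^+ D w) = D w by rewrite valX wpi mulr1.
have fgew i : vge w (- (D w)%:Z) (f i) by have := fge i w; rewrite ws.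
have /choice[rho rhoP] i : exists r, vge w 1 (pi ^+ D w * f i - cst F r).
  apply: residue; have := vgeMZ w (- (D w)%:Z) (f i) piD0.
  by rewrite wpiD subrr => ->.
have lift (g : F) : vge w 1 (pi ^+ D w * g) -> vge w (- (D' w)%:Z) g.
  move=> h; rewrite -(vgeMZ _ _ _ piD0) wpiD /D' eqxx; apply: vgeW h; lia.
have [[a ra]|rho0] := pselect (exists a, rho a != 0); last first.
  apply: (IH _ D') => // [i u|]; last exact: ltn_trans cI.
  have [->|uw] := eqVneq u w; last by have := fge i u; rewrite /D' (negPf uw).
  rewrite ws; apply: lift; have := rhoP i.
  suff -> : rho i = 0 by rewrite rmorph0 subr0.
  by apply/eqP/negPn/negP => ri; apply: rho0; exists i.
pose J := {i : I | i \in predC1 a}.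
(* Gaussian elimination with pivot [a]: the leading coefficients at [w] cancel, which lowers the
   allowed pole order there by one at the cost of one function. *)
pose g (j : J) := f (val j) - cst F (rho (val j) / rho a) * f a.
have [||c [j cj] sumc] := IH J D' g EnD'.
- move=> j u; rewrite /g.
  have [->|uw] := eqVneq u w; last first.
    have fu i : vge u (if u \in s then - (D' u)%:Z else 0) (f i).
      by have := fge i u; rewrite /D' (negPf uw).
    by apply: vgeB; [|apply: vgeMl; [exact: vge_cst|]]; exact: fu.
  rewrite ws; apply: lift.
  have -> : pi ^+ D w * (f (val j) - cst F (rho (val j) / rho a) * f a) =
     (pi ^+ D w * f (val j) - cst F (rho (val j))) -
     cst F (rho (val j) / rho a) * (pi ^+ D w * f a - cst F (rho a)).
    by apply: residue_elimination; rewrite -rmorphM divfK.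
  by apply: vgeB => //; apply: vgeMl => //; exact: vge_cst.
- rewrite card_sig (@eq_card _ _ (predC1 a)) // cardC1.
  by move: cI; case: #|I| => // m; rewrite ltnS.
pose cc i := if insub i is Some j then c j else - \sum_j c j * (rho (val j) / rho a).
have ccj (k : J) : cc (val k) = c k by rewrite /cc valK.
exists cc; first by exists (val j); rewrite ccj.
rewrite (bigD1 a) //=.
have -> : cc a = - \sum_j c j * (rho (val j) / rho a).
  by rewrite /cc insubF // !inE eqxx.
rewrite rmorphN mulNr rmorph_sum /= mulr_suml.
have -> : \sum_(i | i != a) cst F (cc i) * f i = \sum_(j : J) cst F (c j) * f (val j).
  rewrite (eq_bigl (mem (predC1 a))); last by move=> i; rewrite !inE.
  rewrite (big_sub (predC1 a)).
  by apply: eq_bigr => k _; rewrite -ccj.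
rewrite addrC -sumrB -[RHS]sumc; apply: eq_bigr => k _.
by rewrite /g mulrBr rmorphM mulrA.
Qed.

Lemma dependent_of_pole_bound (I : finType) (s : seq (valuation F)) h (f : I -> F) :
  uniq s -> (forall i, pole_bound s h (f i)) -> (1 + size s * h < #|I|)%N ->
  exists2 c : I -> C, (exists i, c i != 0) & \sum_i cst F (c i) * f i = 0.
Proof.
move=> us fb cI; apply: (@dependent_of_degree I (fun=> h) s) => //.
by rewrite big_const_seq count_predT iter_addn_0 mulnC.
Qed.

Definition ev2 (z y : F) (Q : {poly {poly C}}) : F := (map_poly (ev z) Q).[y].

Lemma ev2_is_zmod_morphism z y : zmod_morphism (ev2 z y).
Proof. by move=> p q; rewrite /ev2 rmorphB hornerD hornerN. Qed.

Lemma ev2_is_monoid_morphism z y : monoid_morphism (ev2 z y).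
Proof. by split=> [|p q]; rewrite /ev2 ?rmorph1 ?hornerE // rmorphM hornerM. Qed.

HB.instance Definition _ z y := GRing.isZmodMorphism.Build {poly {poly C}} F (ev2 z y)
  (ev2_is_zmod_morphism z y).
HB.instance Definition _ z y := GRing.isMonoidMorphism.Build {poly {poly C}} F (ev2 z y)
  (ev2_is_monoid_morphism z y).

Lemma ev2D z y : {morph ev2 z y : p q / p + q}. Proof. exact: rmorphD. Qed.
Lemma ev2M z y : {morph ev2 z y : p q / p * q}. Proof. exact: rmorphM. Qed.
Lemma ev2_0 z y : ev2 z y 0 = 0. Proof. exact: rmorph0. Qed.
Lemma ev2C z y p : ev2 z y p%:P = ev z p.
Proof. by rewrite /ev2 map_polyC hornerC. Qed.
Lemma ev2X z y : ev2 z y 'X = y.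
Proof. by rewrite /ev2 map_polyX hornerX. Qed.

Lemma ev2E z y Q : ev2 z y Q = \sum_(i < size Q) ev z Q`_i * y ^+ i.
Proof.
elim/poly_ind: Q => [|Q c IH]; first by rewrite ev2_0 size_poly0 big_ord0.
rewrite (_ : \sum_(i < _) _ = \sum_(i < (size Q).+1) ev z (Q * 'X + c%:P)`_i * y ^+ i).
  rewrite ev2D ev2M ev2X ev2C IH big_ord_recl expr0 mulr1 coefD coefMX coefC add0r addrC.
  rewrite mulr_suml; congr (_ + _); apply: eq_bigr => i _.
  by rewrite coefD coefMX coefC /= addr0 exprSr mulrA.
rewrite size_MXaddC; case: ifP => // /andP[/eqP-> /eqP->].
by rewrite size_poly0 big_ord0 big_ord_recl big_ord0 mul0r add0r coefC ev0 mul0r addr0.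
Qed.

Definition bidegree_le (Q : {poly {poly C}}) (I J : nat) : Prop :=
  (size Q <= I.+1)%N /\ forall i, (size (Q`_i)%R <= J.+1)%N.

(** The monomials have pole divisors of degree at most [N * (J * N + I * h)], which is [I * J + J]
    for [I = N^2] and [J = N^3 * h]. There are [(I + 1) * (J + 1)] of them, more than
    [1 + I * J + J]. *)
Lemma algebraic_relation_bounded (s : seq (valuation F)) (N h : nat) (psi phi : F) :
  uniq s -> (0 < N)%N -> (size s <= N)%N -> pole_bound s N psi -> pole_bound s h phi ->
  exists Q, [/\ Q != 0, bidegree_le Q (N ^ 2) (N ^ 3 * h) & ev2 psi phi Q = 0].
Proof.
move=> us N0 sN psiN phih; set I := (N ^ 2)%N; set J := (N ^ 3 * h)%N.
pose f (ij : 'I_I.+1 * 'I_J.+1) := psi ^+ ij.2 * phi ^+ ij.1.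
have [|//|c [[i0 j0] c0] sumc] := @dependent_of_pole_bound _ s (J * N + I * h)%N f us.
- move=> [i j]; rewrite /f /=; apply: pole_bound_le; last first.
    by apply: pole_boundM; apply: pole_boundX; [exact: psiN|exact: phih].
  by apply: leq_add; rewrite leq_mul // -ltnS.
- rewrite card_prod !card_ord.
  have : (size s * (J * N + I * h) <= N * (J * N + I * h))%N by rewrite leq_mul2r sN orbT.
  have -> : (N * (J * N + I * h) = I * J + J)%N by rewrite /J /I; ring.
  have : (0 < I)%N by rewrite /I expn_gt0 N0.
  have arith (a i j : nat) : (0 < i -> a <= i * j + j -> 1 + a < i.+1 * j.+1)%N by nia.
  exact: arith.
pose Q := \poly_(i < I.+1) \poly_(j < J.+1) c (inord i, inord j).
exists Q; split.
- apply/eqP => Q0; have := congr1 (fun Q : {poly {poly C}} => Q`_i0`_j0) Q0.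
  by rewrite coef_poly ltn_ord coef_poly ltn_ord !coef0 !inord_val => /eqP; rewrite
      (negPf c0).
- split; first exact: size_poly.
  by move=> i; rewrite coef_poly; case: ifP => _; rewrite ?size_poly0 // size_poly.
- rewrite /Q poly_def (raddf_sum (ev2 psi phi)) /= -[RHS]sumc.
  rewrite (eq_bigr (fun i : 'I_I.+1 => \sum_(j < J.+1) cst F (c (i, j)) * f (i, j)));
      last first.
    move=> i _; rewrite -mul_polyC ev2M ev2C ev_poly rmorphXn /= ev2X mulr_suml.
    by apply: eq_bigr => j _; rewrite !inord_val mulrA.
  by rewrite pair_big /=; apply: eq_bigr => [[i j] _].
Qed.

(* Clearing powers of Y from the relation of phi over C[psi] makes its constant term
    nonzero. *)
Lemma zero_order_bound (s : seq (valuation F)) (N h : nat) (psi phi : F) (v : valuation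
    F) :
  uniq s -> (0 < N)%N -> (size s <= N)%N -> pole_bound s N psi -> pole_bound s h phi ->
  v psi < 0 -> phi != 0 -> v phi <= (N ^ 4 * h)%:Z.
Proof.
move=> us N0 sN psiN phih vpsi phi0.
have [Q [Q0 [sQ sQi] evQ]] := algebraic_relation_bounded us N0 sN psiN phih.
have [m [Q1]] := multiplicity_XsubC Q 0; rewrite Q0 /= => Q10 QE.
have psi0 : psi != 0 by apply: contraTneq vpsi => ->; rewrite val0.
rewrite leNgt; apply/negP => vphi.
have vpsiN : - N%:Z <= v psi.
  have := psiN v; rewrite vge_neq0 //; case: ifP => _; lia.
have vev (p : {poly C}) : (size p <= (N ^ 3 * h).+1)%N ->
    vge v ((N ^ 3 * h)%:Z * v psi) (ev psi p).
  move=> sp; rewrite evE; apply: vge_sum => i _.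
  apply: vgeMl; first exact: vge_cst.
  apply: vgeW (vgeX i (vge_val v psi)).
  have := ltn_ord i; have : (i < (N ^ 3 * h).+1)%N by apply: leq_trans (ltn_ord i) sp.
  by move: (N ^ 3 * h)%N => J; nia.
have evQ1 : ev2 psi phi Q1 = 0.
  move/eqP: evQ; rewrite QE subr0 ev2M rmorphXn /= ev2X mulf_eq0 expf_eq0 (negPf phi0)
      andbF orbF.
  by move/eqP.
have cQ1 i : (size (Q1`_i)%R <= (N ^ 3 * h).+1)%N.
  have := sQi (i + m)%N; rewrite QE subr0 coefMXn ltnNge leq_addl /= addnK //.
have q0 : Q1`_0 != 0 by rewrite -horner_coef0 -rootE.
(* At a pole of [psi] the top term of a polynomial in [psi] dominates, so the constant term of the
   relation has order at most 0. If [phi] vanished to order above [N^4 * h], all other terms would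
   have positive order. *)
have vq0 : ev psi Q1`_0 != 0 /\ (N ^ 3 * h)%:Z * v psi <= v (ev psi Q1`_0) <= 0.
  have sq0 : (0 < size (Q1`_0)%R)%N by rewrite size_poly_gt0.
  rewrite evE -(prednK sq0) big_ord_recr /= -lead_coefE; set n := (size (Q1`_0)%R).-1.
  have lc0 : cst F (lead_coef Q1`_0) != 0 by rewrite cst_eq0 lead_coef_eq0.
  have := @val_eqD _ _ v (cst F (lead_coef Q1`_0) * psi ^+ n) (\sum_(i < n) cst F
      Q1`_0`_i * psi ^+ i).
  rewrite mulf_neq0 ?expf_neq0 // valM ?expf_neq0 // val_cst add0r valX addrC.
  case=> // [|-> ->].
    apply: vge_sum => i _; apply: vgeMl; first exact: vge_cst.
    by apply: vgeW (vgeX i (vge_val v psi)); have := ltn_ord i; nia.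
  split=> //; have : (n <= N ^ 3 * h)%N by rewrite -ltnS /n prednK // cQ1.
  by move: (N ^ 3 * h)%N => J; nia.
have sQ1 : (0 < size Q1)%N by rewrite size_poly_gt0; apply: contraNneq q0 => ->;
    rewrite coef0.
move: evQ1; rewrite ev2E -(prednK sQ1) big_ord_recl expr0 mulr1.
have [q00 /andP[_ q0le]] := vq0.
have := @val_eqD _ _ v (ev psi Q1`_0) (\sum_(i < (size Q1).-1) ev psi Q1`_(lift ord0 i)
    * phi ^+ lift ord0 i) q00.
move=> h1 /eqP; case: h1 => [|/negPf -> //].
apply: vge_sum => i _.
apply: vgeW (vgeM (vev _ (cQ1 _)) (vgeX (lift ord0 i) (vge_val v phi))).
have arith (J x y z k : int) : x <= 0 -> - N%:Z <= y -> 0 <= J -> N%:Z * J < z ->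
    0 <= k -> x + 1 <= J * y + (k + 1) * z by nia.
have -> : (lift ord0 i : nat)%:Z = i%:Z + 1 by rewrite lift0; lia.
apply: arith => //.
by rewrite -PoszM mulnA -expnS.
Qed.

End BoundedPoles.

(** * Differentiation at a place *)

Lemma chain_rule_regroup (K : comNzRingType) (a b e y q x' y' : K) :
  (a * x' + b * y') * y + q * y' + e * x' = (a * y + e) * x' + (b * y + q) * y'.
Proof. by ring. Qed.

Lemma order_deriv_identity (K : comNzRingType) (m : nat) (t q q' : K) :
  t * (q' * t ^+ m + q * (m%:R * t ^+ m.-1)) - m%:R * (q * t ^+ m) = t ^+ m * t * q'.
Proof. by case: m => [|m] /=; rewrite ?exprS; ring. Qed.

Lemma sub_regroup (K : comNzRingType) (t g m f q q' : K) :
  t * g - m * f = (t * q' - m * q) + (t * (g - q') - m * (f - q)).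
Proof. by ring. Qed.

Lemma wronskian_identity (K : comNzRingType) (m n t f g f' g' : K) :
  (m - n) * (f * g) + ((t * f' - m * f) * g - f * (t * g' - n * g)) = t * (f' * g - f *
      g').
Proof. by ring. Qed.

Lemma leibniz_error (K : comNzRingType) (f1 f2 g1 g2 q1 q2 r1 r2 : K) :
  (f1 * f2 - q1 * q2 = (f1 - q1) * f2 + q1 * (f2 - q2)) *
  ((g1 * f2 + f1 * g2) - (r1 * q2 + q1 * r2) =
    (g1 - r1) * f2 + r1 * (f2 - q2) + ((f1 - q1) * g2 + q1 * (g2 - r2))).
Proof. by split; ring. Qed.

(** With [U = f * ym] and [V = h * xn], the Wronskian divided by [U * V] is the logarithmic
    derivative of [U / V], here cleared of denominators by [f * y * h * x]. The hypotheses are the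
    power rule, with the exponents absorbed in [y'] and [x']. *)
Lemma wronskian_expansion (K : comNzRingType) (f y h x f' y' h' x' ym xn ym' xn' : K) :
  y * ym' = ym * y' -> x * xn' = xn * x' ->
  ((f' * ym + f * ym') * (h * xn) - f * ym * (h' * xn + h * xn')) * (f * y * h * x) =
  f * ym * (h * xn) *
    (f' * (y * h * x) + y' * (f * h * x) - h' * (f * y * x) - x' * (f * y * h)).
Proof.
move=> ey ex.
have -> : ((f' * ym + f * ym') * (h * xn) - f * ym * (h' * xn + h * xn')) * (f * y * h
    * x) =
  f * h * (f' * ym * h * xn * y * x + f * (y * ym') * h * xn * x - f * ym * h' * xn * y
      * x
    - f * ym * h * (x * xn') * y) by ring.
by rewrite ey ex; ring.
Qed.

(** The sums [a * x' + p * y'], [a1 * x' + p1 * f'] and [a2 * x' + p2 * h'] are differentiated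
    relations, which vanish up to truncation. Modulo them every derivative becomes a multiple of
    [x']. *)
Lemma chain_elimination (K : comNzRingType)
  (f y h x f' y' h' x' p p1 p2 a a1 a2 m n : K) :
  (f' * (y * h * x) + m * y' * (f * h * x) - h' * (f * y * x) - n * x' * (f * y * h)) *
      (p * p1 * p2) =
  x' * (- (a1 * p * p2 * (y * h * x)) - m * (a * p1 * p2 * (f * h * x)) +
        a2 * p * p1 * (f * y * x) - n * (p * p1 * p2 * (f * y * h))) +
  ((a1 * x' + p1 * f') * (p * p2 * (y * h * x)) +
   (a * x' + p * y') * (m * p1 * p2 * (f * h * x)) -
   (a2 * x' + p2 * h') * (p * p1 * (f * y * x))).
Proof. by ring. Qed.

Section ApproximateDerivation.
Variables (R : realType) (F : funfield R) (v : valuation F) (pi : F).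
Hypotheses (pi0 : pi != 0) (vpi : v pi = 1).
Local Notation C := R[i].

Lemma expansion (f : F) (k : nat) : vge v 0 f ->
  exists q : {poly C}, vge v k (f - ev pi q).
Proof.
move=> f0; elim: k => [|k [q qP]]; first by exists 0; rewrite ev0 subr0.
have pk : pi ^+ k != 0 by rewrite expf_neq0.
have vpk : v (pi ^+ k) = k by rewrite valX vpi mulr1.
have [|c cP] := @residue _ _ v ((f - ev pi q) / pi ^+ k).
  by rewrite -(vgeMZ _ _ _ pk) vpk addr0 mulrC divfK.
exists (q + c%:P * 'X^k); rewrite evD evM evC evXn evX opprD addrA.
move: cP; rewrite -(vgeMZ _ _ _ pk) vpk mulrBr [pi ^+ k * (_ / _)]mulrC divfK //.
by rewrite [pi ^+ k * _]mulrC (_ : k.+1%:Z = k%:Z + 1) //; lia.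
Qed.

(* g approximates df / dpi up to order k; working with truncated expansions at v
   avoids both the completion of F and derivations of F. *)
Definition approx_deriv (k : nat) (f g : F) : Prop := exists q : {poly C},
  vge v (k%:Z + 1) (f - ev pi q) /\ vge v k (g - ev pi q^`()).

Lemma vge_pi : vge v 0 pi. Proof. by rewrite vge_neq0 // vpi. Qed.

Lemma approx_derivP k (f : F) : vge v 0 f -> exists g, approx_deriv k f g.
Proof.
move=> f0; have [q qP] := expansion k.+1 f0.
exists (ev pi q^`()), q; rewrite subrr vge0; split=> //.
by move: qP; rewrite intS addrC.
Qed.

Lemma approx_deriv_integral k f g : approx_deriv k f g -> vge v 0 f /\ vge v 0 g.
Proof.
move=> [q [fq gq]]; rewrite -[f](subrK (ev pi q)) -[g](subrK (ev pi q^`())).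
by split; apply: vgeD; rewrite ?vge_ev ?vge_pi //; [apply: vgeW fq|apply: vgeW gq]; lia.
Qed.

Lemma approx_derivD k f1 f2 g1 g2 : approx_deriv k f1 g1 -> approx_deriv k f2 g2 ->
  approx_deriv k (f1 + f2) (g1 + g2).
Proof.
move=> [q1 [fq1 gq1]] [q2 [fq2 gq2]]; exists (q1 + q2).
by rewrite derivD !evD !opprD; split; rewrite addrACA; apply: vgeD.
Qed.

Lemma approx_derivM k f1 f2 g1 g2 : approx_deriv k f1 g1 -> approx_deriv k f2 g2 ->
  approx_deriv k (f1 * f2) (g1 * f2 + f1 * g2).
Proof.
move=> d1 d2; have [f10 g10] := approx_deriv_integral d1.
have [f20 g20] := approx_deriv_integral d2.
move: d1 d2 => [q1 [fq1 gq1]] [q2 [fq2 gq2]]; exists (q1 * q2).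
have q0 q : vge v 0 (ev pi q) by rewrite vge_ev ?vge_pi.
have e := leibniz_error f1 f2 g1 g2 (ev pi q1) (ev pi q2) (ev pi q1^`()) (ev pi q2^`()).
rewrite derivM evD !evM e.1 e.2.
have lk : k%:Z <= k%:Z + 1 by lia.
split; first by apply: vgeD; [exact: vgeMr|exact: vgeMl].
apply: vgeD; apply: vgeD; [exact: vgeMr|apply: vgeMl|apply: vgeMr|exact: vgeMl] => //.
  exact: vgeW fq2.
exact: vgeW fq1.
Qed.

Lemma approx_deriv_cst k c : approx_deriv k (cst F c) 0.
Proof. by exists c%:P; rewrite derivC ev0 evC !subrr !vge0. Qed.

Lemma approx_deriv0 k : approx_deriv k 0 0.
Proof. by have := approx_deriv_cst k 0; rewrite rmorph0. Qed.

Lemma approx_derivZ k c f g : approx_deriv k f g -> approx_deriv k (cst F c * f) (cst F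
    c * g).
Proof.
by move=> /(approx_derivM (approx_deriv_cst k c)); rewrite mul0r add0r.
Qed.

Lemma approx_derivX k n f g : approx_deriv k f g ->
  approx_deriv k (f ^+ n) (n%:R * f ^+ n.-1 * g).
Proof.
move=> d; elim: n => [|n IH].
  by rewrite mul0r mul0r expr0 -(rmorph1 (@cst R F)); exact: approx_deriv_cst.
rewrite exprS; suff -> : n.+1%:R * f ^+ n.+1.-1 * g = g * f ^+ n + f * (n%:R * f ^+
    n.-1 * g).
  exact: approx_derivM.
case: n {IH} => [|n] /=; first by rewrite !mul0r mulr0 addr0 !mul1r mulr1.
rewrite [in LHS]mulrS mulrDl mul1r mulrDl [g * _]mulrC; congr (_ + _).
by rewrite mulrA [f * (_ * _)]mulrCA -exprS.
Qed.

Lemma approx_deriv_ev k p x x' : approx_deriv k x x' ->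
  approx_deriv k (ev x p) (ev x p^`() * x').
Proof.
move=> d; elim/poly_ind: p => [|p c IH].
  by rewrite deriv0 !ev0 mul0r; exact: approx_deriv0.
rewrite derivD derivM derivX derivC addr0 mulr1 !evD !evM evX evC.
have := approx_derivD (approx_derivM IH d) (approx_deriv_cst k c).
by rewrite addr0 mulrDl mulrAC.
Qed.

(** The partial derivative in the inner variable; [deriv] applied to [Q] itself is the one in the
    outer variable. *)
Definition dx (Q : {poly {poly C}}) : {poly {poly C}} := map_poly (@deriv C) Q.

Lemma approx_deriv_ev2 k Q x y x' y' : approx_deriv k x x' -> approx_deriv k y y' ->
  approx_deriv k (ev2 x y Q) (ev2 x y (dx Q) * x' + ev2 x y Q^`() * y').
Proof.
move=> dx' dy'; elim/poly_ind: Q => [|Q p IH].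
  rewrite deriv0 /dx map_poly0 !ev2_0 !mul0r addr0; exact: approx_deriv0.
have -> : dx (Q * 'X + p%:P) = dx Q * 'X + p^`()%:P.
  apply/polyP => i; rewrite !(coefD, coefMX, coefC, coef_map) /=.
  by case: i => [|i] /=; rewrite ?add0r ?addr0.
rewrite derivD derivM derivX derivC addr0 mulr1 !ev2D !ev2M ev2X !ev2C.
have := approx_derivD (approx_derivM IH dy') (approx_deriv_ev p dx').
set A := ev2 _ _ (dx Q); set B := ev2 _ _ Q^`().
suff -> : (A * x' + B * y') * y + ev2 x y Q * y' + ev x p^`() * x' =
  (A * y + ev x p^`()) * x' + (B * y + ev2 x y Q) * y' by [].
exact: chain_rule_regroup.
Qed.

(** The Euler operator [pi * d/dpi] multiplies the leading term of an expansion by its order. *)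
Lemma order_deriv (q : {poly C}) : q != 0 -> exists m : nat,
  [/\ ev pi q != 0, v (ev pi q) = m & vge v (m%:Z + 1) (pi * ev pi q^`() - m%:R * ev pi
      q)].
Proof.
move=> q0; have [m [q1]] := multiplicity_XsubC q 0; rewrite q0 subr0 /= => q10 ->.
have vpi0 : 0 < v pi by rewrite vpi.
have [e1 ve1] := val_ev0 pi0 vpi0 q10.
have pm : pi ^+ m != 0 by rewrite expf_neq0.
exists m; rewrite evM evXn evX mulf_neq0 // valM // ve1 add0r valX vpi mulr1; split=> //.
have -> : pi * ev pi (q1 * 'X^m)^`() - m%:R * (ev pi q1 * pi ^+ m) = pi ^+ m * pi * ev
    pi q1^`().
  rewrite derivM derivXn evD !evM evXn evX.
  have -> : ev pi ('X^(m.-1) *+ m) = m%:R * pi ^+ m.-1.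
    by rewrite -mulr_natl evM rmorph_nat evXn evX.
  exact: order_deriv_identity.
rewrite -exprSr; apply: vgeMr; last by rewrite vge_ev ?vge_pi.
by rewrite vge_neq0 ?expf_neq0 // valX vpi mulr1; lia.
Qed.

Lemma approx_deriv_lead k f g : approx_deriv k f g -> f != 0 -> v f <= k%:Z ->
  exists m : nat, v f = m /\ vge v (m%:Z + 1) (pi * g - m%:R * f).
Proof.
move=> [q [fq gq]] f0 vf.
have [|] := @val_eqD _ _ v f (- (f - ev pi q)) f0.
  by rewrite vgeN; apply: vgeW fq; lia.
rewrite opprB addrC subrK => e0 ve.
have q0 : q != 0 by apply: contra_neq e0 => ->; rewrite ev0.
have [m [_ vem em]] := order_deriv q0.
have vfm : v f = m by rewrite -ve.
exists m; split=> //.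
have -> : pi * g - m%:R * f = (pi * ev pi q^`() - m%:R * ev pi q) +
    (pi * (g - ev pi q^`()) - m%:R * (f - ev pi q)).
  exact: sub_regroup.
apply: vgeD => //; apply: vgeB.
  by rewrite addrC -vpi vgeMZ //; apply: vgeW gq; rewrite -vfm.
by apply: vgeMl; [exact: vge_nat|apply: vgeW fq; rewrite -vfm; lia].
Qed.

(** The polynomial [q] approximating 0 need not be 0, only of order at least [k + 1];
    differentiation lowers the order by at most one. *)
Lemma approx_deriv_zero k g : approx_deriv k 0 g -> vge v k g.
Proof.
move=> [q []]; rewrite sub0r vgeN => fq gq.
rewrite -[g](subrK (ev pi q^`())); apply: vgeD => //.
have [->|q0] := eqVneq q 0; first by rewrite deriv0 ev0 vge0.
have [m [e0 vem em]] := order_deriv q0.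
move: fq; rewrite vge_neq0 // vem => km.
rewrite -(vgeMZ _ _ _ pi0) vpi -[_ * _](subrK (m%:R * ev pi q)).
apply: vgeD; first by apply: vgeW em; lia.
by apply: vgeMl; [exact: vge_nat|rewrite vge_neq0 // vem; lia].
Qed.

(* Characteristic 0 makes the order exact. *)
Lemma wronskian_order k f f' g g' : approx_deriv k f f' -> approx_deriv k g g' ->
  f != 0 -> g != 0 -> v f <= k%:Z -> v g <= k%:Z -> v f != v g ->
  f' * g - f * g' != 0 /\ v (f' * g - f * g') = v f + v g - 1.
Proof.
move=> df dg f0 g0 vf vg fg.
have [m [vfm em]] := approx_deriv_lead df f0 vf.
have [n [vgn en]] := approx_deriv_lead dg g0 vg.
set W := f' * g - f * g'.
have mn : cst F (m%:R - n%:R) != 0.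
  by rewrite cst_eq0 subr_eq0 eqr_nat; apply: contra_neq fg; rewrite vfm vgn => ->.
have fg0 : cst F (m%:R - n%:R) * (f * g) != 0 by rewrite !mulf_neq0.
have [|] := @val_eqD _ _ v (cst F (m%:R - n%:R) * (f * g))
   ((pi * f' - m%:R * f) * g - f * (pi * g' - n%:R * g)) fg0.
  rewrite valM ?mulf_neq0 // val_cst add0r valM //; apply: vgeB.
    by rewrite addrAC; apply: vgeM; [rewrite vfm|exact: vge_val].
  by rewrite -addrA; apply: vgeM; [exact: vge_val|rewrite vgn].
have -> : cst F (m%:R - n%:R) * (f * g) + ((pi * f' - m%:R * f) * g - f * (pi * g' -
    n%:R * g)) = pi * W.
  by rewrite rmorphB !rmorph_nat; exact: wronskian_identity.
rewrite mulf_eq0 (negPf pi0) /= => W0; rewrite valM // vpi valM ?mulf_neq0 // val_cst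
    add0r valM //.
by move=> e; split=> //; lia.
Qed.

End ApproximateDerivation.

(** * Order of vanishing of u - 1 *)

Lemma wronskian_shift (K : comNzRingType) (c u v u' v' : K) :
  (u' - c * v') * v - (u - c * v) * v' = u' * v - u * v'.
Proof. by ring. Qed.

Lemma power_rule_shift (K : comNzRingType) (n : nat) (t t' : K) :
  t * (n%:R * t ^+ n.-1 * t') = t ^+ n * (n%:R * t').
Proof. by case: n => [|n] /=; rewrite ?exprS; ring. Qed.

Section AbcInequality.
Variables (R : realType) (F : funfield R).
Local Notation C := R[i].

Lemma bidegree_le_deriv (Q : {poly {poly C}}) I J : bidegree_le Q I J -> bidegree_le
    Q^`() I J.
Proof.
move=> [sQ1 sQ2]; split; last first.
  by move=> i; rewrite coef_deriv -scaler_nat; apply: leq_trans (size_scale_leq _ _)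
      (sQ2 _).
have [->|Q0] := eqVneq Q 0; first by rewrite deriv0 size_poly0.
by apply: leq_trans (ltnW (lt_size_deriv Q0)) sQ1.
Qed.

(** While the derivative in the outer variable also vanishes at [(x, phi)], it replaces the
    relation, with smaller size and within the same bidegree. The descent ends before that
    derivative is the zero polynomial, because [x] is not algebraic over C. *)
Lemma minimal_relation (s : seq (valuation F)) (N h : nat) (x phi : F) :
  uniq s -> (0 < N)%N -> (size s <= N)%N -> pole_bound s N x -> pole_bound s h phi ->
  ~ is_constant x ->
  exists Q, [/\ bidegree_le Q (N ^ 2) (N ^ 3 * h), ev2 x phi Q = 0 & ev2 x phi Q^`() !=
      0].
Proof.
move=> us N0 sN xN phih xnc.
have [Q0 [Q0n bQ0 eQ0]] := algebraic_relation_bounded us N0 sN xN phih.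
have [n] := ubnP (size Q0); elim: n Q0 Q0n bQ0 eQ0 => // n IH Q Q0 bQ eQ sQ.
have [d0|] := eqVneq (ev2 x phi Q^`()) 0; last by exists Q.
have Qd : Q^`() != 0.
  apply/eqP => Qd; apply: xnc.
  have QC : Q = (Q`_0)%:P.
    apply/polyP => [[|i]]; rewrite coefC //=.
    have := congr1 (fun P : {poly {poly C}} => P`_i) Qd; rewrite coef_deriv coef0 => /eqP.
    by rewrite -scaler_nat scaler_eq0 pnatr_eq0 => /eqP.
  apply: (@algebraic_is_constant _ _ _ Q`_0); last by have := eQ; rewrite {1}QC ev2C.
  by apply: contra_neq Q0 => e; rewrite QC e polyC0.
apply: (IH Q^`()) => //; last by rewrite (leq_trans (lt_size_deriv Q0)) // -ltnS.
exact: bidegree_le_deriv.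
Qed.

Lemma pole_bound_ev2 (s : seq (valuation F)) N H I J x y (Q : {poly {poly C}}) :
  pole_bound s N x -> pole_bound s H y -> bidegree_le Q I J ->
  pole_bound s (J * N + I * H) (ev2 x y Q).
Proof.
move=> xN yH [sQ sQi]; rewrite ev2E; apply: pole_bound_sum => i _.
have iI : (i <= I)%N by rewrite -ltnS; exact: leq_trans (ltn_ord i) sQ.
apply: (@pole_bound_le _ _ _ (J * N + i * H)); first by rewrite leq_add2l leq_mul2r iI
    orbT.
apply: pole_boundM; last exact: pole_boundX.
rewrite evE; apply: pole_bound_sum => j _; apply: pole_bound_cstM.
have jJ : (j <= J)%N by rewrite -ltnS; exact: leq_trans (ltn_ord j) (sQi i).
by apply: (@pole_bound_le _ _ _ (j * N)); rewrite ?leq_mul2r ?jJ ?orbT //; exact: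
    pole_boundX.
Qed.

Lemma bidegree_le_dx (Q : {poly {poly C}}) I J : bidegree_le Q I J -> bidegree_le (dx
    Q) I J.
Proof.
move=> [sQ1 sQ2]; split; first exact: leq_trans (size_poly _ _) sQ1.
move=> i; rewrite coef_map /=.
have [->|Q0] := eqVneq Q`_i 0; first by rewrite deriv0 size_poly0.
by apply: leq_trans (ltnW (lt_size_deriv Q0)) (sQ2 i).
Qed.

(** The bound of [pole_bound_ev2] for the bidegree [(N^2, N^3 * H)] of [minimal_relation]. *)
Definition relation_height (N H : nat) : nat := (N ^ 3 * H * N + N ^ 2 * H)%N.

(** The witnesses are the partial derivatives of a minimal relation, so the chain rule gives [phi']
    as [- (a / p) * x'] up to truncation. They do not depend on [k], which is later chosen large in
    terms of the order of [p]. *)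
Lemma relation_terms (s : seq (valuation F)) (N H : nat) (x phi : F) (v : valuation F)
    (pi : F) :
  pi != 0 -> v pi = 1 ->
  uniq s -> (0 < N)%N -> (size s <= N)%N -> pole_bound s N x -> pole_bound s H phi ->
  ~ is_constant x -> vge v 0 x -> vge v 0 phi ->
  exists a p : F, [/\ p != 0, vge v 0 a & vge v 0 p] /\
    [/\ pole_bound s (relation_height N H) a, pole_bound s (relation_height N H) p &
     forall k x' phi', approx_deriv v pi k x x' -> approx_deriv v pi k phi phi' ->
       vge v k (a * x' + p * phi')].
Proof.
move=> pi0 vpi us N0 sN xN phiH xnc x0 phi0.
have [Q [bQ eQ dQ]] := minimal_relation us N0 sN xN phiH xnc.
have v2 P : vge v 0 (ev2 x phi P).
  by rewrite ev2E; apply: vge_sum => i _; apply: vgeMr; [exact: vge_ev|exact: vge0X].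
exists (ev2 x phi (dx Q)), (ev2 x phi Q^`()); split; split=> //.
- by apply: pole_bound_ev2 => //; exact: bidegree_le_dx.
- by apply: pole_bound_ev2 => //; exact: bidegree_le_deriv.
move=> k x' phi' dx' dphi'; apply: (approx_deriv_zero pi0 vpi).
by rewrite -eQ; apply: approx_deriv_ev2.
Qed.

(** The bound of [zero_order_bound] for sums of products of three relation terms and three functions
    among [f], [h], [x], [y]. *)
Definition abc_bound (N H : nat) : nat := (N ^ 4 * (3 * relation_height N H + 3 * H))%N.

(* A Mason-Stothers inequality for U = V + (U - V), with a bound on the order
   of U - c V at v which does not depend on the exponents m and n. *)
Lemma abc_inequality (s : seq (valuation F)) (N H m n : nat) (x y f h : F) (c : C) (v :
    valuation F) :
  uniq s -> (0 < N)%N -> (size s <= N)%N -> (N <= H)%N ->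
  pole_bound s N x -> pole_bound s N x^-1 -> pole_bound s H y ->
  pole_bound s H f -> pole_bound s H h ->
  c != 0 -> y != 0 -> f != 0 -> h != 0 -> 0 < v x -> vge v 0 y -> vge v 0 f -> vge v 0
      h ->
  let U := f * y ^+ m in let V := h * x ^+ n in let Z := U - cst F c * V in
  Z != 0 -> v V < v Z -> v Z <= v V + (abc_bound N H)%:Z.
Proof.
move=> us N0 sN NH xN xiN yH fH hH c0 y0 f0 h0 vx vy vf vh U V Z Z0 VZ.
have x0 : x != 0 by apply: contraTneq vx => ->; rewrite val0.
have vx0 : vge v 0 x by rewrite vge_neq0 // ltW.
have xnc : ~ is_constant x by case=> e xe; move: vx; rewrite xe val_cst.
have [pi [pi0 vpi]] := uniformizer v.
have [a [p [[p0 va vp] [aH pH ap]]]] := relation_terms pi0 vpi us N0 sN xN yH xnc vx0 vy.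
have [a1 [p1 [[p10 va1 vp1] [a1H p1H ap1]]]] := relation_terms pi0 vpi us N0 sN xN fH
    xnc vx0 vf.
have [a2 [p2 [[p20 va2 vp2] [a2H p2H ap2]]]] := relation_terms pi0 vpi us N0 sN xN hH
    xnc vx0 vh.
set D := relation_height N H in aH pH a1H p1H a2H p2H.
have U0 : U != 0 by rewrite mulf_neq0 ?expf_neq0.
have V0 : V != 0 by rewrite mulf_neq0 ?expf_neq0.
have vU : v U = v V.
  have cV0 : cst F c * V != 0 by rewrite mulf_neq0 ?cst_eq0.
  have vcV : v (cst F c * V) = v V by rewrite valM ?cst_eq0 // val_cst add0r.
  have [|_] := @val_eqD _ _ v (cst F c * V) Z cV0.
    by rewrite vcV vge_neq0 // lezD1.
  by rewrite vcV addrC subrK.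
have mono : f * y * h * x != 0 by rewrite !mulf_neq0.
have pp : p * p1 * p2 != 0 by rewrite !mulf_neq0.
have vmono : v x <= v (f * y * h * x).
  rewrite valM ?mulf_neq0 // -[X in X <= _]add0r lerD2r.
  by rewrite -vge_neq0 ?mulf_neq0 //; do !apply: vgeMl => //.
have vpp : 0 <= v (p * p1 * p2).
  by rewrite -vge_neq0 //; do !apply: vgeMl => //.
(* The order that [T * (p * p1 * p2)] will turn out to have; [k] is taken larger so that truncation
   errors cannot affect it. *)
pose tau := v Z - v V - 1 + v (f * y * h * x) + v (p * p1 * p2).
pose k := (`|v Z| + `|v V| + `|v x| + `|tau|)%N.+1.
have [x' dx'] := approx_derivP pi0 vpi k vx0.
have [y' dy'] := approx_derivP pi0 vpi k vy.
have [f' df'] := approx_derivP pi0 vpi k vf.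
have [h' dh'] := approx_derivP pi0 vpi k vh.
have dU := approx_derivM pi0 vpi df' (approx_derivX pi0 vpi m dy').
have dV := approx_derivM pi0 vpi dh' (approx_derivX pi0 vpi n dx').
set U' := (X in approx_deriv _ _ _ _ X) in dU.
set V' := (X in approx_deriv _ _ _ _ X) in dV.
have dZ : approx_deriv v pi k Z (U' - cst F c * V').
  rewrite /Z -[cst F c]opprK -rmorphN mulNr opprK [in X in approx_deriv _ _ _ _ X]mulNr
      opprK.
  apply: approx_derivD => //; exact: approx_derivZ.
have [[kZ kV] [kx ktau]] : (v Z <= k%:Z /\ v V <= k%:Z) /\ (v x <= k%:Z /\ tau < k%:Z).
  by rewrite /k; move: (v Z) (v V) (v x) (tau) => i1 i2 i3 i4; clear; lia.
have ZV : v Z != v V by rewrite neq_lt VZ orbT.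
(* The Wronskian with [V] is the same for [Z] and [U], so that of [U] and [V] has order
   [v Z + v V - 1]. Compared with [U * V], of order [2 * v V], this measures how closely [U / V]
   approaches [c]. *)
have [W0 vW] := wronskian_order pi0 vpi dZ dV Z0 V0 kZ kV ZV.
have WE : (U' - cst F c * V') * V - Z * V' = U' * V - U * V'.
  exact: wronskian_shift.
rewrite WE in W0 vW.
(* The logarithmic derivative of [U / V] cleared of denominators: [m] and [n] remain only as
   scalars. *)
pose T := f' * (y * h * x) + m%:R * y' * (f * h * x) - h' * (f * y * x) - n%:R * x' *
    (f * y * h).
have TE : (U' * V - U * V') * (f * y * h * x) = U * V * T.
  have := @wronskian_expansion F f y h x f' (m%:R * y') h' (n%:R * x') (y ^+ m) (x ^+ n)
    (m%:R * y ^+ m.-1 * y') (n%:R * x ^+ n.-1 * x').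
  by apply; exact: power_rule_shift.
have T0 : T != 0.
  by apply: contra_neq (mulf_neq0 W0 mono) => T0; rewrite TE T0 mulr0.
have vT : v (T * (p * p1 * p2)) = tau.
  have := congr1 v TE; rewrite (valM _ W0 mono) vW (valM _ (mulf_neq0 U0 V0) T0) (valM
      _ U0 V0) vU -/V => e.
  rewrite (valM _ T0 pp) /tau; move: e.
  move: (v Z) (v V) (v (f * y * h * x)) (v T) (v (p * p1 * p2)) => i1 i2 i3 i4 i5;
      clear; lia.
(* The quotient of [T * (p * p1 * p2)] by [x'] after elimination. It is a genuine function with
   poles bounded independently of [k], [m] and [n], unlike the approximate derivatives. *)
pose Psi := - (a1 * p * p2 * (y * h * x)) - m%:R * (a * p1 * p2 * (f * h * x)) +
  a2 * p * p1 * (f * y * x) - n%:R * (p * p1 * p2 * (f * y * h)).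
have e1 := ap1 _ _ _ dx' df'; have e0 := ap _ _ _ dx' dy'; have e2 := ap2 _ _ _ dx' dh'.
have [||xP0 vxP] := @val_eqD _ _ v (T * (p * p1 * p2))
  (- ((a1 * x' + p1 * f') * (p * p2 * (y * h * x)) +
      (a * x' + p * y') * (m%:R * p1 * p2 * (f * h * x)) -
      (a2 * x' + p2 * h') * (p * p1 * (f * y * x)))).
- by rewrite mulf_neq0.
- rewrite vT vgeN; apply: (@vgeW _ _ _ _ k); first by rewrite lezD1.
  by apply: vgeB; [apply: vgeD|]; apply: vgeMr => //; do !apply: vgeMl => //; exact:
      vge_nat.
have PsiE : T * (p * p1 * p2) - ((a1 * x' + p1 * f') * (p * p2 * (y * h * x)) +
      (a * x' + p * y') * (m%:R * p1 * p2 * (f * h * x)) -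
      (a2 * x' + p2 * h') * (p * p1 * (f * y * x))) = x' * Psi.
  by rewrite /T (@chain_elimination _ f y h x f' y' h' x' p p1 p2 a a1 a2 m%:R n%:R)
      addrK.
rewrite PsiE vT in xP0 vxP.
have [x'0 Psi0] : x' != 0 /\ Psi != 0.
  by move: xP0; rewrite mulf_eq0 negb_or => /andP[].
have vx' : v x' = v x - 1.
  have [e [vxe ee]] := approx_deriv_lead pi0 vpi dx' x0 kx.
  have ex : e%:R * x != 0.
    by rewrite mulf_neq0 // -(rmorph_nat (@cst R F)) cst_eq0 pnatr_eq0; move: vx;
        rewrite vxe; case: (e).
  have ve : v (e%:R * x) = v x.
    rewrite valM //; last by move: ex; rewrite mulf_eq0 negb_or => /andP[].
    by rewrite -(rmorph_nat (@cst R F)) val_cst add0r.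
  have [|_] := @val_eqD _ _ v (e%:R * x) (pi * x' - e%:R * x) ex.
    by rewrite ve vxe.
  by rewrite addrC subrK valM // vpi ve; move: (v x') (v x) => i1 i2; clear; lia.
have vPsi : v Psi = tau - v x + 1.
  by move: vxP; rewrite valM // vx'; move: (v Psi) (v x) (tau) => i1 i2 i3; clear; lia.
have PsiH : pole_bound s (3 * D + 3 * H) Psi.
  have yhx : pole_bound s (3 * H) (y * h * x).
    by apply: pole_bound_le (pole_boundM (pole_boundM yH hH) xN); move: NH; clear; lia.
  have fhx : pole_bound s (3 * H) (f * h * x).
    by apply: pole_bound_le (pole_boundM (pole_boundM fH hH) xN); move: NH; clear; lia.
  have fyx : pole_bound s (3 * H) (f * y * x).
    by apply: pole_bound_le (pole_boundM (pole_boundM fH yH) xN); move: NH; clear; lia.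
  have fyh : pole_bound s (3 * H) (f * y * h).
    by apply: pole_bound_le (pole_boundM (pole_boundM fH yH) hH); clear; lia.
  have prod3 q1 q2 q3 g : pole_bound s D q1 -> pole_bound s D q2 -> pole_bound s D q3 ->
      pole_bound s (3 * H) g -> pole_bound s (3 * D + 3 * H) (q1 * q2 * q3 * g).
    move=> b1 b2 b3 bg.
    by apply: pole_bound_le (pole_boundM (pole_boundM (pole_boundM b1 b2) b3) bg);
        clear; lia.
  have nat_mul (j : nat) g : pole_bound s (3 * D + 3 * H) g -> pole_bound s (3 * D + 3
      * H) (j%:R * g).
    by rewrite -(rmorph_nat (@cst R F)); exact: pole_bound_cstM.
  rewrite /Psi; apply: pole_boundD; [apply: pole_boundD; [apply: pole_boundD|]|].
  - by apply: pole_boundN; apply: prod3.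
  - by apply: pole_boundN; apply: nat_mul; apply: prod3.
  - exact: prod3.
  - by apply: pole_boundN; apply: nat_mul; apply: prod3.
(* The pole at [v] needed by [zero_order_bound] is that of [1/x]. *)
have vxi : v x^-1 < 0 by rewrite valV oppr_lt0.
have := zero_order_bound us N0 sN xiN PsiH vxi Psi0.
rewrite vPsi /tau -/(abc_bound N H); move: vmono vpp.
move: (v Z) (v V) (v (f * y * h * x)) (v (p * p1 * p2)) (v x) => i1 i2 i3 i4 i5; clear;
    lia.
Qed.

End AbcInequality.

(** * Sequences with a dominant root *)

(** Inverse roots replace poles at [v] by zeros, and the [k] additional powers absorb the poles of
    [f] and [h] there, as [abc_inequality] needs integral functions. *)
Lemma common_denominator (K : fieldType) (f h a b : K) (n m k : nat) : a != 0 -> b != 0 ->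
  f * a^-1 ^+ k * b^-1 ^+ (m + k) - h * b^-1 ^+ k * a^-1 ^+ (n + k) =
  (f * a ^+ n - h * b ^+ m) * (a^-1 ^+ (n + k) * b^-1 ^+ (m + k)).
Proof.
move=> a0 b0; rewrite !exprD !exprVn.
have an : a ^+ n != 0 by rewrite expf_neq0.
have ak : a ^+ k != 0 by rewrite expf_neq0.
have bm : b ^+ m != 0 by rewrite expf_neq0.
have bk : b ^+ k != 0 by rewrite expf_neq0.
move: (a ^+ n) (a ^+ k) (b ^+ m) (b ^+ k) an ak bm bk => p q r t p0 q0 r0 t0.
by field; rewrite p0 q0 r0 t0.
Qed.

Lemma clear_denominator (K : fieldType) (h a b : K) (n m k : nat) : a != 0 -> b != 0 ->
  h * b^-1 ^+ k * a^-1 ^+ (n + k) = h * b ^+ m * (a^-1 ^+ (n + k) * b^-1 ^+ (m + k)).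
Proof.
move=> a0 b0; rewrite !exprD !exprVn.
have an : a ^+ n != 0 by rewrite expf_neq0.
have ak : a ^+ k != 0 by rewrite expf_neq0.
have bm : b ^+ m != 0 by rewrite expf_neq0.
have bk : b ^+ k != 0 by rewrite expf_neq0.
move: (a ^+ n) (a ^+ k) (b ^+ m) (b ^+ k) an ak bm bk => p q r t p0 q0 r0 t0.
by field; rewrite p0 q0 r0 t0.
Qed.

Lemma regroup_diff (K : comNzRingType) (g g' u u' : K) :
  g - g' = u + (g - u - (g' - u' + u')).
Proof. by ring. Qed.

Lemma truncation_identity (K : fieldType) (a t : K) (n k : nat) : t != 0 ->
  a * (t ^+ n * t ^+ k) - a * t ^+ n = a * (1 - t^-1 ^+ k) * (t ^+ n * t ^+ k).
Proof.
move=> t0; rewrite exprVn; have tk : t ^+ k != 0 by rewrite expf_neq0.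
by move: (t ^+ n) (t ^+ k) tk => p q q0; field.
Qed.

Lemma mul_interval (x y a b : int) :
  - a <= x <= a -> - b <= y <= b -> - (a * b) <= x * y <= a * b.
Proof.
by rewrite -!ler_norml normrM => xa yb; apply: ler_pM.
Qed.

(* Cramer's rule for n x1 - m y1 = c1 and n x2 - m y2 = c2. *)
Lemma cramer_bound (a b x1 y1 x2 y2 c1 c2 : int) (n m : nat) :
  n%:Z * x1 - m%:Z * y1 = c1 -> n%:Z * x2 - m%:Z * y2 = c2 ->
  x1 * y2 - x2 * y1 != 0 ->
  - a <= x1 <= a -> - a <= y1 <= a -> - a <= x2 <= a -> - a <= y2 <= a ->
  - b <= c1 <= b -> - b <= c2 <= b ->
  n%:Z <= 2 * (b * a) /\ m%:Z <= 2 * (b * a).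
Proof.
move=> e1 e2 d0 hx1 hy1 hx2 hy2 hc1 hc2.
have key (k : nat) (u z : int) : k%:Z * (x1 * y2 - x2 * y1) = u - z ->
    - (b * a) <= u <= b * a -> - (b * a) <= z <= b * a -> k%:Z <= 2 * (b * a).
  move=> e hu hz; have d1 : 1 <= `|x1 * y2 - x2 * y1| by rewrite -[1]add0r lezD1
      normr_gt0.
  apply: (@le_trans _ _ `|u - z|); last first.
    by rewrite ler_norml; move: hu hz; move: (b * a) => t; clear; lia.
  by rewrite -e normrM ger0_norm // ler_peMr.
split.
  apply: (key n (c1 * y2) (c2 * y1)); [|exact: mul_interval|exact: mul_interval].
  by rewrite -e1 -e2; clear; ring.
apply: (key m (c1 * x2) (c2 * x1)); [|exact: mul_interval|exact: mul_interval].
by rewrite -e1 -e2; clear; ring.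
Qed.

Section Recurrences.
Variables (R : realType) (F : funfield R).
Local Notation C := R[i].
Implicit Types (v w : valuation F) (f g h : F).

Definition bounded (s : seq (valuation F)) (N : nat) f : Prop :=
  [/\ f != 0, pole_bound s N f & pole_bound s N f^-1].

Lemma bounded_val s N f w : bounded s N f -> - N%:Z <= w f <= N%:Z.
Proof.
move=> [f0 fN fiN]; have := fN w; have := fiN w.
rewrite !vge_neq0 ?invr_eq0 // valV; case: ifP => _ h1 h2; apply/andP; split; lia.
Qed.

Definition bounded_seq s N (d : nat) (a alpha : 'I_d.+1 -> F) : Prop :=
  forall i, bounded s N (a i) /\ bounded s N (alpha i).

(** The case where the dominant root has a pole at [v]; for a single root [dominant_root] also
    allows [v (alpha ord0)] to be nonnegative. *)
Definition dominating v (d : nat) (a alpha : 'I_d.+1 -> F) : Prop :=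
  [/\ v (alpha ord0) < 0, forall i, i != ord0 -> v (alpha ord0) < v (alpha i) &
      immediate_effect v a alpha].

(** If all minors vanished, [al ^ (- v be) * be ^ (v al)] would have order 0 everywhere and so be
    constant, although the exponent [v al] is nonzero. *)
Lemma independent_minor v (al be : F) : al != 0 -> be != 0 -> v al < 0 ->
  mult_independent al be -> exists w, v al * w be - w al * v be != 0.
Proof.
move=> al0 be0 val' ind; apply: contrapT => nw.
have zero w : v al * w be - w al * v be = 0.
  by apply/eqP/negP => /negP ne; apply: nw; exists w.
have [|_ e] := ind (- v be) (v al); last by rewrite e in val'.
apply: no_pole_is_constant => w.
rewrite vge_neq0 ?mulf_neq0 ?expfz_neq0 // valM ?expfz_neq0 // !valXz.
by have := zero w; move: (v al) (v be) (w al) (w be) => i1 i2 i3 i4; clear; lia.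
Qed.

Section Bounds.
Variables (s : seq (valuation F)) (N : nat).
Hypotheses (us : uniq s) (N0 : (0 < N)%N) (sN : (size s <= N)%N).

(** [H + H * N] is the pole bound of [f * al^-1 ^+ H]. *)
Definition gap_bound (H : nat) : nat := abc_bound N (H + H * N).
(** The value [2 * (b * a)] of [cramer_bound] with [a = N] for the orders of the roots and
    [b = 2 * N^4 * H] for a difference of two orders. *)
Definition exponent_bound (H : nat) : nat := (4 * N * (N ^ 4 * H))%N.

(** A pole bound only limits the order from below. At a zero or pole of [psi], one of [psi] and its
    inverse has a pole, and [zero_order_bound] limits it from above. *)
Lemma support_val_bound H f w psi : bounded s N psi -> w psi != 0 ->
  f != 0 -> pole_bound s H f -> - (N ^ 4 * H)%:Z <= w f <= (N ^ 4 * H)%:Z.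
Proof.
move=> [psi0 psiN psiiN] wpsi f0 fH; apply/andP; split.
  have := fH w; rewrite vge_neq0 //.
  have : (H <= N ^ 4 * H)%N by rewrite leq_pmull // expn_gt0 N0.
  by move: (N ^ 4 * H)%N => J; case: ifP => _; clear; lia.
have [w0|w0|w0] := ltgtP (w psi) 0; last by rewrite w0 eqxx in wpsi.
  exact: (zero_order_bound us N0 sN psiN fH w0 f0).
have wi : w psi^-1 < 0 by rewrite valV oppr_lt0.
exact: (zero_order_bound us N0 sN psiiN fH wi f0).
Qed.

Section Pair.
Variables (al be : F) (v w : valuation F).
Hypotheses (alN : bounded s N al) (beN : bounded s N be) (val_al : v al < 0) (val_be :
    v be < 0).
Hypothesis (minor : v al * w be - w al * v be != 0).

Lemma exponents_of_support H f h n m psi : f != 0 -> h != 0 ->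
  pole_bound s H f -> pole_bound s H h -> bounded s N psi -> w psi != 0 ->
  (forall u : valuation F, u f + n%:Z * u al = u h + m%:Z * u be) ->
  (n <= exponent_bound H)%N /\ (m <= exponent_bound H)%N.
Proof.
move=> f0 h0 fH hH psiN wpsi eq.
have wf := support_val_bound psiN wpsi f0 fH; have wh := support_val_bound psiN wpsi h0
    hH.
have valn0 : v al != 0 by rewrite lt_eqF.
have vf := support_val_bound alN valn0 f0 fH; have vh := support_val_bound alN valn0 h0
    hH.
have [] := @cramer_bound N (2 * (N ^ 4 * H)%:Z) (v al) (v be) (w al) (w be) (v h - v f)
    (w h - w f) n m.
- by have := eq v; move: (v f) (v h) (_ * v al) (_ * v be) => i1 i2 i3 i4; clear; lia.
- by have := eq w; move: (w f) (w h) (_ * w al) (_ * w be) => i1 i2 i3 i4; clear; lia.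
- exact: minor.
- exact: bounded_val alN.
- exact: bounded_val beN.
- exact: bounded_val alN.
- exact: bounded_val beN.
- by move: vf vh; move: (v f) (v h) (N ^ 4 * H)%N => i1 i2 i3; clear; lia.
- by move: wf wh; move: (w f) (w h) (N ^ 4 * H)%N => i1 i2 i3; clear; lia.
have -> : 2 * (2 * (N ^ 4 * H)%:Z * N%:Z) = (exponent_bound H)%:Z.
  rewrite /exponent_bound; move: (N ^ 4 * H)%N => i; clear; lia.
by rewrite !lez_nat.
Qed.

Lemma exponents_of_equality H f h n m : f != 0 -> h != 0 ->
  pole_bound s H f -> pole_bound s H h -> f * al ^+ n = h * be ^+ m ->
  (n <= exponent_bound H)%N /\ (m <= exponent_bound H)%N.
Proof.
move=> f0 h0 fH hH e; have [al0 _ _] := alN; have [be0 _ _] := beN.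
have eq (u : valuation F) : u f + n%:Z * u al = u h + m%:Z * u be.
  by have := congr1 u e; rewrite !valM ?expf_neq0 // !valX.
have [wpsi|wpsi] : (w al != 0) \/ (w be != 0).
    apply/orP; rewrite -negb_and; apply: contra minor => /andP[/eqP-> /eqP->].
    by rewrite mulr0 mul0r subrr.
- exact: (exponents_of_support f0 h0 fH hH alN wpsi eq).
- exact: (exponents_of_support f0 h0 fH hH beN wpsi eq).
Qed.

(** The second alternative is the case where the two terms coincide, which [abc_inequality] excludes
    and the linear system of orders settles. *)
Lemma approximation_step H f h n m M : (N <= H)%N -> f != 0 -> h != 0 ->
  pole_bound s H f -> pole_bound s H h ->
  v (f * al ^+ n) = v (h * be ^+ m) -> 0 < M ->
  vge v (v (f * al ^+ n) + M) (f * al ^+ n - h * be ^+ m) ->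
  M <= (gap_bound H)%:Z \/ (n <= exponent_bound H)%N /\ (m <= exponent_bound H)%N.
Proof.
move=> NH f0 h0 fH hH vE M0 vM.
have [al0 alP aliP] := alN; have [be0 beP beiP] := beN.
have [e|Z0] := eqVneq (f * al ^+ n - h * be ^+ m) 0.
  right; apply: exponents_of_equality fH hH _ => //.
  by apply/eqP; rewrite -subr_eq0 e.
left; pose x := al^-1; pose y := be^-1.
have x0 : x != 0 by rewrite invr_eq0.
have y0 : y != 0 by rewrite invr_eq0.
have vx : 0 < v x by rewrite valV oppr_gt0.
have vy : 0 < v y by rewrite valV oppr_gt0.
pose f' := f * x ^+ H; pose h' := h * y ^+ H.
have integral g z : g != 0 -> pole_bound s H g -> z != 0 -> 0 < v z -> vge v 0 (g * z
    ^+ H).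
  move=> g0 gH z0 vz; have := gH v; rewrite !vge_neq0 ?mulf_neq0 ?expf_neq0 //.
  rewrite valM ?expf_neq0 // valX; have : H%:Z <= H%:Z * v z by rewrite ler_peMr //
      -[1]add0r lezD1.
  by move: (v g) (_ * v z) => i1 i2; case: ifP => _; clear; lia.
have PE : f' * y ^+ (m + H) - cst F 1 * (h' * x ^+ (n + H)) =
    (f * al ^+ n - h * be ^+ m) * (x ^+ (n + H) * y ^+ (m + H)).
  rewrite rmorph1 mul1r /f' /h' /x /y; exact: common_denominator.
have P0 : x ^+ (n + H) * y ^+ (m + H) != 0 by rewrite mulf_neq0 ?expf_neq0.
have VE : h' * x ^+ (n + H) = h * be ^+ m * (x ^+ (n + H) * y ^+ (m + H)).
  rewrite /h' /x /y; exact: clear_denominator.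
have hb0 : h * be ^+ m != 0 by rewrite mulf_neq0 ?expf_neq0.
have := @abc_inequality _ _ s N (H + H * N) (m + H) (n + H) x y f' h' 1 v us N0 sN.
cbv zeta; rewrite PE VE !(valM _ _ P0) // (mulf_neq0 Z0 P0) => abc.
have {}abc : v (f * al ^+ n - h * be ^+ m) <= v (h * be ^+ m) + (gap_bound H)%:Z.
  rewrite /gap_bound.
  suff : v (f * al ^+ n - h * be ^+ m) + v (x ^+ (n + H) * y ^+ (m + H)) <=
      v (h * be ^+ m) + v (x ^+ (n + H) * y ^+ (m + H)) + (abc_bound N (H + H * N))%:Z.
    by move: (v (_ - _)) (v (_ ^+ _ * _)) (v (h * _)) (abc_bound _ _) => i1 i2 i3 i4;
        clear; lia.
  have C10 : 1 != 0 :> C := oner_neq0 _.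
  apply: abc => //.
  - exact: leq_trans NH (leq_addr _ _).
  - by rewrite /x invrK.
  - apply: pole_bound_le beiP; exact: leq_trans NH (leq_addr _ _).
  - by apply: pole_boundM => //; apply: pole_boundX.
  - by apply: pole_boundM => //; apply: pole_boundX.
  - by rewrite mulf_neq0 ?expf_neq0.
  - by rewrite mulf_neq0 ?expf_neq0.
  - by rewrite vge_neq0 // ltW.
  - exact: integral.
  - exact: integral.
  - rewrite ltrD2r; move: vM; rewrite vge_neq0 // vE.
    by move: (v (_ - _)) (v (h * _)) M0 => i1 i2; clear; lia.
move: vM; rewrite vge_neq0 // vE.
by move: (v (_ - _)) (v (h * _)) abc => i1 i2; clear; lia.
Qed.

End Pair.

Section Sequences.
Variables (d : nat) (a alpha : 'I_d.+1 -> F).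
Hypothesis aN : bounded_seq s N a alpha.
Local Notation a0 := (a ord0).
Local Notation al := (alpha ord0).

Lemma leading_neq0 n : a0 * al ^+ n != 0.
Proof. by have [[? _ _] [? _ _]] := aN ord0; rewrite mulf_neq0 ?expf_neq0. Qed.

Lemma leading_val (u : valuation F) n : u (a0 * al ^+ n) = u a0 + n%:Z * u al.
Proof. by have [[? _ _] [? _ _]] := aN ord0; rewrite valM ?expf_neq0 // valX. Qed.

Lemma recseqE n : recseq a alpha n = a0 * al ^+ n + \sum_(i < d.+1 | i != ord0) a i *
    alpha i ^+ n.
Proof. by rewrite /recseq (bigD1 ord0). Qed.

Variable v : valuation F.
Hypothesis dom : dominating v a alpha.

(** Each power of the dominant root gains at least 1 over the others, and comparing coefficients
    loses at most [2 * N]. *)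
Lemma tail_gap n : vge v (v a0 + n%:Z * v al + n%:Z - (2 * N)%:Z)
  (recseq a alpha n - a0 * al ^+ n).
Proof.
rewrite recseqE [X in vge _ _ X]addrC addKr; apply: vge_sum => i i0.
have [aiN aliN] := aN i; have [ai0 _ _] := aiN; have [ali0 _ _] := aliN.
have [a0N _] := aN ord0.
have [_ /(_ i i0) lti _] := dom.
rewrite vge_neq0 ?mulf_neq0 ?expf_neq0 // valM ?expf_neq0 // valX.
have := bounded_val v aiN; have := bounded_val v a0N.
have : n%:Z * v al + n%:Z <= n%:Z * v (alpha i).
  by rewrite -[X in _ + X]mulr1 -mulrDr ler_wpM2l // lezD1.
by move: (_ * v al) (_ * v (alpha i)) (v (a i)) (v a0) => i1 i2 i3 i4; clear; lia.
Qed.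

(** Immediate effect gives strict dominance also for small [n], where [tail_gap] says too little;
    the exact order in [recseq_diff] rests on it. *)
Lemma tail_dominated n : (0 < n)%N ->
  vge v (v (a0 * al ^+ n) + 1) (recseq a alpha n - a0 * al ^+ n).
Proof.
move=> n0; rewrite recseqE [X in vge _ _ X]addrC addKr; apply: vge_sum => i i0.
have [[ai0 _ _] [ali0 _ _]] := aN i; have [_ _ /(_ n n0 i i0) lti] := dom.
by rewrite vge_neq0 ?mulf_neq0 ?expf_neq0 // lezD1.
Qed.

Lemma recseq_diff n n' : (0 < n')%N -> (n' < n)%N ->
  recseq a alpha n - recseq a alpha n' != 0 /\
  v (recseq a alpha n - recseq a alpha n') = v a0 + n%:Z * v al.
Proof.
move=> n'0 n'n; have n0 : (0 < n)%N by exact: leq_ltn_trans n'n.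
have [val_al _ _] := dom.
have lt : v (a0 * al ^+ n) < v (a0 * al ^+ n').
  rewrite !leading_val ltrD2l ltr_nM2r //.
have -> : recseq a alpha n - recseq a alpha n' = a0 * al ^+ n +
    (recseq a alpha n - a0 * al ^+ n - (recseq a alpha n' - a0 * al ^+ n' + a0 * al ^+
        n')).
  exact: regroup_diff.
rewrite -leading_val; apply: val_eqD; first exact: leading_neq0.
apply: vgeB; first exact: tail_dominated.
apply: vgeD.
  by apply: vgeW (tail_dominated n'0); rewrite lerD2r ltW.
by rewrite vge_neq0 ?leading_neq0 // lezD1.
Qed.

Lemma truncation (n k : nat) : (k <= n)%N ->
  a0 * al ^+ n - a0 * al ^+ (n - k) = a0 * (1 - al^-1 ^+ k) * al ^+ n.
Proof.
move=> kn; have [_ [al0 _ _]] := aN ord0.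
by rewrite -{1}(subnK kn) -{3}(subnK kn) exprD; exact: truncation_identity.
Qed.

Lemma truncation_bound k X : (k <= X)%N -> pole_bound s (N + X * N) (a0 * (1 - al^-1 ^+
    k)).
Proof.
move=> kX; have [[_ a0P _] [_ _ aliP]] := aN ord0.
apply: pole_boundM => //; apply: pole_boundD.
  by apply: pole_bound_le (pole_bound1 s).
apply: pole_boundN; apply: pole_bound_le (pole_boundX k aliP).
by rewrite leq_mul2r kX orbT.
Qed.

Lemma truncation_val n k : (0 < k)%N -> (k <= n)%N ->
  a0 * (1 - al^-1 ^+ k) != 0 /\ v (a0 * (1 - al^-1 ^+ k) * al ^+ n) = v a0 + n%:Z * v al.
Proof.
move=> k0 kn; have [[a00 _ _] [al0 _ _]] := aN ord0.
have [val_al _ _] := dom.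
have [|n1 v1] := @val_eqD _ _ v 1 (- al^-1 ^+ k) (oner_neq0 _).
  rewrite val1 vgeN vge_neq0 ?expf_neq0 ?invr_eq0 // add0r valX valV.
  have : 0 < - v al by rewrite oppr_gt0.
  by move: (- v al) k0 => i; clear; nia.
rewrite mulf_neq0 // !valM ?mulf_neq0 ?expf_neq0 // v1 val1 addr0 valX //.
Qed.

End Sequences.
End Bounds.
End Recurrences.

(** * Bounding the exponents *)

Lemma error_identity (K : comNzRingType) (g g' h h' u u' z z' : K) : g - g' = h - h' ->
  u - u' - (z - z') = (h - z) - (h' - z') - ((g - u) - (g' - u')).
Proof.
move=> e; have -> : (h - z) - (h' - z') - ((g - u) - (g' - u')) =
  (h - h') - (g - g') + (u - u' - (z - z')) by ring.
by rewrite e subrr add0r.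
Qed.

Lemma sub_add_cancel (K : comNzRingType) (u z z' : K) : u - z = u - (z - z') - z'.
Proof. by ring. Qed.

Lemma add_sub_cancel (K : comNzRingType) (u u' z : K) : u - z = u - u' - z + u'.
Proof. by ring. Qed.

Lemma add_sub_cancel2 (K : comNzRingType) (u u' z z' : K) :
  u - z = u - u' - (z - z') + u' - z'.
Proof. by ring. Qed.

Lemma collision_rearrange (K : comNzRingType) (g h g' h' : K) :
  g - h = g' - h' -> g - g' = h - h'.
Proof. by move/eqP; rewrite subr_eq => /eqP ->; ring. Qed.

(** Equal orders of the two leading terms make [n] and [m] proportional up to factors at most [N],
    so a bound on the smaller exponent bounds both. *)
Lemma comparable_exponents (N n m Y : nat) (x1 x2 y1 y2 : int) :
  x1 + n%:Z * x2 = y1 + m%:Z * y2 -> (minn n m)%:Z - (2 * N)%:Z <= Y%:Z ->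
  x2 < 0 -> y2 < 0 -> (0 < N)%N -> - N%:Z <= x1 <= N%:Z -> - N%:Z <= y1 <= N%:Z ->
  - N%:Z <= x2 -> - N%:Z <= y2 ->
  (n <= N * (Y + 2 * N + 2))%N /\ (m <= N * (Y + 2 * N + 2))%N.
Proof.
wlog nm : n m x1 x2 y1 y2 / (n <= m)%N => [wl|].
  have [nm|] := boolP (n <= m)%N; first exact: wl.
  rewrite -ltnNge => /ltnW mn e h1 h2 h3 h4 h5 h6 h7 h8; apply/and_comm.
  by apply: (wl m n y1 y2 x1 x2); rewrite // minnC.
rewrite (minn_idPl nm) => e nY x20 y20 N0 /andP[h1 h2] /andP[h3 h4] h5 h6.
have nY' : (n <= Y + 2 * N)%N by move: nY; clear; lia.
have mn : m%:Z <= N%:Z * n%:Z + (2 * N)%:Z.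
  have e1 : m%:Z <= m%:Z * - y2 by rewrite ler_peMr // -[1]add0r lezD1 oppr_gt0.
  have e2 : n%:Z * - x2 <= n%:Z * N%:Z by rewrite ler_wpM2l // lerNl.
  move: e e1 e2; rewrite !mulrN [N%:Z * _]mulrC.
  by move: (_ * x2) (_ * y2) (_ * N%:Z) h1 h2 h3 h4 => i1 i2 i3; clear; lia.
have le : (m <= N * (Y + 2 * N + 2))%N.
  have : (N * n <= N * (Y + 2 * N))%N by rewrite leq_mul2l nY' orbT.
  have -> : (N * (Y + 2 * N + 2) = N * (Y + 2 * N) + 2 * N)%N by rewrite mulnDr [(N *
      2)%N]mulnC.
  move: mn; rewrite -PoszM; move: (N * n)%N (N * _)%N => i1 i2; clear; lia.
by split=> //; exact: leq_trans nm le.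
Qed.

Section Bound.
Variables (R : realType) (F : funfield R).
Implicit Types (v w : valuation F).

(** In these definitions a height is the [truncation_bound] available once the gap is known to be at
    most [gap_bound N N], respectively [gap2 N]. *)
Definition height2 (N : nat) : nat := (N + gap_bound N N * N)%N.
Definition gap2 (N : nat) : nat := (gap_bound N N + gap_bound N (height2 N))%N.
Definition height3 (N : nat) : nat := (N + gap2 N * N)%N.
(** Sums serve as maxima. The exponent bounds cover coincidence of the two terms in each of the
    three rounds; the last summand is the outcome of [comparable_exponents]. *)
Definition core_bound (N : nat) : nat :=
  (exponent_bound N N + exponent_bound N (height2 N) + exponent_bound N (height3 N) +
   N * (gap2 N + gap_bound N (height3 N) + 2 * N + 2))%N.
Definition single_bound (N : nat) : nat := (2 * N + 2 * (N * N))%N.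

Section Fixed.
Variables (s : seq (valuation F)) (N : nat).
Hypotheses (us : uniq s) (N0 : (0 < N)%N) (sN : (size s <= N)%N).

Section TwoSequences.
Variables (d t : nat) (a alpha : 'I_d.+1 -> F) (b beta : 'I_t.+1 -> F).
Hypotheses (aN : bounded_seq s N a alpha) (bN : bounded_seq s N b beta).
Local Notation a0 := (a ord0).
Local Notation al := (alpha ord0).
Local Notation b0 := (b ord0).
Local Notation be := (beta ord0).

Lemma core_estimate v w n n' m m' :
  dominating v a alpha -> dominating v b beta -> v al * w be - w al * v be != 0 ->
  (0 < n')%N -> (n' < n)%N -> (0 < m')%N -> (m' < m)%N ->
  recseq a alpha n - recseq a alpha n' = recseq b beta m - recseq b beta m' ->
  (n <= core_bound N)%N /\ (m <= core_bound N)%N.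
Proof.
move=> da db minor n'0 n'n m'0 m'm eqn.
have [a0N alN] := aN ord0; have [b0N beN] := bN ord0.
have [val_al _ _] := da; have [val_be _ _] := db.
have [_ vGn] := recseq_diff aN da n'0 n'n; have [_ vHm] := recseq_diff bN db m'0 m'm.
have eqv : v a0 + n%:Z * v al = v b0 + m%:Z * v be by rewrite -vGn -vHm eqn.
pose k := (n - n')%N; pose l := (m - m')%N.
have k0 : (0 < k)%N by rewrite subn_gt0.
have l0 : (0 < l)%N by rewrite subn_gt0.
have kn : (k <= n)%N by exact: leq_subr.
have lm : (l <= m)%N by exact: leq_subr.
have n'E : n' = (n - k)%N by rewrite /k subKn // ltnW.
have m'E : m' = (m - l)%N by rewrite /l subKn // ltnW.
pose s0 := v a0 + n%:Z * v al; pose M0 := (minn n m)%:Z - (2 * N)%:Z.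
have van' : s0 + k%:Z <= v a0 + n'%:Z * v al.
  rewrite /s0 n'E; move: kn val_al; move: (v a0) (v al) (k) (n) => i1 i2 i3 i4; clear;
      nia.
have vbm' : s0 + l%:Z <= v b0 + m'%:Z * v be.
  rewrite /s0 eqv m'E; move: lm val_be; move: (v b0) (v be) (l) (m) => i1 i2 i3 i4;
      clear; nia.
pose E := a0 * al ^+ n - a0 * al ^+ n' - (b0 * be ^+ m - b0 * be ^+ m').
(* At the smaller exponents the tails gain less, by [k] or [l], but by [van'] and [vbm'] their
   leading terms start higher by at least as much. All four tails therefore have order at least
   [s0 + M0]. *)
have vE : vge v (s0 + M0) E.
  rewrite /E (error_identity _ _ _ _ eqn).
  have kE : k%:Z = n%:Z - n'%:Z by rewrite /k; move: n'n; clear; lia.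
  have lE : l%:Z = m%:Z - m'%:Z by rewrite /l; move: m'm; clear; lia.
  apply: vgeB; apply: vgeB.
  - apply: vgeW (tail_gap bN db m); rewrite -eqv -/s0 /M0.
    by move: (s0); clear; lia.
  - apply: vgeW (tail_gap bN db m'); rewrite /M0; move: vbm' lE.
    by move: (s0) (v b0 + _) (l) => i1 i2 i3; clear; lia.
  - apply: vgeW (tail_gap aN da n); rewrite -/s0 /M0.
    by move: (s0); clear; lia.
  - apply: vgeW (tail_gap aN da n'); rewrite /M0; move: van' kE.
    by move: (s0) (v a0 + _) (k) => i1 i2 i3; clear; lia.
have fin (Y : nat) : M0 <= Y%:Z -> (Y <= gap2 N + gap_bound N (height3 N))%N ->
    (n <= core_bound N)%N /\ (m <= core_bound N)%N.
  move=> MY Yg; suff [nY mY] : (n <= N * (Y + 2 * N + 2))%N /\ (m <= N * (Y + 2 * N +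
      2))%N.
    have le : (N * (Y + 2 * N + 2) <= core_bound N)%N.
      rewrite /core_bound; apply: leq_trans (leq_addl _ _).
      by rewrite leq_mul2l; move: Yg; clear; lia.
    by split; [exact: leq_trans nY le|exact: leq_trans mY le].
  have := bounded_val v a0N; have := bounded_val v b0N.
  have := bounded_val v alN; have := bounded_val v beN.
  move: eqv MY val_al val_be N0; rewrite /M0.
  move: (v a0) (v al) (v b0) (v be) => i1 i2 i3 i4; clear.
  move=> e MY i20 i40 N0 /andP[h1 _] /andP[h2 _] h3 h4.
  exact: (comparable_exponents e MY).
have gap_le : (gap_bound N N <= gap2 N)%N by exact: leq_addr.
have [M00|M0pos] := leP M0 0; first by apply: (fin 0%N).
have kpos : 0 < k%:Z by rewrite ltz_nat.
have lpos : 0 < l%:Z by rewrite ltz_nat.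
have expo H : H \in [:: N; height2 N; height3 N] ->
    (n <= exponent_bound N H)%N /\ (m <= exponent_bound N H)%N ->
    (n <= core_bound N)%N /\ (m <= core_bound N)%N.
  move=> HH; have le : (exponent_bound N H <= core_bound N)%N.
    by move: HH; rewrite /core_bound !inE => /or3P[]/eqP->; clear; lia.
  by case=> nH mH; split; [exact: leq_trans nH le|exact: leq_trans mH le].
have [aK_0 aK_v] := truncation_val aN da k0 kn; have [bL_0 bL_v] := truncation_val bN
    db l0 lm.
have aKE := truncation aN kn; have bLE := truncation bN lm.
rewrite -n'E in aKE; rewrite -m'E in bLE.
have a00 : a0 != 0 by case: a0N.
have b00 : b0 != 0 by case: b0N.
have va0 := leading_val aN v n; have vb0 := leading_val bN v m.
have a0P : pole_bound s N a0 by case: a0N.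
have b0P : pole_bound s N b0 by case: b0N.
have step := approximation_step us N0 sN alN beN val_al val_be minor.
have van'E : vge v (s0 + k%:Z) (a0 * al ^+ n').
  by apply: vgeW (vge_val v _); rewrite (leading_val aN).
have vbm'E : vge v (s0 + l%:Z) (b0 * be ^+ m').
  by apply: vgeW (vge_val v _); rewrite (leading_val bN).
have min2 (M1 M2 : int) (X : nat) : Num.min M1 M2 <= X%:Z -> M1 <= X%:Z \/ M2 <= X%:Z.
  by move: M1 M2 => i1 i2; clear; lia.
(* Last round: with both gaps bounded the full factors are admissible, and only the tails remain as
   error. *)
have claim3 : (k <= gap2 N)%N -> (l <= gap2 N)%N ->
    (n <= core_bound N)%N /\ (m <= core_bound N)%N.
  move=> kg lg.
  have [||Mg|ex] := step (height3 N) _ _ n m M0 (leq_addr _ _) aK_0 bL_0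
    (truncation_bound aN kg) (truncation_bound bN lg) _ M0pos.
  - by rewrite aK_v bL_v.
  - by rewrite aK_v -aKE -bLE.
  - by apply: fin Mg _; exact: leq_addl.
  - by apply: expo ex; rewrite !inE eqxx !orbT.
(* Second round, with [k] bounded: the term at [m'] is left in the error, which may limit the order
   to [l] above [s0]. *)
have claim2a : (k <= gap_bound N N)%N -> (n <= core_bound N)%N /\ (m <= core_bound N)%N.
  move=> kg.
  have [||||Mg|ex] := step (height2 N) _ _ n m (Num.min M0 l%:Z) (leq_addr _ _) aK_0 b00
    (truncation_bound aN kg) _ _ _.
  - exact: pole_bound_le (leq_addr _ _) b0P.
  - by rewrite aK_v vb0.
  - by rewrite lt_min M0pos.
  - have -> : a0 * (1 - al^-1 ^+ k) * al ^+ n - b0 * be ^+ m = E - b0 * be ^+ m'.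
      by rewrite /E -aKE; exact: sub_add_cancel.
    rewrite aK_v; apply: vgeB.
      by apply: vgeW vE; rewrite lerD2l ge_min lexx.
    by apply: vgeW vbm'E; rewrite lerD2l ge_min lexx orbT.
  - have [M0g|lg] := min2 _ _ _ Mg.
      by apply: fin M0g _; rewrite /gap2; clear; lia.
    apply: claim3; first exact: leq_trans kg gap_le.
    by apply: leq_trans (leq_addl _ _); rewrite -lez_nat.
  - by apply: expo ex; rewrite !inE eqxx !orbT.
have claim2b : (l <= gap_bound N N)%N -> (n <= core_bound N)%N /\ (m <= core_bound N)%N.
  move=> lg.
  have [||||Mg|ex] := step (height2 N) _ _ n m (Num.min M0 k%:Z) (leq_addr _ _) a00 bL_0
    _ (truncation_bound bN lg) _ _.
  - exact: pole_bound_le (leq_addr _ _) a0P.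
  - by rewrite bL_v va0.
  - by rewrite lt_min M0pos.
  - have -> : a0 * al ^+ n - b0 * (1 - be^-1 ^+ l) * be ^+ m = E + a0 * al ^+ n'.
      by rewrite /E -bLE; exact: add_sub_cancel.
    rewrite va0; apply: vgeD.
      by apply: vgeW vE; rewrite lerD2l ge_min lexx.
    by apply: vgeW van'E; rewrite lerD2l ge_min lexx orbT.
  - have [M0g|kg] := min2 _ _ _ Mg.
      by apply: fin M0g _; rewrite /gap2; clear; lia.
    apply: claim3; last exact: leq_trans lg gap_le.
    by apply: leq_trans (leq_addl _ _); rewrite -lez_nat.
  - by apply: expo ex; rewrite !inE eqxx !orbT.
(* First round: only the leading coefficients are kept, and the terms at [n'] and [m'] both count as
   error. *)
have [|||Mg|ex] := step N _ _ n m (Num.min M0 (Num.min k%:Z l%:Z)) (leqnn _) a00 b00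
    a0P b0P _ _.
- by rewrite va0 vb0.
- by rewrite !lt_min M0pos kpos.
- have -> : a0 * al ^+ n - b0 * be ^+ m = E + a0 * al ^+ n' - b0 * be ^+ m'.
    by rewrite /E; exact: add_sub_cancel2.
  rewrite va0; apply: vgeB; [apply: vgeD|].
  + by apply: vgeW vE; rewrite lerD2l ge_min lexx.
  + by apply: vgeW van'E; rewrite lerD2l !ge_min lexx orbT.
  + by apply: vgeW vbm'E; rewrite lerD2l !ge_min lexx !orbT.
- have [M0g|/min2[kg|lg]] := min2 _ _ _ Mg.
  + by apply: fin M0g _; rewrite /gap2; clear; lia.
  + by apply: claim2a; rewrite -lez_nat.
  + by apply: claim2b; rewrite -lez_nat.
- by apply: expo ex; rewrite !inE eqxx.
Qed.

End TwoSequences.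

(** At [v] the one-term side has order at least [v a0], while that of the other side falls with the
    larger [m]; this bounds it by [2 * N]. At a pole of [al] the other side then has a pole of order
    at most [N + 2 * N^2], which bounds [n1] and [n2]. *)
Lemma single_term_estimate v (a0 al : F) (t : nat) (b beta : 'I_t.+1 -> F) n1 n2 m1 m2 :
  bounded s N a0 -> bounded s N al -> bounded_seq s N b beta ->
  ~ is_constant al -> 0 <= v al -> dominating v b beta ->
  (0 < m1)%N -> (0 < m2)%N -> (n1, m1) <> (n2, m2) ->
  a0 * al ^+ n1 - a0 * al ^+ n2 = recseq b beta m1 - recseq b beta m2 ->
  (maxn (maxn n1 m1) (maxn n2 m2) <= single_bound N)%N.
Proof.
move=> a0N alN bN /pole_exists[w wal] val_al db m10 m20 ne eqn.
have [a00 _ _] := a0N; have [al0 _ _] := alN.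
have val_term (u : valuation F) n : u (a0 * al ^+ n) = u a0 + n%:Z * u al.
  by rewrite valM ?expf_neq0 // valX.
wlog m21 : n1 n2 m1 m2 m10 m20 ne eqn / (m2 < m1)%N => [wl|].
  have [m12|m21|m12] := ltngtP m1 m2; last 1 first.
  - move: eqn; rewrite m12 subrr => /eqP; rewrite subr_eq0 => /eqP /(congr1 w).
    rewrite !val_term => e; case: ne; rewrite m12; congr pair.
    by move: e wal; move: (w a0) (w al) => i1 i2; clear; nia.
  - rewrite maxnC; apply: wl => //; first by case=> e1 e2; apply: ne; rewrite e1 e2.
    by rewrite -opprB eqn opprB.
  - exact: wl.
have [S0 vS] := recseq_diff bN db m20 m21.
have bval (u : valuation F) f : bounded s N f -> - N%:Z <= u f <= N%:Z := @bounded_val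
    _ _ s N f u.
have m1N : (m1 <= 2 * N)%N.
  have : vge v (v a0) (a0 * al ^+ n1 - a0 * al ^+ n2).
    apply: vgeB; rewrite vge_neq0 ?mulf_neq0 ?expf_neq0 // val_term;
      by rewrite lerDl mulr_ge0.
  rewrite eqn vge_neq0 // vS.
  have [vbe _ _] := db; have [b0N _] := bN ord0.
  have := bval v _ a0N; have := bval v _ b0N; move: vbe.
  by move: (v a0) (v (b ord0)) (v (beta ord0)) => i1 i2 i3; clear; nia.
have wH m : (m <= 2 * N)%N -> vge w (- N%:Z - (2 * (N * N))%:Z) (recseq b beta m).
  move=> mN; apply: vge_sum => i _; have [biN beiN] := bN i.
  have [bi0 _ _] := biN; have [bei0 _ _] := beiN.
  rewrite vge_neq0 ?mulf_neq0 ?expf_neq0 // valM ?expf_neq0 // valX.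
  have := bval w _ biN; have := bval w _ beiN; move: mN.
  by move: (w (b i)) (w (beta i)) => i1 i2; clear; nia.
have wS : vge w (- N%:Z - (2 * (N * N))%:Z) (a0 * al ^+ n1 - a0 * al ^+ n2).
  by rewrite eqn; apply: vgeB; apply: wH; rewrite // ltnW // (leq_trans m21).
have nle n : vge w (- N%:Z - (2 * (N * N))%:Z) (a0 * al ^+ n) -> (n <= single_bound N)%N.
  rewrite vge_neq0 ?mulf_neq0 ?expf_neq0 // val_term /single_bound.
  have := bval w _ a0N; move: wal.
  by move: (w a0) (w al) (N * N)%N => i1 i2 i3; clear; nia.
have term_le n n' : (n' < n)%N -> vge w (- N%:Z - (2 * (N * N))%:Z) (a0 * al ^+ n - a0
    * al ^+ n') ->
    (n <= single_bound N)%N.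
  move=> n'n.
  have [||d0 wd] := @val_eqD _ _ w (a0 * al ^+ n) (- (a0 * al ^+ n')).
  - by rewrite mulf_neq0 ?expf_neq0.
  - rewrite vgeN vge_neq0 ?mulf_neq0 ?expf_neq0 // !val_term.
    by move: wal n'n; move: (w a0) (w al) => i1 i2; clear; nia.
  by rewrite vge_neq0 // wd => h; apply: nle; rewrite vge_neq0 // mulf_neq0 ?expf_neq0.
have [n12|n21|n12] := ltngtP n1 n2; last 1 first.
- by move: S0; rewrite -eqn n12 subrr eqxx.
- have n2b : (n2 <= single_bound N)%N.
    by apply: (term_le _ n1) => //; rewrite -vgeN opprB.
  by rewrite !geq_max n2b (ltnW (leq_trans n12 n2b)) /single_bound; move: m1N m21;
      clear; lia.
- have n1b := term_le _ _ n21 wS.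
  by rewrite !geq_max n1b (ltnW (leq_trans n21 n1b)) /single_bound; move: m1N m21;
      clear; lia.
Qed.

Lemma bounded_seqN (t : nat) (b beta : 'I_t.+1 -> F) :
  bounded_seq s N b beta -> bounded_seq s N (fun i => - b i) beta.
Proof.
move=> bN i; have [[b0 bP biP] beN] := bN i; split=> //.
by split; rewrite ?oppr_eq0 ?invrN //; exact: pole_boundN.
Qed.

Lemma dominatingN v (t : nat) (b beta : 'I_t.+1 -> F) :
  dominating v b beta -> dominating v (fun i => - b i) beta.
Proof. by move=> [h1 h2 h3]; split=> // n n0 i i0; rewrite !mulNr !valN; exact: h3. Qed.

Lemma recseqN (t : nat) (b beta : 'I_t.+1 -> F) n :
  recseq (fun i => - b i) beta n = - recseq b beta n.
Proof. by rewrite /recseq -sumrN; apply: eq_bigr => i _; rewrite mulNr. Qed.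

Lemma dominating_estimate v (d t : nat) (a alpha : 'I_d.+1 -> F) (b beta : 'I_t.+1 -> F)
    n1 m1 n2 m2 :
  bounded_seq s N a alpha -> bounded_seq s N b beta ->
  dominating v a alpha -> dominating v b beta ->
  mult_independent (alpha ord0) (beta ord0) ->
  (0 < n1)%N -> (0 < m1)%N -> (0 < n2)%N -> (0 < m2)%N -> (n1, m1) <> (n2, m2) ->
  recseq a alpha n1 - recseq a alpha n2 = recseq b beta m1 - recseq b beta m2 ->
  (maxn (maxn n1 m1) (maxn n2 m2) <= core_bound N)%N.
Proof.
move=> aN bN da db ind.
have [_ [al0 _ _]] := aN ord0; have [_ [be0 _ _]] := bN ord0; have [val_al _ _] := da.
have [w minor] := independent_minor al0 be0 val_al ind.
wlog n21 : n1 m1 n2 m2 / (n2 < n1)%N => [wl|] n10 m10 n20 m20 ne eqn.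
  have [n12|n21|n12] := ltngtP n1 n2; last 1 first.
  - move: eqn; rewrite n12 subrr => /esym/eqP e.
    have [m12|m21|m12] := ltngtP m1 m2; last by case: ne; rewrite n12 m12.
      have [+ _] := recseq_diff bN db m10 m12.
      by rewrite -opprB oppr_eq0 e.
    by have [+ _] := recseq_diff bN db m20 m21; rewrite e.
  - rewrite maxnC; apply: wl => //; first by case=> e1 e2; apply: ne; rewrite e1 e2.
    by rewrite -opprB eqn opprB.
  - exact: wl.
have [m12|m21|m12] := ltngtP m1 m2; last 1 first.
- have [+ _] := recseq_diff aN da n20 n21.
  by rewrite eqn m12 subrr eqxx.
- have eqn' : recseq a alpha n1 - recseq a alpha n2 =
    recseq (fun i => - b i) beta m2 - recseq (fun i => - b i) beta m1.
    by rewrite !recseqN eqn opprK addrC.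
  have [h1 h2] := core_estimate aN (bounded_seqN bN) da (dominatingN db) minor n20 n21
      m10 m12 eqn'.
  by rewrite !geq_max h1 h2 (ltnW (leq_trans n21 h1)) (ltnW (leq_trans m12 h2)).
- have [h1 h2] := core_estimate aN bN da db minor n20 n21 m20 m21 eqn.
  by rewrite !geq_max h1 h2 (ltnW (leq_trans n21 h1)) (ltnW (leq_trans m21 h2)).
Qed.

Definition total_bound (K : nat) : nat := (core_bound K + single_bound K)%N.

Lemma dominating_or_single v (d : nat) (a alpha : 'I_d.+1 -> F) :
  dominant_root v alpha -> immediate_effect v a alpha ->
  dominating v a alpha \/ 0 <= v (alpha ord0) /\ d = 0%N.
Proof.
move=> dr ie; have [v0|v0] := ltP (v (alpha ord0)) 0; [left|right].
  split=> //; case: dr => [d0 i|[]] //; case: d0 => d0.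
  by move=> /eqP; case; apply: val_inj => /=; case: i => i /=; rewrite d0; case: i.
by split=> //; case: dr => [[]|[_]] //; rewrite ltNge v0.
Qed.

Lemma dominating_single v (a alpha : 'I_1 -> F) : v (alpha ord0) < 0 -> dominating v a
    alpha.
Proof. by split=> // [i|n _ i]; rewrite ord1 eqxx. Qed.

Lemma recseq_single (a alpha : 'I_1 -> F) n : recseq a alpha n = a ord0 * alpha ord0 ^+ n.
Proof. by rewrite /recseq big_ord1. Qed.

Lemma collision_estimate v (d t : nat) (a alpha : 'I_d.+1 -> F) (b beta : 'I_t.+1 -> F)
    n1 m1 n2 m2 :
  bounded_seq s N a alpha -> bounded_seq s N b beta ->
  dominant_root v alpha -> immediate_effect v a alpha ->
  dominant_root v beta -> immediate_effect v b beta ->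
  ~ is_constant (alpha ord0) -> ~ is_constant (beta ord0) ->
  mult_independent (alpha ord0) (beta ord0) ->
  (0 < n1)%N -> (0 < m1)%N -> (0 < n2)%N -> (0 < m2)%N -> (n1, m1) <> (n2, m2) ->
  recseq a alpha n1 - recseq b beta m1 = recseq a alpha n2 - recseq b beta m2 ->
  (maxn (maxn n1 m1) (maxn n2 m2) <= total_bound N)%N.
Proof.
move=> aN bN dra iea drb ieb alnc benc ind n10 m10 n20 m20 ne eqn0.
have eqn : recseq a alpha n1 - recseq a alpha n2 = recseq b beta m1 - recseq b beta m2.
  exact: collision_rearrange.
have eqn' : recseq b beta m1 - recseq b beta m2 = recseq a alpha n1 - recseq a alpha n2
    by [].
have core u : dominating u a alpha -> dominating u b beta ->
    (maxn (maxn n1 m1) (maxn n2 m2) <= total_bound N)%N.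
  move=> da db; apply: leq_trans (leq_addr _ _).
  exact: (dominating_estimate aN bN da db).
have singleA (u : valuation F) : 0 <= u (alpha ord0) -> d = 0%N -> dominating u b beta ->
    (maxn (maxn n1 m1) (maxn n2 m2) <= total_bound N)%N.
  move=> u0 d0 db; apply: leq_trans (leq_addl _ _).
  have [a0N alN] := aN ord0; move: eqn; subst d; rewrite !recseq_single => eqn.
  exact: (single_term_estimate a0N alN bN alnc u0 db).
have singleB (u : valuation F) : 0 <= u (beta ord0) -> t = 0%N -> dominating u a alpha ->
    (maxn (maxn n1 m1) (maxn n2 m2) <= total_bound N)%N.
  move=> u0 t0 da; apply: leq_trans (leq_addl _ _).
  have [b0N beN] := bN ord0; move: eqn'; subst t; rewrite !recseq_single => eqn'.
  rewrite [maxn n1 m1]maxnC [maxn n2 m2]maxnC.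
  apply: (single_term_estimate b0N beN aN benc u0 da) => //.
  by case=> e1 e2; apply: ne; rewrite e1 e2.
have [da|[va d0]] := dominating_or_single dra iea;
  have [db|[vb t0]] := dominating_or_single drb ieb.
- exact: core da db.
- exact: singleB vb t0 da.
- exact: singleA va d0 db.
(* Both sequences have one term, so dominance is vacuous at every place, and [v] may be replaced by
   a pole of [alpha ord0]. *)
have [u ual] := pole_exists alnc.
have da : dominating u a alpha by subst d; exact: dominating_single.
have [ube|ube] := ltP (u (beta ord0)) 0; last exact: singleB ube t0 da.
by apply: core da _; subst t; exact: dominating_single.
Qed.

End Fixed.
End Bound.

(** * Computability of the bound *)

Section Computability.

Lemma recursive_ext n (f g : n.-tuple nat -> nat) : f =1 g -> recursive f -> recursive g.
Proof. by move=> /funext ->. Qed.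

Lemma recursive_comp2 n (f : nat -> nat -> nat) (k1 k2 : n.-tuple nat -> nat) :
  @recursive 2 (fun x => f (tnth x ord0) (tnth x (lift ord0 ord0))) ->
  recursive k1 -> recursive k2 -> recursive (fun x => f (k1 x) (k2 x)).
Proof.
move=> rf r1 r2; pose k (i : 'I_2) := if i == ord0 then k1 else k2.
apply: recursive_ext (@recursive_comp 2 n _ k rf _).
  by move=> x; rewrite !tnth_mktuple.
by move=> i; rewrite /k; case: ifP.
Qed.

Lemma recursive_comp1 n (f : nat -> nat) (k : n.-tuple nat -> nat) :
  computable f -> recursive k -> recursive (fun x => f (k x)).
Proof.
move=> rf rk; apply: recursive_ext (@recursive_comp 1 n _ (fun=> k) rf _) => // x.
by rewrite /thead tnth_mktuple.
Qed.

Lemma recursive_S n (k : n.-tuple nat -> nat) : recursive k -> recursive (fun x => (k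
    x).+1).
Proof. by apply: recursive_comp1; exact: recursive_succ. Qed.

Lemma recursive_addn : @recursive 2 (fun x => tnth x ord0 + tnth x (lift ord0 ord0))%N.
Proof.
apply: (@recursive_primrec 1 (fun x => tnth x ord0)
  (fun x : 3.-tuple nat => (tnth x (lift ord0 ord0)).+1)).
- exact: recursive_proj.
- by apply: recursive_S; exact: recursive_proj.
- by move=> x; rewrite tnth0 tnthS.
- by move=> y x; rewrite !tnth0 !tnthS tnth0.
Qed.

Lemma recursive_muln : @recursive 2 (fun x => tnth x ord0 * tnth x (lift ord0 ord0))%N.
Proof.
apply: (@recursive_primrec 1 (fun=> 0%N)
  (fun x : 3.-tuple nat => tnth x (lift ord0 ord0) + tnth x (lift ord0 (lift ord0
      ord0)))%N).
- exact: recursive_zero.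
- apply: (recursive_comp2 recursive_addn); exact: recursive_proj.
- by move=> x; rewrite tnth0 mul0n.
- by move=> y x; rewrite !tnth0 !tnthS tnth0 mulSn addnC.
Qed.

Lemma computable_const c : computable (fun=> c).
Proof.
elim: c => [|c IH]; first exact: recursive_zero.
exact: recursive_S IH.
Qed.

Lemma computable_succ : computable S.
Proof. exact: recursive_succ. Qed.

Lemma computable_add f g : computable f -> computable g -> computable (fun n => f n + g
    n)%N.
Proof. exact: (recursive_comp2 recursive_addn). Qed.

Lemma computable_mul f g : computable f -> computable g -> computable (fun n => f n * g
    n)%N.
Proof. exact: (recursive_comp2 recursive_muln). Qed.

Lemma computable_exp f c : computable f -> computable (fun n => f n ^ c)%N.
Proof.
move=> rf; elim: c => [|c IH]; first exact: computable_const.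
have -> : (fun n => f n ^ c.+1)%N = (fun n => f n * f n ^ c)%N.
  by apply: funext => n; rewrite expnS.
exact: computable_mul.
Qed.

Lemma computable_exponent_bound f g : computable f -> computable g ->
  computable (fun n => exponent_bound (f n) (g n)).
Proof.
move=> rf rg; rewrite /exponent_bound.
by do ?[apply: computable_mul|apply: computable_exp|exact: computable_const|done].
Qed.

Lemma computable_gap_bound f g : computable f -> computable g ->
  computable (fun n => gap_bound (f n) (g n)).
Proof.
move=> rf rg; rewrite /gap_bound /abc_bound /relation_height.
by do ?[apply: computable_mul|apply: computable_exp|apply: computable_add|exact:
    computable_const|done].
Qed.

Lemma computable_total_bound f : computable f -> computable (fun n => total_bound (f n)).
Proof.
move=> rf; rewrite /total_bound /core_bound /single_bound.
have r2 : computable (fun n => height2 (f n)).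
  by apply: computable_add => //; apply: computable_mul => //; exact:
      computable_gap_bound.
have g2 : computable (fun n => gap2 (f n)).
  by apply: computable_add; exact: computable_gap_bound.
have r3 : computable (fun n => height3 (f n)).
  by apply: computable_add => //; exact: computable_mul.
by do ?[apply: computable_mul|apply: computable_add|apply: computable_exponent_bound|
  apply: computable_gap_bound|exact: computable_const|done].
Qed.

End Computability.

(** * Integers and lengths are bounded by codes *)

Section Codes.

Lemma pickle_pairE (A B : countType) (x : A) (y : B) :
  choice.pickle (x, y) = CodeSeq.code [:: choice.pickle x; choice.pickle y].
Proof. by []. Qed.

Lemma pickle_seqE (A : countType) (s : seq A) :
  choice.pickle s = CodeSeq.code (map choice.pickle s).
Proof. by []. Qed.

Lemma mem_ltn_code x (s : seq nat) : x \in s -> (x < CodeSeq.code s)%N.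
Proof. by move/(allP (CodeSeq.ltn_code s)). Qed.

Lemma pickle_fst (A B : countType) (p : A * B) : (choice.pickle p.1 < choice.pickle p)%N.
Proof. by case: p => x y; rewrite pickle_pairE mem_ltn_code // inE eqxx. Qed.

Lemma pickle_snd (A B : countType) (p : A * B) : (choice.pickle p.2 < choice.pickle p)%N.
Proof. by case: p => x y; rewrite pickle_pairE mem_ltn_code // !inE eqxx orbT. Qed.

Lemma pickle_mem (A : countType) (x : A) (s : seq A) : x \in s -> (choice.pickle x <
    choice.pickle s)%N.
Proof. by move=> xs; rewrite pickle_seqE mem_ltn_code // map_f. Qed.

Lemma size_le_code s : (size s <= CodeSeq.code s)%N.
Proof.
elim: s => //= x s IH; apply: leq_ltn_trans IH _.
have : (0 < 2 ^ x)%N by rewrite expn_gt0.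
by rewrite -addnn; move: (2 ^ x)%N (CodeSeq.code s) => i j; clear; nia.
Qed.

Lemma size_le_pickle (A : countType) (s : seq A) : (size s <= choice.pickle s)%N.
Proof. by rewrite pickle_seqE -(size_map choice.pickle) size_le_code. Qed.

Lemma pickle_int (z : int) : (`|z| <= choice.pickle z)%N.
Proof.
case: z => n /=.
  (* By computation an integer is coded as a pair of optional naturals, with the left entry filled
     for [Posz] and the right one for [Negz]. In the latter case the strict bounds absorb the
     successor in the absolute value. *)
  have -> : choice.pickle (Posz n) = choice.pickle (Some n, None : option nat) by [].
  apply: ltnW; apply: leq_ltn_trans (pickle_fst (Some n, None : option nat)).
  have -> : choice.pickle (Some n) = CodeSeq.code [:: n] by [].
  by apply: ltnW; apply: mem_ltn_code; rewrite inE eqxx.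
have -> : choice.pickle (Negz n) = choice.pickle (None : option nat, Some n) by [].
apply: leq_ltn_trans (pickle_snd (None : option nat, Some n)).
have -> : choice.pickle (Some n) = CodeSeq.code [:: n] by [].
by apply: ltnW; apply: mem_ltn_code; rewrite inE eqxx.
Qed.

End Codes.

(** * The height parameter in terms of the coded data *)

Section DataBound.
Variables (R : realType) (F : funfield R) (g d t : nat).
Variables (a alpha : 'I_d.+1 -> F) (b beta : 'I_t.+1 -> F).

Let s := enum_fset (fset_set (zeros_poles a alpha b beta)).
(* Every integer in a pickled structure is at most its code, so the code itself
   bounds the number of places and all the valuations. *)
Let N := (data_code g a alpha b beta).+1.

(** [fset_set] returns the empty set on an infinite one, so finiteness is what makes the table list
    all zeros and poles. *)
Lemma finite_zeros_poles : finite_set (zeros_poles a alpha b beta).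
Proof.
pose A := (\bigcup_(i in [set` 'I_d.+1]) ([set w : valuation F | w (a i) != 0] `|` [set
    w : valuation F | w (alpha i) != 0]))%classic.
pose B := (\bigcup_(j in [set` 'I_t.+1]) ([set w : valuation F | w (b j) != 0] `|` [set
    w : valuation F | w (beta j) != 0]))%classic.
apply: (@sub_finite_set _ _ (A `|` B)%classic).
  by move=> w /= [[i h]|[j h]]; [left; exists i|right; exists j].
rewrite finite_setU; split; apply: bigcup_finite => // i _; rewrite finite_setU; split;
    exact: finite_support.
Qed.

Lemma mem_support w : (w \in s) = (w \in zeros_poles a alpha b beta).
Proof. exact: (in_fset_set finite_zeros_poles). Qed.

Lemma size_support : (size s <= N)%N.
Proof.
rewrite /N /data_code /divisor_table -/s.
set T := [seq _ | _ <- s]; have -> : size s = size T by rewrite size_map.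
apply: leq_trans (size_le_pickle T) _.
by apply: leqW; apply: ltnW; exact: (pickle_snd (g, T)).
Qed.

Lemma row_bound (w : valuation F) (z : int) : w \in s ->
  (let r := valuation_row a alpha b beta w in
   (z \in r.1.1.1) || (z \in r.1.1.2) || (z \in r.1.2) || (z \in r.2)) ->
  (`|z| <= N)%N.
Proof.
move=> ws /= zr; set r := valuation_row a alpha b beta w in zr.
have rT : (choice.pickle r < choice.pickle (divisor_table a alpha b beta))%N.
  by apply: pickle_mem; apply: map_f.
have TN := pickle_snd (g, divisor_table a alpha b beta).
apply: leq_trans (pickle_int z) _; apply: leqW; apply: ltnW.
apply: leq_ltn_trans TN; apply: ltnW; apply: leq_ltn_trans rT.
have h1 := pickle_fst r; have h2 := pickle_fst r.1; have h3 := pickle_fst r.1.1.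
have k1 := pickle_snd r; have k2 := pickle_snd r.1; have k3 := pickle_snd r.1.1.
move: zr; rewrite -!orbA => /or4P[]/pickle_mem h; apply: ltnW.
- exact: ltn_trans h (ltn_trans h3 (ltn_trans h2 h1)).
- exact: ltn_trans h (ltn_trans k3 (ltn_trans h2 h1)).
- exact: ltn_trans h (ltn_trans k2 h1).
- exact: ltn_trans h k1.
Qed.

Lemma bounded_of_row (f : F) : f != 0 ->
  (forall w, w \notin zeros_poles a alpha b beta -> w f = 0) ->
  (forall w, let r := valuation_row a alpha b beta w in
   (w f \in r.1.1.1) || (w f \in r.1.1.2) || (w f \in r.1.2) || (w f \in r.2)) ->
  bounded s N f.
Proof.
move=> f0 out row; split=> // w; rewrite vge_neq0 ?invr_eq0 // ?valV; case: ifP => ws.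
- by have := row_bound ws (row w); move: (w f) (N) => i j; clear; lia.
- by rewrite out // -mem_support ws.
- by have := row_bound ws (row w); move: (w f) (N) => i j; clear; lia.
- by rewrite out ?oppr0 // -mem_support ws.
Qed.

Lemma bounded_data : (forall i, a i != 0 /\ alpha i != 0) ->
  (forall j, b j != 0 /\ beta j != 0) ->
  bounded_seq s N a alpha /\ bounded_seq s N b beta.
Proof.
move=> a0 b0.
have mf k (e : 'I_k.+1 -> F) i (w : valuation F) : w (e i) \in [seq w (e i) | i <- enum
    'I_k.+1].
  by apply: map_f; rewrite mem_enum.
have out (f : F) (w : valuation F) : (w f != 0 -> zeros_poles a alpha b beta w) ->
    w \notin zeros_poles a alpha b beta -> w f = 0.
  by move=> h nw; apply/eqP; apply: contraNT nw => /h; rewrite inE.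
split=> i; [have [h1 h2] := a0 i|have [h1 h2] := b0 i]; split; apply: bounded_of_row =>
    //.
- by move=> w; apply: out => h; left; exists i; left.
- by move=> w /=; rewrite mf.
- by move=> w; apply: out => h; left; exists i; right.
- by move=> w /=; rewrite (mf _ alpha) !orbT.
- by move=> w; apply: out => h; right; exists i; left.
- by move=> w /=; rewrite (mf _ b) !orbT.
- by move=> w; apply: out => h; right; exists i; right.
- by move=> w /=; rewrite (mf _ beta) !orbT.
Qed.

End DataBound.

Theorem theorem3 (R : realType) :
  exists Phi : nat -> nat, computable Phi /\
  forall (F : funfield R) (g : nat) (d t : nat)
    (a alpha : 'I_d.+1 -> F) (b beta : 'I_t.+1 -> F),
  has_genus F g ->
  (forall i, a i != 0 /\ alpha i != 0) ->
  (forall j, b j != 0 /\ beta j != 0) ->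
  (exists v : valuation F,
     [/\ dominant_root v alpha, immediate_effect v a alpha,
         dominant_root v beta & immediate_effect v b beta]) ->
  ~ is_constant (alpha ord0) ->
  ~ is_constant (beta ord0) ->
  mult_independent (alpha ord0) (beta ord0) ->
  exists C : nat, C = Phi (data_code g a alpha b beta) /\
  forall n1 m1 n2 m2 : nat,
    (0 < n1)%N -> (0 < m1)%N -> (0 < n2)%N -> (0 < m2)%N ->
    (n1, m1) <> (n2, m2) ->
    recseq a alpha n1 - recseq b beta m1 =
      recseq a alpha n2 - recseq b beta m2 ->
    (maxn (maxn n1 m1) (maxn n2 m2) <= C)%N.
Proof.
(* The successor makes the height parameter positive, as the degree estimates require. *)
exists (fun n => total_bound n.+1); split.
  exact: computable_total_bound computable_succ.
move=> F g d t a alpha b beta _ a0 b0 [v [dra iea drb ieb]] alnc benc ind.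
exists (total_bound (data_code g a alpha b beta).+1); split=> // n1 m1 n2 m2 n10 m10
    n20 m20 ne eqn.
have [aN bN] := bounded_data g a0 b0.
exact: (collision_estimate (fset_uniq _) (ltn0Sn _) (size_support g a alpha b beta) aN bN
  dra iea drb ieb).
Qed.
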